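(* For a compact rooted weighted real tree $(T,\emptyset,d,\mu)\in\mathbb{T}$, let $\Psi_T$ be the measure on $\mathbb{T}\times\mathbb{R}_+$ defined, for every nonnegative measurable function $f$ on $\mathbb{T}\times\mathbb{R}_+$, by $$\Psi_T(f)=\int_T\mu(T_y)\,f\left(T_y,H(y)\right)\,\ell(\mathrm{d}y).$$ Then the mapping $T\mapsto\Psi_T$, from $\mathbb{T}$ endowed with the Gromov-Hausdorff-Prokhorov topology to the space $\mathcal{M}(\mathbb{T}\times\mathbb{R}_+)$ of nonnegative finite measures on $\mathbb{T}\times\mathbb{R}_+$ endowed with the topology of weak convergence, is well defined and continuous.
   Context: A real tree is a metric space $(T,d)$ in which any two points $x,y$ are joined by a unique geodesic segment $\llbracket x,y\rrbracket$ and every continuous injective path from $x$ to $y$ has range $\llbracket x,y\rrbracket$. $\mathbb{T}$ is the set of compact rooted weighted real trees $(T,\emptyset,d,\mu)$ ($\emptyset\in T$ the root, $\mu$ a nonnegative finite Borel measure on $T$), modulo root-preserving and measure-preserving isometries. For $y\in T$, $H(y)=d(\emptyset,y)$, and $T_y=\{z\in T:y\in\llbracket\emptyset,z\rrbracket\}$ is the subtree above $y$, rooted at $y$ and equipped with $d$ and $\mu_{|T_y}$. The length measure $\ell$ on $T$ is the unique $\sigma$-finite Borel measure that vanishes on the set of leaves (points $x\ne\emptyset$ such that $T\setminus\{x\}$ is connected; the set of leaves is $\{\emptyset\}$ if $T=\{\emptyset\}$) and satisfies $\ell(\llbracket x,y\rrbracket)=d(x,y)$ for all $x,y\in T$. The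 Gromov-Hausdorff-Prokhorov topology on $\mathbb{T}$ is induced by $$d_{\mathrm{GHP}}(T,T')=\inf\left\{\tfrac12\operatorname{dis}(\mathcal{R})\vee \operatorname{D}(m;\mu,\mu')\vee m(\mathcal{R}^c)\right\},$$ the infimum being over all correspondences $\mathcal{R}\subset T\times T'$ (subsets whose projections to $T$ and $T'$ are onto) with $(\emptyset,\emptyset')\in\mathcal{R}$ and all nonnegative finite measures $m$ on $T\times T'$; here $\operatorname{dis}(\mathcal{R})=\sup\{|d(x,y)-d'(x',y')|:(x,x'),(y,y')\in\mathcal{R}\}$ and $\operatorname{D}(m;\mu,\mu')=d_{\mathrm{TV}}(m\circ p^{-1},\mu)+d_{\mathrm{TV}}(m\circ p'^{-1},\mu')$, with $p,p'$ the canonical projections and $d_{\mathrm{TV}}(\mu,\nu)=\frac12\sup\{|\mu(f)-\nu(f)|: f \text{ measurable},\ \|f\|_\infty\le1\}$. $\mathbb{T}\times\mathbb{R}_+$ has the product topology. *)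

(* Defs.v *)
From HB Require Import structures.
From mathcomp Require Import all_boot all_order all_algebra.
From mathcomp Require Import all_classical all_reals all_analysis.
From mathcomp Require Import measurable_realfun.
From mathcomp Require Import lra.
Set Implicit Arguments.
Unset Strict Implicit.
Unset Printing Implicit Defensive.
Import Order.TTheory GRing.Theory Num.Theory.
Import numFieldNormedType.Exports.
Local Open Scope classical_set_scope.
Local Open Scope ring_scope.
Local Open Scope quotient_scope.

Section real_tree.
Context {R : realType}.
Implicit Types X : metricType R.

Definition geodesic X (x y : X) (g : R -> X) : Prop :=
  [/\ g 0 = x, g (mdist x y) = y &
      {in `[0, mdist x y] &, forall s t, mdist (g s) (g t) = `|s - t|}].

(* in a real tree all geodesics from x to y have the same range *)
Definition segment X (x y : X) : set X :=
  \bigcup_(g in geodesic x y) (g @` `[0, mdist x y]).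

Definition real_tree X : Prop :=
  [/\ forall x y : X, exists g, geodesic x y g,
      forall (x y : X) g h, geodesic x y g -> geodesic x y h ->
        g @` `[0, mdist x y] = h @` `[0, mdist x y] &
      forall (x y : X) (c : R -> X), {within `[0, 1], continuous c} ->
        {in `[0, 1] &, injective c} -> c 0 = x -> c 1 = y ->
        c @` `[0, 1] = segment x y].

End real_tree.

Section segment_lemmas.
Context {R : realType} {X : metricType R}.
Hypothesis tX : real_tree X.
Implicit Types x y z p : X.

Let T : forall x y z, mdist x z <= mdist x y + mdist y z := @metric_triangle R X.
Let geoex x y : exists g, geodesic x y g. Proof. by case: tX. Qed.
Let S : forall x y, mdist x y = mdist y x := @metric_sym R X.

Lemma segmentP x y z : segment x y z <-> mdist x z + mdist z y = mdist x y.
Proof.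
split=> [[g [g0 g1 gi]] [t]|xzy].
  rewrite /= in_itv/= => /andP[t0 t1] <-.
  rewrite -[x in LHS]g0 -[y in LHS]g1 ?gi ?in_itv/= ?t0 ?t1 ?lexx ?mdist_ge0//.
  by rewrite sub0r normrN distrC !ger0_norm ?subr_ge0// addrC subrK.
have [[g [g0 g1 gi]] [h [h0 h1 hi]]] := (geoex x z, geoex z y).
have dxz := mdist_ge0 x z; have dzy := mdist_ge0 z y.
pose c t := if t <= mdist x z then g t else h (t - mdist x z).
have cz : c (mdist x z) = z by rewrite /c lexx.
have c0 : c 0 = x by rewrite /c mdist_ge0.
have c1 : c (mdist x y) = y.
  rewrite /c -xzy; case: ifPn => [le|_]; last by rewrite addrAC subrr add0r.
  have zy0 : mdist z y = 0 by apply/eqP; rewrite eq_le dzy andbT; lra.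
  by rewrite zy0 addr0 g1; exact: mdist_positivity.
exists c; last by exists (mdist x z) => //=; rewrite in_itv/= dxz -xzy lerDl.
split=> // s t; rewrite !in_itv/= => /andP[s0 s1] /andP[t0 t1].
wlog st : s t s0 s1 t0 t1 / s <= t => [H|].
  have [|/ltW] := leP s t; first exact: H.
  by rewrite S distrC; exact: H.
rewrite [RHS]distrC ger0_norm ?subr_ge0// /c.
have [sz|sz] := leP s (mdist x z); have [tz|tz] := leP t (mdist x z).
- by rewrite gi ?in_itv/= ?s0 ?t0// distrC ger0_norm ?subr_ge0.
- have d1 : mdist x (g s) = s.
    by rewrite -[x in LHS]g0 gi ?in_itv/= ?s0 ?lexx// sub0r normrN ger0_norm.
  have d2 : mdist (g s) z = mdist x z - s.
    by rewrite -[z in LHS]g1 gi ?in_itv/= ?s0 ?lexx ?dxz// distrC ger0_norm ?subr_ge0.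
  have tz' : 0 <= t - mdist x z <= mdist z y by apply/andP; split; lra.
  have d3 : mdist z (h (t - mdist x z)) = t - mdist x z.
    rewrite -{1}h0 hi ?in_itv/= ?lexx//.
    by rewrite sub0r normrN ger0_norm ?subr_ge0 ?(ltW tz).
  have d4 : mdist (h (t - mdist x z)) y = mdist z y - (t - mdist x z).
    rewrite -[y in LHS]h1 hi ?in_itv/= ?lexx ?dzy//.
    by rewrite distrC ger0_norm// subr_ge0; case/andP: tz'.
  have := T (g s) z (h (t - mdist x z)).
  have := T x (g s) y; have := T (g s) (h (t - mdist x z)) y.
  move=> ? ? ?; apply/eqP; rewrite eq_le; apply/andP; split; lra.
- by move: (le_lt_trans (le_trans st tz) sz); rewrite ltxx.
- rewrite hi ?in_itv/=; [|by apply/andP; split; lra..].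
  by rewrite distrC ger0_norm; lra.
Qed.

Lemma segment_left x y : segment x y x.
Proof. by apply/segmentP; rewrite mdistxx add0r. Qed.

Lemma segment_right x y : segment x y y.
Proof. by apply/segmentP; rewrite mdistxx addr0. Qed.

Lemma geodesic_le x y g s t : geodesic x y g ->
  0 <= s <= mdist x y -> 0 <= t <= mdist x y -> mdist (g s) (g t) = `|s - t|.
Proof. by case=> _ _ gi ? ?; rewrite gi ?in_itv. Qed.

Lemma lipschitz_within (c : R -> X) (k : R) : 0 < k ->
  {in `[0, 1] &, forall s t, mdist (c s) (c t) <= k * `|s - t|} ->
  {within `[0, 1], continuous c}.
Proof.
move=> k0 cL; apply/subspace_continuousP => x x01.
apply/metricType_numDomainType.cvgrPdist_lt => e e0.
rewrite near_withinE; near=> t => t01.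
rewrite (le_lt_trans (cL _ _ _ _))//.
rewrite mulrC -ltr_pdivlMr//; near: t.
by apply: cvgr_dist_lt => //; rewrite divr_gt0.
Unshelve. all: by end_near. Qed.
End segment_lemmas.

Section convex.
Context {R : realType} {X : metricType R}.
Hypothesis tX : real_tree X.
Implicit Types o x y z p : X.

Let T : forall x y z, mdist x z <= mdist x y + mdist y z := @metric_triangle R X.
Let S : forall x y, mdist x y = mdist y x := @metric_sym R X.
Let geoex x y : exists g, geodesic x y g. Proof. by case: tX. Qed.

Lemma segment_sub x y z p : segment x y z -> segment z y p -> segment x y p.
Proof.
move=> /(segmentP tX) xzy /(segmentP tX) zpy; apply/(segmentP tX).
by have := T x z p; have := T x p y; lra.
Qed.

(* the segment from o to z lies in the union of [o, p] and [p, z] *)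
Lemma tripod o p z y : segment o z y -> segment o p y \/ segment p z y.
Proof.
have [g gg] := geoex o p; have [g0 g1 _] := gg.
have gi := geodesic_le gg.
have dop := mdist_ge0 o p.
pose f t := mdist p (g t) + mdist (g t) z.
pose E := [set t | 0 <= t <= mdist o p /\ f t <= mdist p z].
have Ep : E (mdist o p).
  by split; [rewrite dop lexx|rewrite /f g1 mdistxx add0r].
have Ei : has_inf E.
  by split; [exists (mdist o p)|exists 0 => t [/andP[]]].
pose t0 := inf E.
have t0E t : E t -> t0 <= t by move=> Et; apply: inf_lbound => //; case: Ei.
have t00 : 0 <= t0 by apply: lb_le_inf; [exists (mdist o p)|move=> t [/andP[]]].
have t0p : t0 <= mdist o p by exact: t0E.
have t0i : 0 <= t0 <= mdist o p by rewrite t00.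
have t0f : f t0 <= mdist p z.
  apply/ler_addgt0Pr => e e0.
  have e20 : 0 < e / 2 by rewrite divr_gt0.
  have [t Et tt0] := inf_adherent e20 Ei.
  have [ti ft] := Et; have t0t := t0E _ Et.
  have := gi _ _ t0i ti; rewrite distrC ger0_norm ?subr_ge0// => dt.
  have := T p (g t) (g t0); have := T (g t0) (g t) z.
  rewrite (S (g t) (g t0)) dt; move: ft tt0; rewrite /f.
  by move=> ? ? ? ?; rewrite /t0 in dt *; lra.
set q := g t0.
have pqz : segment p z q.
  apply/(segmentP tX)/eqP; rewrite eq_le T andbT; exact: t0f.
have oqd : mdist o q = t0.
  by rewrite /q -{1}g0 gi ?lexx//= sub0r normrN ger0_norm.
have oqp : segment o p q by exists g => //; exists t0 => //=; rewrite in_itv.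
have [h gh] := geoex q z; have [h0 h1 _] := gh.
have hi := geodesic_le gh.
have dqz := mdist_ge0 q z.
have hs u : 0 <= u <= mdist q z -> segment p z (h u).
  move=> u01; apply: (segment_sub pqz).
  by exists h => //; exists u => //=; rewrite in_itv.
have gs t : 0 <= t <= t0 -> segment o p (g t).
  move=> /andP[t1 t2]; exists g => //; exists t => //=.
  by rewrite in_itv/= t1 (le_trans t2).
pose k := t0 + mdist q z.
have [k0|k0] := leP k 0.
  have qz0 : mdist q z = 0 by rewrite /k in k0; lra.
  have t00' : t0 = 0 by rewrite /k in k0; lra.
  have qz : q = z by exact: mdist_positivity.
  have qo : q = o by rewrite /q t00'.
  move=> /(segmentP tX); rewrite -qz qo mdistxx => yo.
  have := mdist_ge0 o y; have := mdist_ge0 y o => ? ?.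
  have -> : y = o by apply/esym/mdist_positivity; lra.
  by left; exact: segment_left.
pose c t := if t <= t0 then g t else h (t - t0).
pose c' t := c (k * t).
have kin t : 0 <= t <= 1 -> 0 <= k * t <= k.
  by move=> /andP[a b]; rewrite mulr_ge0 ?(ltW k0)//= ler_piMr// ltW.
have cg t : t <= t0 -> c t = g t by rewrite /c => ->.
have ch t : t0 <= t -> c t = h (t - t0).
  rewrite /c le_eqVlt => /orP[/eqP <-|]; first by rewrite lexx subrr h0.
  by rewrite ltNge => /negbTE ->.
have cL s t : 0 <= s <= k -> 0 <= t <= k -> s <= t -> mdist (c s) (c t) <= t - s.
  move=> /andP[s0 sk] /andP[t0' tk] st.
  have [tt|tt] := leP t t0.
    rewrite !cg ?(le_trans st tt)// gi; last 2 first.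
    - by apply/andP; split; lra.
    - by apply/andP; split; lra.
    by rewrite distrC ger0_norm ?subr_ge0.
  have [ss|ss] := leP s t0.
    rewrite (cg s) ?(ch t) ?(ltW tt)//; apply: (le_trans (T _ q _)).
    rewrite {1}/q gi//; last by apply/andP; split; lra.
    rewrite -[q]h0 hi ?lexx//; last by apply/andP; split; rewrite /k in tk; lra.
    by rewrite distrC (distrC 0) !ger0_norm; lra.
  rewrite !ch ?(ltW ss) ?(ltW tt)// hi; last 2 first.
  - by apply/andP; split; rewrite /k in sk; lra.
  - by apply/andP; split; rewrite /k in tk; lra.
  by rewrite distrC ger0_norm; lra.
have cinj s t : 0 <= s <= k -> 0 <= t <= k -> s <= t -> c s = c t -> s = t.
  move=> /andP[s0 sk] /andP[t0' tk] st.
  have [tt|tt] := leP t t0.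
    rewrite !cg ?(le_trans st tt)// => gst.
    have sp : 0 <= s <= mdist o p by apply/andP; split; lra.
    have tp : 0 <= t <= mdist o p by apply/andP; split; lra.
    have /esym/eqP := gi s t sp tp.
    by rewrite gst mdistxx normr_eq0 subr_eq0 => /eqP.
  have ti : 0 <= t - t0 <= mdist q z by apply/andP; split; rewrite /k in tk; lra.
  rewrite (ch t) ?(ltW tt)//.
  have [ss|ss] := leP s t0.
    rewrite cg// => gh'.
    have sp : 0 <= s <= mdist o p by apply/andP; split; lra.
    have : t0 <= s.
      apply: t0E; split=> //; move: (hs _ ti); rewrite -gh'.
      by move=> /(segmentP tX) e; rewrite /f e.
    move=> t0s; have st0 : s = t0 by apply/eqP; rewrite eq_le ss.
    have zi : (0 : R) <= (0 : R) <= mdist q z by apply/andP; split.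
    have /esym/eqP := hi 0 (t - t0) zi ti.
    by rewrite h0 -gh' st0 -/q mdistxx normr_eq0 sub0r oppr_eq0 subr_eq0 => /eqP ->.
  rewrite ch ?(ltW ss)// => hst.
  have si : 0 <= s - t0 <= mdist q z by apply/andP; split; rewrite /k in sk; lra.
  have /esym/eqP := hi _ _ si ti.
  by rewrite hst mdistxx normr_eq0 subr_eq0 => /eqP/addIr.
have c'0 : c' 0 = o by rewrite /c' mulr0 cg.
have c'1 : c' 1 = z by rewrite /c' mulr1 ch /k ?lerDl// addrAC subrr add0r.
have c'c : {within `[0, 1], continuous c'}.
  apply: (lipschitz_within k0) => s t; rewrite !in_itv/= => s01 t01.
  have [st|/ltW st] := leP s t.
    rewrite distrC ger0_norm ?subr_ge0// mulrBr cL ?kin//.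
    by rewrite ler_wpM2l// ltW.
  rewrite S ger0_norm ?subr_ge0// mulrBr cL ?kin//.
  by rewrite ler_wpM2l// ltW.
have c'i : {in `[0, 1] &, injective c'}.
  move=> s t; rewrite !in_itv/= => s01 t01.
  wlog st : s t s01 t01 / s <= t => [H|].
    have [st|/ltW st] := leP s t; first exact: H.
    by move=> /esym/H-> //.
  move=> /cinj cst; apply: (mulfI (lt0r_neq0 k0)); apply: cst; rewrite ?kin//.
  by rewrite ler_wpM2l// ltW.
case: tX => _ _ /(_ _ _ _ c'c c'i c'0 c'1) <- [t]; rewrite /= in_itv/= => t01 <-.
have /andP[kt0 ktk] := kin _ t01; rewrite /c'.
have [kt|kt] := leP (k * t) t0.
  by left; rewrite cg//; apply: gs; rewrite kt0.
right; rewrite ch ?(ltW kt)//; apply: hs.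
by rewrite subr_ge0 (ltW kt)/= lerBlDl.
Qed.

Lemma up_convex o y z z' p : segment o z y -> segment o z' y ->
  segment z z' p -> segment o p y.
Proof.
move=> oz oz' /(segmentP tX) zpz.
have [//|/(segmentP tX) pyz] := tripod p oz.
have [//|/(segmentP tX) pyz'] := tripod p oz'.
have yp : y = p.
  apply/mdist_positivity/eqP; rewrite eq_le mdist_ge0 andbT.
  have := T z y z'; rewrite (S z y) (S y p); rewrite (S z p) in zpz; lra.
by rewrite yp; exact: segment_right.
Qed.

End convex.

Notation borel T := (g_sigma_algebraType (@open T)).

Section rooted.
Context {R : realType}.

(* A bare carrier is used instead of a [metricType]: a record containing a
   [metricType] lives in a universe that is too large for the type of all trees
   to be itself a topological and measurable space. *)
Record rooted_space := RootedSpace {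
  car :> Type;
  dist : car -> car -> R;
  root : car;
  distxx : forall x, dist x x = 0;
  dist_pos : forall x y, dist x y = 0 -> x = y;
  dist_sym : forall x y, dist x y = dist y x;
  dist_tri : forall y x z, dist x z <= dist x y + dist y z }.

HB.instance Definition _ (X : rooted_space) := gen_eqMixin (car X).
HB.instance Definition _ (X : rooted_space) := gen_choiceMixin (car X).
HB.instance Definition _ (X : rooted_space) := isPointed.Build (car X) (root X).
HB.instance Definition _ (X : rooted_space) := @isMetric.Build R (car X)
  (@dist X) (@distxx X) (@dist_pos X) (@dist_sym X) (@dist_tri X).

Record weighted_tree := WeightedTree {
  space :> rooted_space;
  mass : {finite_measure set (borel space) -> \bar R};
  space_tree : real_tree space;
  space_compact : compact [set: space] }.

Section sub.
Variables (X : rooted_space) (A : set X) (r : X) (Ar : A r).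

Let sval_A_inj : injective (@sval X A).
Proof.
by move=> [x Ax] [y Ay] /= xy; subst y; congr exist; exact: Prop_irrelevance.
Qed.

Definition sub_rooted : rooted_space.
Proof.
refine (@RootedSpace {x : X | A x} (fun x y => mdist (sval x) (sval y)) (exist _ r Ar)
  _ _ _ _).
- by move=> x; exact: mdistxx.
- by move=> x y /mdist_positivity/sval_A_inj.
- by move=> x y; exact: metric_sym.
- by move=> y x z; exact: metric_triangle.
Defined.

Definition sub_val (x : sub_rooted) : X := sval x.

Lemma sub_val_inj : injective sub_val. Proof. exact: sval_A_inj. Qed.

Lemma sub_valP x : A (sub_val x). Proof. exact: svalP. Qed.

Lemma sub_dist (x y : sub_rooted) : mdist x y = mdist (sub_val x) (sub_val y).
Proof. by []. Qed.

Lemma sub_image_inj (B C : set sub_rooted) :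
  sub_val @` B = sub_val @` C -> B = C.
Proof.
by move=> BC; apply/funext => x; rewrite -(image_inj sub_val_inj) BC image_inj.
Qed.

Definition sub_in (x : X) : sub_rooted :=
  if pselect (A x) is left Ax then exist _ x Ax else root sub_rooted.

Lemma sub_inK x : A x -> sub_val (sub_in x) = x.
Proof. by rewrite /sub_in; case: pselect. Qed.

Lemma sub_geodesic x y g : geodesic x y g -> geodesic (sub_val x) (sub_val y) (sub_val \o g).
Proof. by case=> g0 g1 gi; split; rewrite /= -?sub_dist ?g0 ?g1. Qed.

Lemma sub_continuous D (c : R -> sub_rooted) :
  {within D, continuous c} -> {within D, continuous (sub_val \o c)}.
Proof.
move=> cc; apply/subspace_continuousP => x Dx.
apply/metricType_numDomainType.cvgrPdist_lt => e e0.
move/subspace_continuousP : cc => /(_ _ Dx).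
by move=> /metricType_numDomainType.cvgrPdist_lt/(_ _ e0).
Qed.

Hypothesis Aconvex : forall x y, A x -> A y -> segment x y `<=` A.

Lemma sub_segment x y : real_tree X ->
  sub_val @` segment x y = segment (sub_val x) (sub_val y).
Proof.
move=> [ge gu _]; apply/seteqP; split=> [_ [z [g gg [t t01 <-] <-]]|z].
  by exists (sub_val \o g); [exact: sub_geodesic|exists t].
move=> [g gg [t t01 gtz]]; exists (sub_in z); last first.
  by rewrite sub_inK//; apply: (Aconvex (sub_valP x) (sub_valP y)); exists g => //; exists t.
have gA s : s \in `[0, mdist x y] -> sub_val (sub_in (g s)) = g s.
  move=> s01; rewrite sub_inK//; apply: (Aconvex (sub_valP x) (sub_valP y)).
  by exists g => //; exists s.
have [g0 g1 gi] := gg.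
have d0 : 0 <= mdist x y by exact: mdist_ge0.
exists (sub_in \o g); last by exists t => //=; rewrite gtz.
split=> /=.
- by apply: sub_val_inj; rewrite gA ?g0// in_itv/= lexx.
- by apply: sub_val_inj; rewrite gA ?g1// in_itv/= lexx d0.
- by move=> s u s01 u01; rewrite sub_dist !gA//; exact: gi.
Qed.

Lemma sub_tree : real_tree X -> real_tree sub_rooted.
Proof.
move=> tX; have [ge gu gc] := tX; split.
- move=> x y; have : (sub_val @` segment x y) (sub_val x).
    by rewrite sub_segment//; exact: segment_left.
  by move=> [_ [g gg _] _]; exists g.
- move=> x y g h /sub_geodesic gg /sub_geodesic gh.
  apply: sub_image_inj.
  by rewrite !image_comp; exact: gu.
- move=> x y c cc ci c0 c1.
  apply: sub_image_inj.
  rewrite image_comp sub_segment//; apply: gc => /=.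
  + exact: sub_continuous.
  + by move=> s t s01 t01 /sub_val_inj/ci; exact.
  + by rewrite c0.
  + by rewrite c1.
Qed.

Hypothesis Aclosed : closed A.

Lemma sub_compact : compact [set: X] -> compact [set: sub_rooted].
Proof.
move=> cX; have cA : compact A by apply: (subclosed_compact Aclosed cX).
move=> F FF _.
have [x [Ax xF]] : A `&` cluster (sub_val @ F) !=set0.
  by apply: cA; apply: (@filterE _ F) => x; exact: sub_valP.
exists (sub_in x); split=> // B C FB.
rewrite -metricType_numDomainType.filter_from_mdist_nbhs => -[e e0 eC].
have [_ [[y By <-] xy]] : (sub_val @` B) `&` ball x e !=set0.
  apply: xF; last exact: nbhsx_ballx.
  by apply: (@filterS _ F _ B) FB => y By; exists y.
exists y; split=> //; apply: eC; rewrite /= sub_dist sub_inK//.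
Qed.

Lemma sub_measurable (B : set (borel sub_rooted)) : measurable B ->
  measurable (sub_val @` B : set (borel X)).
Proof.
move: B; have mA : measurable (A : set (borel X)).
  rewrite -[A]setCK; apply: measurableC; apply: sub_sigma_algebra.
  exact: closed_openC.
suff H : <<s @open sub_rooted >> `<=`
    [set B | measurable (sub_val @` B : set (borel X))] by move=> B /H.
apply: smallest_sub => /=; last first.
  move=> O oO /=; pose U : set X := \bigcup_(p in [set p : X * {posnum R} |
    ball p.1 p.2%:num `&` A `<=` sub_val @` O]) (ball p.1 p.2%:num)^°.
  suff -> : sub_val @` O = A `&` U.
    apply: measurableI => //; apply: sub_sigma_algebra.
    by apply: bigcup_open => p _; exact: open_interior.
  apply/esym/seteqP; split=> [x [Ax [p pO /interior_subset px]]|_ [x Ox <-]].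
    by apply: pO.
  split; first exact: sub_valP.
  move: oO; rewrite openE => /(_ _ Ox).
  rewrite /interior -metricType_numDomainType.filter_from_mdist_nbhs => -[e e0 eO].
  exists (sub_val x, PosNum e0) => /=; last exact: nbhsx_ballx.
  move=> y [xy Ay]; exists (sub_in y); last exact: sub_inK.
  by apply: eO => /=; rewrite sub_dist sub_inK//; move: xy; rewrite ballEmdist.
split.
- by rewrite /= image_set0.
- move=> B mB; rewrite /= setTD; rewrite /= in mB.
  suff -> : sub_val @` (~` B) = A `\` sub_val @` B by exact: measurableD.
  apply/esym/seteqP; split=> [x [Ax nB]|_ [x nB <-]].
    exists (sub_in x); last exact: sub_inK.
    by move=> Bx; apply: nB; exists (sub_in x) => //; exact: sub_inK.
  by split; [exact: sub_valP|move=> [y By /sub_val_inj yx]; rewrite yx in By].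
- by move=> F mF /=; rewrite image_bigcup; apply: bigcup_measurable => k _; exact: mF.
Qed.

Variable m : {finite_measure set (borel X) -> \bar R}.

Definition sub_mass (B : set (borel sub_rooted)) : \bar R :=
  m (sub_val @` B).

Let sub_mass0 : sub_mass set0 = 0%E.
Proof. by rewrite /sub_mass image_set0 measure0. Qed.

Let sub_mass_ge0 B : (0 <= sub_mass B)%E. Proof. exact: measure_ge0. Qed.

Let sub_mass_sigma : semi_sigma_additive sub_mass.
Proof.
move=> F mF tF mUF; rewrite /sub_mass image_bigcup.
apply: (@measure_semi_sigma_additive _ _ _ m (fun n => sub_val @` F n)).
- by move=> n; exact: sub_measurable.
- apply/trivIsetP => /= i j _ _ ij; apply/seteqP; split=> // _ [[x Fx <-] [y Fy]].
  move=> /sub_val_inj yx; rewrite yx in Fy.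
  by move/trivIsetP : tF => /(_ _ _ I I ij)/seteqP[+ _]; apply; split; eassumption.
- by rewrite -image_bigcup; exact: sub_measurable.
Qed.

HB.instance Definition _ := isMeasure.Build _ _ _
  sub_mass sub_mass0 sub_mass_ge0 sub_mass_sigma.

Let sub_mass_fin : fin_num_fun sub_mass.
Proof. by move=> B mB; apply: fin_num_measure; exact: sub_measurable. Qed.

HB.instance Definition _ := @Measure_isFinite.Build _ _ _ sub_mass sub_mass_fin.

Definition sub_measure : {finite_measure set (borel sub_rooted) -> \bar R} :=
  sub_mass.

End sub.

End rooted.

Arguments rooted_space : clear implicits.
Arguments weighted_tree : clear implicits.

Section subtree.
Context {R : realType}.
Implicit Types T : weighted_tree R.

(* T_y, as a subset of T; [subtree] below is the weighted tree T_y *)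
Definition above T (y : T) : set T := [set z | segment (root T) z y].

Lemma above_self T (y : T) : above y y.
Proof. exact: (segment_right (space_tree T)). Qed.

Lemma above_convex T (y z z' : T) : above y z -> above y z' ->
  segment z z' `<=` above y.
Proof. by move=> yz yz' p; exact: (up_convex (space_tree T) yz yz'). Qed.

Lemma above_closed T (y : T) : closed (above y).
Proof.
move=> z yz; apply/(segmentP (space_tree T))/eqP.
rewrite eq_le metric_triangle andbT; apply/ler_addgt0Pr => e e0.
have e20 : 0 < e / 2 by rewrite divr_gt0.
have [z' [/(segmentP (space_tree T)) yz']] := yz _ (nbhsx_ballx z _ e20).
rewrite ballEmdist/= => zz'.
have := metric_triangle y z' z; have := metric_triangle (root T) z z'.
rewrite (metric_sym z' z); lra.
Qed.

Definition subtree T (y : T) : weighted_tree R := {|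
  space := sub_rooted (above_self y);
  mass := sub_measure (above_self y) (@above_closed T y) (mass T);
  space_tree := sub_tree (above_self y) (@above_convex T y) (@space_tree R T);
  space_compact :=
    @sub_compact R T _ _ (above_self y) (@above_closed T y) (@space_compact R T) |}.

Lemma isometry_measurable (X Y : rooted_space R) (f : X -> Y)
    (A : set (borel Y)) : (forall x y, mdist (f x) (f y) = mdist x y) ->
  measurable A -> measurable (f @^-1` A : set (borel X)).
Proof.
move=> fd; suff H : <<s @open Y >> `<=`
  [set B | measurable (f @^-1` B : set (borel X))] by exact: H.
apply: smallest_sub => /=; last first.
  move=> O oO; apply: sub_sigma_algebra.
  have /continuousP : continuous f; last exact.
  move=> x; apply/(@metricType_numDomainType.cvgrPdist_lt _ Y X (nbhs x)) => e e0.
  by apply/nbhs_ballP; exists e => // y; rewrite ballEmdist /= fd.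
split=> [|B|F mF] /=.
- by rewrite preimage_set0.
- by move=> mB; rewrite setTD preimage_setC; exact: measurableC.
- by rewrite preimage_bigcup; apply: bigcup_measurable => k _; exact: mF.
Qed.

Definition tree_iso T T' : Prop := exists f : T -> T',
  [/\ forall x y, mdist (f x) (f y) = mdist x y,
      range f = [set: T'],
      f (root T) = root T' &
      forall A : set (borel T'), measurable A -> mass T' A = mass T (f @^-1` A)].

Definition iso_rel : rel (weighted_tree R) := fun T T' => `[< tree_iso T T' >].

Lemma iso_rel_refl : reflexive iso_rel.
Proof. by move=> T; apply/asboolP; exists id; split=> //; rewrite image_id. Qed.

Lemma tree_iso_sym T T' : tree_iso T T' -> tree_iso T' T.
Proof.
move=> [f [fd fs fr fm]].
have /choice[g fg] : forall y, exists x, f x = y.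
  by move=> y; have : range f y by [rewrite fs|]; move=> [x _ <-]; exists x.
have gf x : g (f x) = x by apply/mdist_positivity; rewrite -fd fg mdistxx.
have gd x y : mdist (g x) (g y) = mdist x y by rewrite -fd !fg.
exists g; split=> //; [by apply/seteqP; split=> // x _; exists (f x)|by rewrite -fr gf|].
move=> A mA; rewrite fm; last exact: isometry_measurable.
by congr (mass T _); apply/seteqP; split=> x /=; rewrite gf.
Qed.

Lemma iso_rel_sym : symmetric iso_rel.
Proof. by move=> T T'; apply/asboolP/asboolP; exact: tree_iso_sym. Qed.

Lemma iso_rel_trans : transitive iso_rel.
Proof.
move=> T2 T1 T3 /asboolP[f [fd fs fr fm]] /asboolP hg; apply/asboolP.
move: hg => [g [gd gs gr gm]].
exists (g \o f); split=> /=.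
- by move=> x y; rewrite gd fd.
- by rewrite -image_comp fs gs.
- by rewrite fr gr.
- by move=> A mA; rewrite gm// fm//; exact: isometry_measurable.
Qed.

Definition unit_rooted : rooted_space R.
Proof.
by refine (@RootedSpace R unit (fun _ _ => 0) tt _ _ _ _) => // -[] [].
Defined.

Lemma unit_tree : real_tree unit_rooted.
Proof.
have E (x y : unit_rooted) : x = y by case: x; case: y.
split.
- move=> x y; exists (fun=> root unit_rooted); split=> // s t.
  have -> : mdist x y = 0 :> R by [].
  by rewrite !in_itv/= => /le_anti <- /le_anti <-; rewrite subrr normr0 mdistxx.
- move=> x y g h _ _; congr (image _ _); apply/funext => t; exact: E.
- move=> x y c _ ci _ _; have := ci 0 1.
  rewrite !in_itv/= !lexx ler01 => /(_ isT isT (E _ _))/eqP.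
  by rewrite eq_sym oner_eq0.
Qed.

Lemma unit_compact : compact [set: unit_rooted].
Proof.
move=> F FF _; exists (root unit_rooted); split=> // B C FB.
move=> /nbhs_singleton Cr; have [x Bx] := filter_ex FB.
by exists (root unit_rooted); split=> //; move: Bx; case: x.
Qed.

Definition unit_weighted_tree : weighted_tree R := {|
  space := unit_rooted;
  mass := mzero;
  space_tree := unit_tree;
  space_compact := unit_compact |}.

HB.instance Definition _ := gen_eqMixin (weighted_tree R).
HB.instance Definition _ := gen_choiceMixin (weighted_tree R).

Canonical iso_equiv_rel :=
  EquivRel iso_rel iso_rel_refl iso_rel_sym iso_rel_trans.

Definition tree_space : Type := {eq_quot iso_rel}.
HB.instance Definition _ := Choice.on tree_space.
HB.instance Definition _ := EqQuotient.on tree_space.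

Definition tree_class (T : weighted_tree R) : tree_space := \pi_tree_space T.

HB.instance Definition _ :=
  isPointed.Build tree_space (tree_class unit_weighted_tree).

(* Only measurable correspondences are considered: a measure is not meaningful
   on a non-measurable set. Replacing a correspondence by its closure leaves
   its distortion unchanged, so that this does not affect the infimum. *)
Definition correspondence T T' (C : set (T * T')) : Prop :=
  [/\ measurable (C : set (borel (T * T')%type)),
      fst @` C = [set: T],
      snd @` C = [set: T'] &
      C (root T, root T')].

Definition distortion T T' (C : set (T * T')) : \bar R :=
  ereal_sup [set `|mdist p.1 q.1 - mdist p.2 q.2|%:E | p in C & q in C].

Definition dTV d (S : measurableType d) (mu nu : set S -> \bar R) : \bar R :=
  (2^-1%:E * ereal_sup
    [set `|\int[mu]_x (f x)%:E - \int[nu]_x (f x)%:E| | f in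
      [set f : S -> R | measurable_fun [set: S] f /\ forall x, (`|f x| <= 1)%R]])%E.

Definition discrepancy T T' (m : set (borel (T * T')%type) -> \bar R) : \bar R :=
  (dTV (pushforward m (fst : borel (T * T')%type -> borel T)) (mass T) +
   dTV (pushforward m (snd : borel (T * T')%type -> borel T')) (mass T'))%E.

Definition dGHP T T' : \bar R := ereal_inf
  [set e | exists (C : set (T * T'))
      (m : {finite_measure set (borel (T * T')%type) -> \bar R}),
    correspondence C /\
    e = Order.max (Order.max (2^-1%:E * distortion C)%E (discrepancy m))
      (m (~` C))].

(* [dGHP] is invariant under [tree_iso], so the choice of representatives is
   immaterial; its open sets are defined from balls, without using that it is a
   metric on [tree_space]. *)
Definition GHP_open (U : set tree_space) : Prop := forall x, U x ->
  exists2 e : R, 0 < e &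
    forall y, (dGHP (repr x) (repr y) < e%:E)%E -> U y.

Let GHP_openT : GHP_open setT.
Proof. by move=> x _; exists 1. Qed.

Let GHP_openI : setI_closed GHP_open.
Proof.
move=> U V oU oV x [/oU[e e0 eU] /oV[e' e'0 eV]].
exists (Order.min e e'); first by rewrite lt_min e0.
move=> y; rewrite EFin_min lt_min => /andP[/eU ? /eV ?]; split=> //.
Qed.

Let GHP_open_bigU (I : Type) (F : I -> set tree_space) :
  (forall i, GHP_open (F i)) -> GHP_open (\bigcup_i F i).
Proof.
move=> oF x [i _ /oF[e e0 eF]]; exists e => // y /eF Fy.
by exists i.
Qed.

HB.instance Definition _ :=
  isOpenTopological.Build tree_space GHP_openT GHP_openI GHP_open_bigU.

Definition nneg_real : Type := set_type [set x : R | 0 <= x].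
HB.instance Definition _ :=
  Topological.copy nneg_real (set_type [set x : R | 0 <= x]).
HB.instance Definition _ :=
  isPointed.Build nneg_real (exist _ 0 (mem_set (lexx 0))).

Definition tree_height : Type := (tree_space * nneg_real)%type.
HB.instance Definition _ := Topological.on tree_height.
HB.instance Definition _ := Pointed.on tree_height.

Definition finite_measures : Type :=
  {finite_measure set (borel tree_height) -> \bar R}.
HB.instance Definition _ := gen_eqMixin finite_measures.
HB.instance Definition _ := gen_choiceMixin finite_measures.

(* weak convergence: the coarsest topology for which the integrals of bounded
   continuous functions are continuous *)
HB.instance Definition _ := @isSubBaseTopological.Build finite_measures
  ((tree_height -> R) * set R)%type
  [set fU | [/\ continuous fU.1,
                exists M, forall z, `|fU.1 z| <= M &
                open fU.2]]
  (fun fU => [set nu : finite_measures | fU.2 (\int[nu]_z fU.1 z)]).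

Definition leaves T : set T :=
  [set x | (x != root T /\ connected (~` [set x])) \/
           [set: T] = [set root T]].

Definition is_length_measure T (l : {measure set (borel T) -> \bar R}) : Prop :=
  [/\ sigma_finite [set: borel T] l,
      l (@leaves T) = 0%E &
      forall x y : T, l (segment x y) = (mdist x y)%:E].

(* every compact real tree has a length measure, unique on Borel sets; the
   default value [mzero] only makes the definition total *)
Definition length_measure T : {measure set (borel T) -> \bar R} :=
  if pselect (exists l, @is_length_measure T l) is left h then projT1 (cid h)
  else mzero.

Definition height T (y : T) : nneg_real :=
  exist _ (mdist (root T) y) (mem_set (mdist_ge0 (root T) y)).

Definition Psi_integrand T (f : tree_height -> \bar R) (y : T) : \bar R :=
  (mass T (above y) * f (tree_class (subtree y), height y))%E.

(* [nu] is the measure Psi_T; the first component says that the integral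
   defining it makes sense *)
Definition is_Psi T (nu : finite_measures) : Prop :=
  forall f : borel tree_height -> \bar R,
    measurable_fun [set: borel tree_height] f -> (forall z, 0 <= f z)%E ->
    measurable_fun [set: borel T] (@Psi_integrand T f) /\
    (\int[nu]_z f z = \int[length_measure T]_y @Psi_integrand T f y)%E.

End subtree.
Arguments tree_space : clear implicits.
Arguments finite_measures : clear implicits.
Arguments tree_height : clear implicits.

(* Main.v *)
(* Write x_h for the point of [root, x] at height h. Exchanging the integrals over
   pairs (x, y) with y in [root, x] gives
     Psi_T(f) = int_T mu(dx) int_0^(H x) f(T_(x_h), h) dh,
   in which the length measure has disappeared. Fix x. For all but countably many h,
   the ray does not branch at x_h and x_h is not an atom of mu, so that the points
   branching off the ray at heights close to h lie in a small ball of small mass.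
   For such h, a correspondence and a coupling that almost realise d_GHP(T, T')
   induce, through the retractions on the subtrees, a correspondence and a coupling
   of T_(x_h) with T'_(x'_h'), whenever x and x' correspond and h' is close to h.
   By dominated convergence the inner integrals at x and x' are then close, uniformly
   over corresponding pairs since T is compact, and integrating against the coupling
   shows that Psi_T(f) and Psi_T'(f) are close for f bounded, continuous and
   nonnegative. The same stability of subtrees, with T' = T, makes y |-> (T_y, H y)
   measurable. The length measure is built by adding one branch for each point of a
   dense sequence, and every length measure agrees with the Lebesgue measure of
   heights on each segment issued from the root. *)
Require Import Defs.
From HB Require Import structures.
From mathcomp Require Import all_boot all_order all_algebra.
From mathcomp Require Import all_classical all_reals all_analysis.
From mathcomp Require Import measurable_realfun.
From mathcomp Require Import lra ring.
(* [root] must denote the root of a tree, not a root of a polynomial *)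
Import Defs.
Set Implicit Arguments.
Unset Strict Implicit.
Unset Printing Implicit Defensive.
Import Order.TTheory GRing.Theory Num.Theory.
Import numFieldNormedType.Exports.
Local Open Scope classical_set_scope.
Local Open Scope ring_scope.

(** * Real trees *)

(** A correspondence does not restrict to subtrees: near the cut, a point may lie above it while its
    partner does not. The Gromov product [gp] controls this defect: [z] is above the point of the
    ray to [x] at height [h] exactly when [h <= gp x z], and a correspondence of distortion at most
    [2 * e] moves [gp] by at most [3 * e]. Membership is therefore ambiguous only for the [z] with
    [gp x z] close to [h]; these are the points that have to be few and close to the cut. Since the
    map from a point to its subtree need not be continuous, its stability is claimed only off a
    countable set of heights, and integration along rays absorbs that set. Distances between trees
    are handled through [close], at the price of constant factors that are harmless for open
    sets. *)

Section tree_geometry.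
Context {R : realType}.
Variable T : weighted_tree R.
Implicit Types (x y z : T) (h k : R).

Let tT : real_tree T := @space_tree R T.
Let dT x y z : mdist x z <= mdist x y + mdist y z := @metric_triangle R T x y z.
Let dS x y : mdist x y = mdist y x := @metric_sym R T x y.

Definition hgt x : R := mdist (root T) x.

(* the Gromov product at the root: the height at which the rays to [x] and [y] part *)
Definition gp x y : R := (hgt x + hgt y - mdist x y) / 2.

(** The truncation makes [anc x] a 1-Lipschitz map on all of [R], so that its continuity and
    measurability need no domain. *)
Definition clamp h x : R := Order.min (Order.max h 0) (hgt x).

(* the point of the segment [root, x] at height [h] truncated to [0, hgt x] *)
Definition anc x h : T :=
  projT1 (cid (let: And3 ge _ _ := tT in ge (root T) x)) (clamp h x).

Lemma hgt_ge0 x : 0 <= hgt x. Proof. exact: mdist_ge0. Qed.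

Lemma hgt_root : hgt (root T) = 0. Proof. exact: mdistxx. Qed.

Lemma hgt_lip x y : `|hgt x - hgt y| <= mdist x y.
Proof.
rewrite ler_norml; apply/andP; split.
  by have := dT (root T) x y; rewrite /hgt; lra.
by have := dT (root T) y x; rewrite /hgt (dS y x); lra.
Qed.

Lemma gpC x y : gp x y = gp y x.
Proof. by rewrite /gp dS [hgt x + _]addrC. Qed.

Lemma gpxx x : gp x x = hgt x.
Proof. by rewrite /gp mdistxx; lra. Qed.

Lemma gp_ge0 x y : 0 <= gp x y.
Proof. by have := dT x (root T) y; rewrite (dS x (root T)) /gp /hgt; lra. Qed.

Lemma gp_lel x y : gp x y <= hgt x.
Proof. by have := dT (root T) x y; rewrite /gp /hgt; lra. Qed.

Lemma gp_ler x y : gp x y <= hgt y.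
Proof. by rewrite gpC gp_lel. Qed.

Lemma gp_lip x y z : `|gp x z - gp y z| <= mdist x y.
Proof.
have := hgt_lip x y; have := dT x y z; have := dT y x z.
rewrite (dS y x) /gp !ler_norml => ? ? /andP[? ?].
by apply/andP; split; lra.
Qed.

Lemma gp_near x y : hgt x - mdist x y <= gp x y.
Proof.
have := gp_lip y x x; rewrite gpxx (gpC y) (dS y) ler_norml => /andP[]; lra.
Qed.

Lemma clamp_itv h x : 0 <= clamp h x <= hgt x.
Proof. by rewrite /clamp le_min le_max lexx orbT hgt_ge0/= ge_min lexx orbT. Qed.

Lemma clamp_id h x : 0 <= h <= hgt x -> clamp h x = h.
Proof. by move=> /andP[h0 hx]; rewrite /clamp; move/max_idPl : h0 => ->; apply/min_idPl. Qed.

Lemma anc_geodesic x : exists2 g, geodesic (root T) x g &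
  forall h, anc x h = g (clamp h x).
Proof. by rewrite /anc; case: cid => g gg; exists g. Qed.

Lemma mdist_anc2 x h k : mdist (anc x h) (anc x k) = `|clamp h x - clamp k x|.
Proof. by have [g gg E] := anc_geodesic x; rewrite !E (geodesic_le gg)// clamp_itv. Qed.

Lemma mdist_anc2_le x h k : mdist (anc x h) (anc x k) <= `|h - k|.
Proof.
rewrite mdist_anc2 /clamp.
wlog hk : h k / h <= k => [H|].
  have [|/ltW] := leP h k; first exact: H.
  by rewrite distrC (distrC h); exact: H.
have hx := hgt_ge0 x.
rewrite (distrC h) (ger0_norm (x := k - h)) ?subr_ge0// ler_norml.
rewrite /Order.min /Order.max.
by case: (ltP h 0) => ?; case: (ltP k 0) => ?; case: ltP => ?; case: ltP => ?; apply/andP; split; lra.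
Qed.

Lemma anc0 x h : h <= 0 -> anc x h = root T.
Proof.
move=> h0; have [g [g0 _ _] ->] := anc_geodesic x.
by rewrite /clamp; move/max_idPr : h0 => ->; have /min_idPl -> := hgt_ge0 x.
Qed.

Lemma anc_top x h : hgt x <= h -> anc x h = x.
Proof.
move=> hx; have [g [_ g1 _] ->] := anc_geodesic x.
rewrite /clamp; have /max_idPl -> := le_trans (hgt_ge0 x) hx.
by move/min_idPr : hx => ->.
Qed.

Lemma hgt_anc x h : hgt (anc x h) = clamp h x.
Proof.
rewrite /hgt -(anc0 x (lexx 0)) mdist_anc2 clamp_id ?lexx ?hgt_ge0// sub0r normrN.
by rewrite ger0_norm//; case/andP: (clamp_itv h x).
Qed.

Lemma hgt_anc_id x h : 0 <= h <= hgt x -> hgt (anc x h) = h.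
Proof. by move=> hx; rewrite hgt_anc clamp_id. Qed.

Lemma mdist_anc x h : mdist (anc x h) x = hgt x - clamp h x.
Proof.
rewrite -{2}(anc_top (lexx (hgt x))) mdist_anc2 [X in _ - X]clamp_id ?hgt_ge0 ?lexx//.
by rewrite distrC ger0_norm// subr_ge0; case/andP: (clamp_itv h x).
Qed.

Lemma segment_anc x h : segment (root T) x (anc x h).
Proof. by apply/(segmentP tT); rewrite mdist_anc -/(hgt _) hgt_anc /hgt; lra. Qed.

Lemma segment_ancE x y : segment (root T) x y -> y = anc x (hgt y).
Proof.
move=> s; have [[g' gg' [t + <-]] [g gg ->]] := (s, anc_geodesic x).
rewrite /= in_itv/= => t01.
have [_ /(_ _ _ _ _ gg gg') E _] := tT.
have : (g' @` `[0, mdist (root T) x]) (g' t) by exists t => //=; rewrite in_itv.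
rewrite -E => -[u /=]; rewrite in_itv/= => u01 <-; congr g.
have [g0 _ _] := gg.
have -> : hgt (g u) = u.
  rewrite /hgt -g0 (geodesic_le gg)// ?lexx ?mdist_ge0// sub0r normrN ger0_norm//.
  by case/andP: u01.
by rewrite clamp_id.
Qed.

(** Turns membership in a subtree into an inequality on distances. For the converse, [tripod] puts
    [anc x h] on the ray to [z] or between [z] and [x]; in the second case the lower bound on
    [gp x z] forces it onto the ray as well. *)
Lemma above_ancP x h z : 0 <= h <= hgt x -> above (anc x h) z <-> h <= gp x z.
Proof.
move=> hx; have ha := hgt_anc_id hx; have da := mdist_anc x h.
rewrite clamp_id// in da.
split.
  move/(segmentP tT); rewrite -/(hgt _) ha -/(hgt _) => dz.
  have := dT x (anc x h) z; rewrite (dS x (anc x h)) da /gp; lra.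
move=> hg; have [//|/(segmentP tT)] := tripod tT z (segment_anc x h).
rewrite da => dz; apply/(segmentP tT); rewrite -/(hgt _) ha -/(hgt _).
have := dT (root T) (anc x h) z; rewrite -/(hgt _) -/(hgt _) ha.
rewrite (dS z (anc x h)) (dS z x) in dz; move: hg; rewrite /gp => ? ?.
by apply/eqP; rewrite eq_le; apply/andP; split; lra.
Qed.

Lemma above_gp y z : above y z <-> hgt y <= gp y z.
Proof. by rewrite -{1}(anc_top (lexx (hgt y))) above_ancP// hgt_ge0 lexx. Qed.

Lemma anc_eq x z h : h <= gp x z -> anc x h = anc z h.
Proof.
move=> hg; have [h0|/ltW h0] := leP h 0; first by rewrite !anc0.
have hx : 0 <= h <= hgt x by rewrite h0 (le_trans hg)// gp_lel.
have /segment_ancE : above (anc x h) z by apply/above_ancP.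
by rewrite hgt_anc_id.
Qed.

(** Up to the minimum, the ray to [y] agrees with the rays to [x] and to [z], so these two agree
    with each other. *)
Lemma gp_ultra x y z : Order.min (gp x y) (gp y z) <= gp x z.
Proof.
set h := Order.min _ _.
have hxy : h <= gp x y by rewrite ge_min lexx.
have hyz : h <= gp y z by rewrite ge_min lexx orbT.
have h0 : 0 <= h by rewrite le_min !gp_ge0.
have hx : 0 <= h <= hgt x by rewrite h0 (le_trans hxy)// gp_lel.
have hy : 0 <= h <= hgt y by rewrite h0 (le_trans hxy)// gp_ler.
by apply/(above_ancP _ hx); rewrite (anc_eq hxy); apply/above_ancP.
Qed.

Lemma gp_anc x h : gp x (anc x h) = clamp h x.
Proof. by rewrite /gp hgt_anc dS mdist_anc; lra. Qed.

(** Go from [z] down to the point where its ray parts from the ray to [x], then along the latter to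
    height [h]. *)
Lemma mdist_anc_le x z h : 0 <= h <= hgt x ->
  mdist z (anc x h) <= (hgt z - gp x z) + `|gp x z - h|.
Proof.
move=> hx; set k := gp x z.
have kz : 0 <= k <= hgt z by rewrite gp_ge0 gp_ler.
have kx : 0 <= k <= hgt x by rewrite gp_ge0 gp_lel.
apply: (le_trans (dT _ (anc x k) _)); apply: lerD.
  by rewrite (@anc_eq x z)// dS mdist_anc clamp_id.
by rewrite mdist_anc2 !clamp_id.
Qed.

End tree_geometry.

(** * Topology and Borel sets of trees *)

Section metric_topology.
Context {R : realType}.
Implicit Types X Y : rooted_space R.

Lemma nbhs_mdistP X (x : X) (A : set X) :
  nbhs x A <-> exists2 e : R, 0 < e & forall y, mdist x y < e -> A y.
Proof. by rewrite -metricType_numDomainType.filter_from_mdist_nbhs; split=> -[e e0 H]; exists e. Qed.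

Lemma continuous_lip X Y (f : X -> Y) (k : R) : 0 < k ->
  (forall x y, mdist (f x) (f y) <= k * mdist x y) -> continuous f.
Proof.
move=> k0 fk x A /nbhs_mdistP[e e0 eA]; apply/nbhs_mdistP; exists (e / k).
  by rewrite divr_gt0.
by move=> y xy; apply: eA; rewrite (le_lt_trans (fk _ _))// mulrC -ltr_pdivlMr.
Qed.

Lemma continuous_lipR X (f : X -> R) (k : R) : 0 < k ->
  (forall x y, `|f x - f y| <= k * mdist x y) -> continuous f.
Proof.
move=> k0 fk x; apply/(@cvgrPdist_lt _ _ X (nbhs x)) => e e0; apply/nbhs_mdistP; exists (e / k).
  by rewrite divr_gt0.
by move=> y xy; rewrite (le_lt_trans (fk _ _))// mulrC -ltr_pdivlMr.
Qed.

Lemma continuous_fromR X (f : R -> X) : (forall h k, mdist (f h) (f k) <= `|h - k|) ->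
  continuous f.
Proof.
move=> fk x; apply/(@metricType_numDomainType.cvgrPdist_lt R X R (nbhs x)) => e e0.
apply/nbhs_ballP; exists e => //= y; rewrite /ball/= => xy.
exact: le_lt_trans (fk _ _) xy.
Qed.

Lemma mdist_lip X (x y z : X) : `|mdist x y - mdist x z| <= mdist y z.
Proof.
have := metric_triangle x y z; have := metric_triangle x z y.
by rewrite (metric_sym z y) ler_norml => ? ?; apply/andP; split; lra.
Qed.

Lemma continuous_mdist X (x : X) : continuous (mdist x : X -> R).
Proof. by apply: (@continuous_lipR _ _ 1) => // y z; rewrite mul1r mdist_lip. Qed.

Lemma open_mball X (x : X) (e : R) : open [set y | mdist x y < e].
Proof. exact: (open_comp (fun y _ => @continuous_mdist X x y) (@open_lt R e)). Qed.

Lemma closed_mball X (x : X) (e : R) : closed [set y | mdist x y <= e].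
Proof. exact: (preimage_closed (fun y _ => @continuous_mdist X x y) (@closed_le R e)). Qed.

Lemma closed_point X (x : X) : closed [set x].
Proof.
have -> : [set x] = [set y | mdist x y <= 0].
  apply/seteqP; split=> [_ -> /=|y /= xy]; first by rewrite mdistxx.
  by apply/esym/mdist_positivity/eqP; rewrite eq_le xy mdist_ge0.
exact: closed_mball.
Qed.

End metric_topology.

Section borel_sets.
Context {R : realType}.

Lemma measurable_fun_gen d (Z : measurableType d) (Y : pointedType)
    (G : set (set Y)) (f : Z -> g_sigma_algebraType G) :
  (forall U, G U -> measurable (f @^-1` U)) -> measurable_fun [set: Z] f.
Proof.
move=> fG; apply: (@measurability _ _ Z (g_sigma_algebraType G) setT f G) => //.
by move=> _ [U GU <-]; rewrite setTI; exact: fG.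
Qed.

Lemma open_borel (Y : ptopologicalType) (O : set Y) :
  open O -> measurable (O : set (borel Y)).
Proof. exact: sub_sigma_algebra. Qed.

Lemma closed_borel (Y : ptopologicalType) (A : set Y) :
  closed A -> measurable (A : set (borel Y)).
Proof. by move=> cA; rewrite -[A]setCK; apply: measurableC; apply: open_borel; exact: closed_openC. Qed.

Lemma continuous_borel (X Y : ptopologicalType) (f : X -> Y) :
  continuous f -> measurable_fun [set: borel X] (f : borel X -> borel Y).
Proof.
move=> cf; apply: measurable_fun_gen => O oO; apply: open_borel.
by move/continuousP : cf; exact.
Qed.

Lemma continuous_borelR (X : ptopologicalType) (f : X -> R) :
  continuous f -> measurable_fun [set: borel X] (f : borel X -> R).
Proof.
move=> cf; apply: (measurability _ (RGenOInfty.measurableE R)).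
move=> _ [_ [x ->] <-]; rewrite setTI; apply: open_borel.
by move/continuousP : cf; apply; exact: interval_open.
Qed.

Lemma continuous_Rborel (X : ptopologicalType) (f : R -> X) :
  continuous f -> measurable_fun [set: R] (f : R -> borel X).
Proof.
move=> cf; apply: measurable_fun_gen => O oO; apply: open_measurable.
by move/continuousP : cf; exact.
Qed.

End borel_sets.

(** * Nets, dense sequences and Borel sets of a compact tree *)

Section compact_trees.
Context {R : realType}.
Implicit Types T : weighted_tree R.

Lemma invS_lt (e : R) : 0 < e -> exists n : nat, n.+1%:R^-1 < e.
Proof. by move=> /ltr_add_invr[n]; rewrite add0r => ?; exists n. Qed.

Lemma tree_net T (e : R) : 0 < e ->
  exists s : seq T, forall x, exists2 y, y \in s & mdist y x < e.
Proof.
move=> e0; have := @space_compact R T; rewrite compact_cover.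
move=> /(_ T setT (fun y => [set x | mdist y x < e])) [].
- by move=> y _; exact: open_mball.
- by move=> x _; exists x => //=; rewrite mdistxx.
move=> D _ cD; exists (finmap.enum_fset D) => x.
by have [y yD xy] := cD x I; exists y.
Qed.

Lemma tree_dense T : exists u : nat -> T,
  forall y (e : R), 0 < e -> exists n, mdist (u n) y < e.
Proof.
have npos n : (0 : R) < n.+1%:R^-1 by [].
have /choice[net netP] := fun n => @tree_net T _ (npos n).
(* The index codes a net of radius [n.+1%:R^-1] and a position in it; the root is a harmless
   default. *)
exists (fun m => if unpickle m is Some (n, i) then nth (root T) (net n) i else root T).
move=> y e e0.
have [N Ne] := invS_lt e0.
have [z zs zy] := netP N y.
exists (pickle (N, index z (net N))); rewrite pickleK nth_index//.
exact: lt_trans zy Ne.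
Qed.

Definition dense_seq T : nat -> T := projT1 (cid (tree_dense T)).

Lemma dense_seqP T (y : T) (e : R) : 0 < e -> exists n, mdist (dense_seq T n) y < e.
Proof. by rewrite /dense_seq; case: cid => u /= H; exact: H. Qed.

Lemma hgt_bounded T : exists2 K : R, 0 < K & forall x : T, hgt x <= K.
Proof.
have [s sP] := @tree_net T 1 ltr01.
pose K := \sum_(y <- s) hgt y + 1.
have sum0 (r : seq T) : 0 <= \sum_(y <- r) hgt y.
  by apply: sumr_ge0 => y _; exact: hgt_ge0.
exists K; first by have := sum0 s; rewrite /K; lra.
move=> x; have [y ys yx] := sP x.
have : hgt y <= \sum_(y <- s) hgt y.
  rewrite (big_rem y)//= lerDl; exact: sum0.
by have := hgt_lip y x; rewrite ler_norml => /andP[]; rewrite /K; lra.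
Qed.

(** The target carries the Borel sets of the product topology. By separability an open set is a
    countable union of rectangles of balls with centres in the dense sequences, and these pull back
    to measurable sets. *)
Lemma measurable_fun_pair_borel d (Z : measurableType d) T T'
    (a : Z -> borel T) (b : Z -> borel T') :
  measurable_fun [set: Z] a -> measurable_fun [set: Z] b ->
  measurable_fun [set: Z] (fun z => (a z, b z) : borel (T * T')%type).
Proof.
move=> ma mb; apply: measurable_fun_gen => O oO.
pose U (X : weighted_tree R) i k := [set x : X | mdist (dense_seq X i) x < k.+1%:R^-1].
have mU (X : weighted_tree R) (c : Z -> borel X) i k :
    measurable_fun [set: Z] c -> measurable (c @^-1` (U X i k)).
  by move=> mc; rewrite -[X in measurable X]setTI; apply: mc => //; apply: open_borel; exact: open_mball.
(* The first set does not depend on [z]: it is everything or empty, and so selects the rectangles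
   contained in [O]. *)
pose W i j k := [set z | (U T i k) `*` (U T' j k) `<=` O] `&`
  (a @^-1` (U T i k) `&` b @^-1` (U T' j k)).
have mW i j k : measurable (W i j k).
  rewrite /W; have [H|H] := pselect ((U T i k) `*` (U T' j k) `<=` O).
    have -> : [set _ : Z | (U T i k) `*` (U T' j k) `<=` O] = setT by apply/seteqP; split.
    by rewrite setTI; apply: measurableI; exact: mU.
  have -> : [set _ : Z | (U T i k) `*` (U T' j k) `<=` O] = set0 by apply/seteqP; split.
  by rewrite set0I.
suff -> : (fun z => (a z, b z)) @^-1` O = \bigcup_i \bigcup_j \bigcup_k W i j k.
  by do 3 (apply: bigcupT_measurable => ?); exact: mW.
apply/seteqP; split=> [z /= Oz|z [i _ [j _ [k _ [WO [Wa Wb]]]]]]; last exact: (WO (a z, b z)).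
have [[A B] /= [/nbhs_mdistP[e1 e10 eA] /nbhs_mdistP[e2 e20 eB]] AB] : nbhs (a z, b z) O.
  exact: open_nbhs_nbhs.
have [N Ne] : exists n : nat, n.+1%:R^-1 < Order.min e1 e2 / 2.
  by apply: invS_lt; rewrite divr_gt0// lt_min e10.
have npos : (0 : R) < N.+1%:R^-1 by [].
have [i ia] := dense_seqP (a z) npos; have [j jb] := dense_seqP (b z) npos.
have m1 : Order.min e1 e2 <= e1 by rewrite ge_min lexx.
have m2 : Order.min e1 e2 <= e2 by rewrite ge_min lexx orbT.
exists i => //; exists j => //; exists N => //; split=> // -[x y] [/= ix jy].
apply: AB; split=> /=.
  apply: eA; rewrite (le_lt_trans (@metric_triangle R T (a z) (dense_seq T i) x))//.
  rewrite (metric_sym (a z)) (lt_le_trans (ltrD ia ix))// (le_trans _ m1)//.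
  by rewrite [leRHS]splitr ltW// ltrD.
apply: eB; rewrite (le_lt_trans (@metric_triangle R T' (b z) (dense_seq T' j) y))//.
rewrite (metric_sym (b z)) (lt_le_trans (ltrD jb jy))// (le_trans _ m2)//.
by rewrite [leRHS]splitr ltW// ltrD.
Qed.

Lemma measurable_hgt T : measurable_fun [set: borel T] (@hgt R T : borel T -> R).
Proof. by apply: continuous_borelR => /=; exact: continuous_mdist. Qed.

Lemma continuous_anc T (x : T) : continuous (anc x).
Proof. apply: continuous_fromR => h k; exact: mdist_anc2_le. Qed.

Lemma measurable_anc T (x : T) : measurable_fun [set: R] (anc x : R -> borel T).
Proof. by apply: continuous_Rborel => h; exact: continuous_anc. Qed.

Lemma measurable_above T (y : T) : measurable (above y : set (borel T)).
Proof. by apply: (@closed_borel T); exact: (@above_closed R T y). Qed.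

Lemma measurable_point T (y : T) : measurable ([set y] : set (borel T)).
Proof. by apply: (@closed_borel T); exact: (@closed_point R T y). Qed.

Lemma measurable_mball T (y : T) (e : R) : measurable ([set z | mdist y z < e] : set (borel T)).
Proof. by apply: open_borel; exact: open_mball. Qed.

Lemma closed_ray T (x : T) : closed (segment (root T) x).
Proof.
have -> : segment (root T) x = [set y | mdist x y + hgt y <= hgt x].
  apply/seteqP; split=> y.
    by move/(segmentP (space_tree T)); rewrite -/(hgt _) -/(hgt _) (metric_sym y x) /= addrC => ->.
  move=> /= H; apply/(segmentP (space_tree T))/eqP; rewrite eq_le metric_triangle andbT.
  by rewrite (metric_sym y x) addrC.
apply: (preimage_closed _ (@closed_le R (hgt x))) => y _.
apply: (@continuous_lipR _ _ _ 2) => // {}y z.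
have := mdist_lip x y z; have := hgt_lip y z.
rewrite !ler_norml => /andP[? ?] /andP[? ?]; apply/andP; split; lra.
Qed.

Lemma measurable_ray T (x : T) : measurable (segment (root T) x : set (borel T)).
Proof. by apply: (@closed_borel T); exact: (@closed_ray T x). Qed.

End compact_trees.

Section rays.
Context {R : realType}.
Variable T : weighted_tree R.
Implicit Types (x y z : T) (h : R).

Let tT : real_tree T := @space_tree R T.
Let dS x y : mdist x y = mdist y x := @metric_sym R T x y.

Lemma ray_ancP x y h : 0 <= h <= hgt x ->
  segment (root T) y (anc x h) <-> h <= gp x y.
Proof. exact: above_ancP. Qed.

Lemma ray_gp x y z : segment (root T) x z -> segment (root T) y z -> hgt z <= gp x y.
Proof.
move=> zx zy; have zE := segment_ancE zx.
have hz : 0 <= hgt z <= hgt x.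
  rewrite hgt_ge0/=; move/(segmentP tT): zx; rewrite -/(hgt _) -/(hgt _).
  by have := mdist_ge0 z x; lra.
by apply/(ray_ancP _ hz); rewrite -zE.
Qed.

Lemma mdist_gp x y : mdist x y = hgt x + hgt y - gp x y *+ 2.
Proof. by rewrite /gp -mulr_natr; lra. Qed.

Lemma ray_mdist x z : segment (root T) x z -> mdist z x = hgt x - hgt z.
Proof. by move/(segmentP tT); rewrite -/(hgt _) -/(hgt _) => <-; lra. Qed.

Lemma ray_hgt x z : segment (root T) x z -> 0 <= hgt z <= hgt x.
Proof. by move=> zx; rewrite hgt_ge0/= -subr_ge0 -(ray_mdist zx) mdist_ge0. Qed.

Lemma ray_le x y z : segment (root T) x z -> hgt z <= gp x y -> segment (root T) y z.
Proof. by move=> zx zg; rewrite (segment_ancE zx); apply/(ray_ancP _ (ray_hgt zx)). Qed.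

Lemma segment_sym x y z : segment x y z -> segment y x z.
Proof. by move=> /(segmentP tT) H; apply/(segmentP tT); rewrite (dS y z) (dS z x) (dS y x); lra. Qed.

Lemma segment_ray x y z : segment (root T) x z -> gp x y <= hgt z -> segment x y z.
Proof.
move=> zx gz; have dz := ray_mdist zx; have := ray_hgt zx => /andP[z0 zX].
have gxz : gp x z = hgt z by rewrite {1}(segment_ancE zx) gp_anc clamp_id// z0.
have gyz : gp z y = gp x y.
  apply/eqP; rewrite eq_le; apply/andP; split.
    have := gp_ultra x z y; rewrite gxz ge_min => /orP[|//] gz'.
    by apply: le_trans (gp_lel z y) gz'.
  by have := gp_ultra z x y; rewrite (gpC z x) gxz; move/min_idPr : gz => ->.
by apply/(segmentP tT); rewrite (dS x z) dz (mdist_gp z) gyz (mdist_gp x); lra.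
Qed.

(** The segment is cut at the point where the two rays part; the strict inequality on one side
    assigns that point to the other and makes the union disjoint. *)
Lemma segment_rays x y : segment x y =
  (segment (root T) x `&` [set z | gp x y < hgt z]) `|`
  (segment (root T) y `&` [set z | gp x y <= hgt z]).
Proof.
apply/seteqP; split=> z; last first.
  move=> [[zx /ltW gz]|[zy gz]]; first exact: segment_ray.
  by apply/segment_sym/segment_ray => //; rewrite gpC.
move=> s; have := s => /(segmentP tT).
have [zx|zx] : segment (root T) x z \/ segment (root T) y z.
- by have [/segment_sym|] := tripod tT (root T) s; [left|right].
- rewrite (dS x z) (ray_mdist zx) => E.
  have [gz|zg] := ltP (gp x y) (hgt z); [by left|right].
  have zy := ray_le zx zg; split=> //=.
  by move: E; rewrite (ray_mdist zy) (mdist_gp x); lra.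
- rewrite (ray_mdist zx) => E; right; split=> //=.
  rewrite leNgt; apply/negP => zg.
  have zy : segment (root T) x z by apply: (ray_le zx); rewrite gpC ltW.
  by move: E; rewrite (dS x z) (ray_mdist zy) (mdist_gp x); lra.
Qed.

Lemma measurable_hgt_gt (c : R) : measurable ([set z : T | c < hgt z] : set (borel T)).
Proof.
have := @measurable_hgt R T measurableT `]c, +oo[%classic (measurable_itv _).
by rewrite setTI; congr measurable; apply/seteqP; split=> z /=; rewrite in_itv/= andbT.
Qed.

Lemma measurable_hgt_ge (c : R) : measurable ([set z : T | c <= hgt z] : set (borel T)).
Proof.
have := @measurable_hgt R T measurableT `[c, +oo[%classic (measurable_itv _).
by rewrite setTI; congr measurable; apply/seteqP; split=> z /=; rewrite in_itv/= andbT.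
Qed.

End rays.

(** * Length measure *)

Section image_measure.
Context d1 d2 (T1 : measurableType d1) (T2 : measurableType d2) (R : realType).
Variables (m : {measure set T1 -> \bar R}) (f : T1 -> T2).
Hypothesis mf : measurable_fun [set: T1] f.

Definition image_measure : {measure set T2 -> \bar R} :=
  measure_function_pushforward__canonical__measure_function_Measure m mf.

Lemma image_measureE A : image_measure A = m (f @^-1` A).
Proof. by []. Qed.

Lemma integral_image_measure (g : T2 -> \bar R) : measurable_fun [set: T2] g ->
  (forall x, 0 <= g x)%E -> (\int[image_measure]_x g x = \int[m]_x g (f x))%E.
Proof.
move=> mg g0; have := @ge0_integral_pushforward _ _ _ _ R f mf m setT g measurableT mg.
by rewrite preimage_setT; apply => y _; exact: g0.
Qed.

End image_measure.

Section integral_mrestr.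
Context d (T : measurableType d) (R : realType).
Variables (m : {measure set T -> \bar R}) (D : set T) (mD : measurable D).

Lemma integral_mrestr (g : T -> \bar R) : measurable_fun [set: T] g ->
  (forall x, 0 <= g x)%E -> (\int[mrestr m mD]_x g x = \int[m]_(x in D) g x)%E.
Proof.
move=> mg g0; rewrite -(setUv D) ge0_integral_setU//; last 3 first.
- exact: measurableC.
- by rewrite setUv.
- by apply/disj_setPCl.
rewrite [X in (_ + X)%E](_ : _ = 0%E) ?adde0.
  by apply: eq_measure_integral => A mA AD; rewrite /= /mrestr setIidl.
apply: null_set_integral => //; [exact: measurableC| |].
  exact: measurable_funTS.
by rewrite /= /mrestr setICl measure0.
Qed.

End integral_mrestr.

Section ray_measure.
Context {R : realType}.
Variable T : weighted_tree R.
Implicit Types x y : T.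

Notation RR := (measurableTypeR R).
Let mu : {measure set RR -> \bar R} := @lebesgue_measure R.

Lemma lebesgue_cc (c : R) : 0 <= c -> lebesgue_measure `[0, c]%classic = c%:E.
Proof.
move=> c0; rewrite lebesgue_measure_itv/= lte_fin; case: ltP => [_|c0'].
  by rewrite -EFinB subr0.
by congr EFin; apply/eqP; rewrite eq_le c0 c0'.
Qed.

Lemma lebesgue_oc (b c : R) : b <= c -> lebesgue_measure `]b, c]%classic = (c - b)%:E.
Proof.
move=> bc; rewrite lebesgue_measure_itv/= lte_fin; case: ltP => [_|bc']; first by rewrite -EFinB.
by congr EFin; apply/eqP; rewrite eq_sym subr_eq0 eq_le bc bc'.
Qed.

(** The open half-lines generate the Borel sets and are stable under intersection; finiteness of the
    total mass lets values pass from a half-line to its complement. *)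
Lemma measure_half_lines (m1 m2 : {measure set RR -> \bar R}) (K : R) :
  m1 setT = K%:E -> m2 setT = K%:E ->
  (forall c : R, m1 `]-oo, c]%classic = m2 `]-oo, c]%classic) ->
  forall B, measurable B -> m1 B = m2 B.
Proof.
move=> m1K m2K m12.
have mI c : measurable (`]-oo, c]%classic : set RR) by exact: measurable_itv.
have mJ c : measurable (`]c, +oo[%classic : set RR) by exact: measurable_itv.
have sp (m : {measure set RR -> \bar R}) c :
    m setT = (m `]-oo, c]%classic + m `]c, +oo[%classic)%E.
  rewrite -measureU; [congr (m _)|exact: mI|exact: mJ|].
    apply/seteqP; split=> // h _ /=; rewrite !in_itv/= andbT.
    by have [|] := leP h c; [left|right].
  by rewrite -subset0 => h /=; rewrite !in_itv/= andbT => -[]; lra.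
have le1 (m : {measure set RR -> \bar R}) A : measurable A -> m setT = K%:E -> (m A <= K%:E)%E.
  by move=> mA <-; apply: le_measure; rewrite ?inE.
have lt1 (m : {measure set RR -> \bar R}) A : measurable A -> m setT = K%:E -> m A \is a fin_num.
  by move=> mA mK; rewrite ge0_fin_numE// (le_lt_trans (le1 _ _ mA mK))// ltry.
have cover : \bigcup_k `](- k%:R : R), +oo[%classic = setT.
  apply/seteqP; split=> // h _; exists (Num.truncn `|h|).+1 => //=.
  rewrite in_itv/= andbT; have := Num.Theory.truncnS_gt `|h|; rewrite ltr_norml => /andP[+ _].
  by [].
apply: (@measure_unique _ R RR (@RGenOInfty.G R : set (set RR)) (fun k => `](- k%:R)%R, +oo[%classic : set RR)).
- exact: RGenOInfty.measurableE.
- move=> _ _ [b ->] [c ->]; exists (Order.max b c).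
  by apply/seteqP; split=> h /=; rewrite !in_itv/= !andbT gt_max => /andP.
- by move=> k; exists (- k%:R).
- exact: cover.
- move=> _ [c ->]; have := sp m1 c; rewrite m1K -m2K (sp m2 c) m12 => /esym.
  move=> E; have F := lt1 m2 _ (mI c) m2K.
  by apply/eqP; rewrite eq_le -(leeD2lE _ _ F) E lexx -(leeD2lE _ _ F) E lexx.
- by move=> k; rewrite (le_lt_trans (le1 m1 _ (mJ _) m1K))// ltry.
Qed.

Variable l : {measure set (borel T) -> \bar R}.
Hypothesis lray : forall x : T, l (segment (root T) x) = (hgt x)%:E.

Let mD x : measurable (`[0, hgt x]%classic : set RR).
Proof. exact: measurable_itv. Qed.

Lemma measurable_anc_pre x (A : set (borel T)) : measurable A ->
  measurable (anc x @^-1` A : set RR).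
Proof. by move=> mA; rewrite -[X in measurable X]setTI; exact: measurable_anc. Qed.

(** The image of [l] on the ray under [hgt] agrees with Lebesgue measure on half-lines, because the
    part of the ray below height [a] is the ray to [anc x a]. Only the lengths of rays are assumed,
    so the result also serves while a length measure is being constructed. *)
Lemma ray_measure x (A : set (borel T)) : measurable A ->
  l (A `&` segment (root T) x) = lebesgue_measure (anc x @^-1` A `&` `[0, hgt x]%classic).
Proof.
move=> mA.
pose m1 := image_measure (mrestr l (@measurable_ray R T x))
  (@measurable_hgt R T : measurable_fun setT (@hgt R T : borel T -> RR)).
pose m2 : {measure set RR -> \bar R} := mrestr mu (mD x).
have m12 : m1 (anc x @^-1` A) = m2 (anc x @^-1` A).
  apply: (@measure_half_lines _ _ (hgt x)); last exact: measurable_anc_pre.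
  - by rewrite /m1 image_measureE preimage_setT /= /mrestr setTI lray.
  - by rewrite /m2/= /mrestr setTI; apply: lebesgue_cc; exact: hgt_ge0.
  move=> a; rewrite /m1 image_measureE /m2/= /mrestr.
  have [a0|a0] := ltP a 0.
    rewrite [X in l X = _](_ : _ = set0); last first.
      rewrite -subset0 => z /= [+ _]; rewrite in_itv/=.
      by have := hgt_ge0 z; lra.
    rewrite [X in _ = _ X](_ : _ = set0) ?measure0//.
    by rewrite -subset0 => h /=; rewrite !in_itv/= => -[? /andP[? _]]; lra.
  transitivity (l (segment (root T) (anc x a))).
    congr (l _); apply/seteqP; split=> z /=; rewrite in_itv/=.
      move=> [za zx]; rewrite (segment_ancE zx).
      have zi := ray_hgt zx; rewrite -(segment_ancE zx).
      apply: (ray_le zx); rewrite gp_anc /clamp le_min (proj2 (andP zi)) le_max za.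
      by [].
    move=> za; have := ray_hgt za; rewrite hgt_anc => /andP[z0 zc].
    have zx : segment (root T) x z by apply: (ray_le za); rewrite gpC gp_anc.
    split=> //; apply: (le_trans zc); rewrite /clamp ge_min; apply/orP; left.
    by rewrite ge_max lexx.
  rewrite lray hgt_anc.
  have -> : `]-oo, a]%classic `&` `[0, hgt x]%classic = `[0, clamp a x]%classic.
    apply/seteqP; split=> h /=; rewrite !in_itv/= /clamp le_min le_max.
      by move=> [-> /andP[-> ->]].
    by move=> /andP[h0 /andP[/orP[ha|h0'] hx]]; rewrite h0 hx; split=> //; lra.
  by apply/esym/lebesgue_cc; case/andP: (clamp_itv a x).
transitivity (m1 (anc x @^-1` A)); last exact: m12.
rewrite /m1 image_measureE /= /mrestr; congr (l _).
by apply/seteqP; split=> z /= [Az zx]; split=> //; move: Az; rewrite -(segment_ancE zx).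
Qed.

Lemma integral_ray x (g : borel T -> \bar R) : measurable_fun [set: borel T] g ->
  (forall y, 0 <= g y)%E ->
  (\int[l]_(y in segment (root T) x) g y =
   \int[lebesgue_measure]_(h in `[0%R, hgt x]) g (anc x h))%E.
Proof.
move=> mg g0.
have mray := @measurable_ray R T x.
pose m2 : {measure set RR -> \bar R} := mrestr mu (mD x).
pose m1 : {measure set (borel T) -> \bar R} := mrestr l mray.
pose m3 := image_measure m2 (@measurable_anc R T x : measurable_fun setT (anc x : RR -> borel T)).
transitivity (\int[m1]_y g y)%E; first by rewrite /m1 integral_mrestr.
transitivity (\int[m3]_y g y)%E.
  apply: eq_measure_integral => A mA _.
  by rewrite /m1 /m3 image_measureE /m2/= /mrestr; exact: ray_measure.
rewrite /m3 integral_image_measure//.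
rewrite (@integral_mrestr _ _ _ mu _ (mD x) (fun h => g (anc x h)))//.
exact: measurableT_comp mg (@measurable_anc R T x).
Qed.

End ray_measure.

(** * Construction of the length measure, branch by branch *)

Section length_measure_existence.
Context {R : realType}.
Variable T : weighted_tree R.
Implicit Types (x y z : T) (n k : nat).

Notation RR := (measurableTypeR R).
Let tT : real_tree T := @space_tree R T.
Let u := dense_seq T.

(** Leaving the subtree above [x] requires passing through [x], which is farther from [z] than [w]
    is. Hence the subtree without its root is open. *)
Lemma above_neq_open x z : above x z -> z != x ->
  forall w, mdist z w < mdist z x -> above x w /\ w != x.
Proof.
move=> xz zx w zw; split; last first.
  by apply/eqP => wx; move: zw; rewrite wx ltxx.
apply/above_gp; have xz' := ray_mdist xz; have [_ hxz] := andP (ray_hgt xz).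
have gxz : gp x z = hgt x.
  by apply/eqP; rewrite eq_le gp_lel; apply/above_gp.
rewrite leNgt; apply/negP => gxw.
have gzw : gp z w <= gp x w.
  have := gp_ultra x z w; rewrite gxz ge_min => /orP[|//] H.
  by have := le_lt_trans H gxw; rewrite ltxx.
have := gp_ler x w; have := mdist_gp z w; move: xz'; rewrite metric_sym.
rewrite -mulr_natr; lra.
Qed.

Definition tip n : R := \big[Order.max/0]_(k < n) gp (u n) (u k).

Let tip_ge0 n : 0 <= tip n.
Proof. by rewrite /tip; elim/big_ind: _ => // [a b a0 b0|k _]; rewrite ?le_max ?a0// gp_ge0. Qed.

Let tip_le n k : (k < n)%N -> gp (u n) (u k) <= tip n.
Proof. by move=> kn; rewrite /tip (bigD1 (Ordinal kn))//= le_max lexx. Qed.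

Let tip_lt n h : 0 < h -> (forall k, (k < n)%N -> gp (u n) (u k) < h) -> tip n < h.
Proof.
move=> h0 H; rewrite /tip; elim/big_ind: _ => // [a b ah bh|k _]; last exact: H.
by rewrite gt_max ah.
Qed.

Let mI n : measurable (`]tip n, hgt (u n)]%classic : set RR).
Proof. exact: measurable_itv. Qed.

Let mu : {measure set RR -> \bar R} := @lebesgue_measure R.

Let branch n := image_measure (mrestr mu (mI n))
  (@measurable_anc R T (u n) : measurable_fun setT (anc (u n) : RR -> borel T)).

(* the branch of [u n] above height [tip n] is what [u n] adds to the tree
   spanned by [u 0, ..., u (n - 1)] *)
Definition branch_length : {measure set (borel T) -> \bar R} := mseries branch 0.

Let branchE n A : branch n A = lebesgue_measure (anc (u n) @^-1` A `&` `]tip n, hgt (u n)]%classic).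
Proof. by []. Qed.

(** The top of a branch is a single height, hence null, so only its interior matters. *)
Let branch_length0 A : (forall n h, tip n < h < hgt (u n) -> ~ A (anc (u n) h)) ->
  branch_length A = 0%E.
Proof.
move=> HA; rewrite /branch_length/= /mseries eseries0// => n _ _.
rewrite branchE; apply: countable_lebesgue_measure0.
apply: (sub_countable (B := [set hgt (u n)])); last exact: countable1.
apply: subset_card_le => h /= []; rewrite in_itv/= => Ah /andP[h1].
rewrite le_eqVlt => /orP[/eqP//|h2]; exfalso; apply: HA Ah.
by rewrite h1 h2.
Qed.

(** Branch [n] meets the ray to [x] exactly at the heights in [J n]. By [gp_ultra] these intervals
    are disjoint, and they cover all heights below [hgt x], so their lengths add up. *)
Let branch_length_ray x : branch_length (segment (root T) x) = (hgt x)%:E.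
Proof.
pose J n : set RR := `]tip n, gp (u n) x]%classic.
have mJ n : measurable (J n) by exact: measurable_itv.
have JE n : branch n (segment (root T) x) = mu (J n).
  rewrite branchE; congr (lebesgue_measure _); apply/seteqP; split=> h /=; rewrite !in_itv/=.
    move=> [xh /andP[h1 hu]]; have h0 : 0 < h := le_lt_trans (tip_ge0 n) h1.
    have hi : 0 <= h <= hgt (u n) by rewrite (ltW h0).
    by rewrite /J/= in_itv/= h1; move/(above_ancP _ hi) : xh.
  rewrite /J/= in_itv/= => /andP[h1 hg]; have h0 : 0 < h := le_lt_trans (tip_ge0 n) h1.
  have hu : h <= hgt (u n) by exact: le_trans hg (gp_lel _ _).
  have hi : 0 <= h <= hgt (u n) by rewrite (ltW h0).
  by rewrite h1 hu; split=> //; apply/(above_ancP _ hi).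
rewrite /branch_length/= /mseries (eq_eseriesr (fun n _ => JE n)).
have tJ : trivIset setT J.
  apply/trivIsetP => i j _ _.
  wlog ij : i j / (i < j)%N => [H ij|_].
    have := ij; rewrite neq_ltn => /orP[?|?]; first exact: H.
    by rewrite setIC; apply: H; rewrite // eq_sym.
  rewrite /J -subset0 => h /=; rewrite !in_itv/= => -[/andP[hi1 hi2] /andP[hj1 hj2]].
  have := gp_ultra (u j) x (u i); rewrite (gpC x).
  have := tip_le ij => H1 H2.
  have : h <= gp (u j) (u i) by apply: le_trans H2; rewrite le_min hj2.
  by move=> /le_trans/(_ H1); rewrite leNgt hj1.
rewrite -measure_semi_bigcup//; last exact: bigcupT_measurable.
have J1 : `]0, hgt x[%classic `<=` \bigcup_n J n.
  move=> h /=; rewrite in_itv/= => /andP[h0 hx].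
  (* Density gives some [u n] whose ray follows the ray to [x] up to height [h]; for the first such
     [n], minimality puts [h] strictly above [tip n]. *)
  have /ex_minnP[n hn minn] : exists n, h <= gp (u n) x.
    have e0 : 0 < hgt x - h by rewrite subr_gt0.
    have [n nx] := dense_seqP x e0; exists n.
    by have := gp_near x (u n); rewrite gpC metric_sym /u; lra.
  exists n => //; rewrite /J/= in_itv/= hn andbT; apply: tip_lt => // k kn.
  rewrite ltNge; apply/negP => hk.
  have := gp_ultra (u k) (u n) x; rewrite gpC => H.
  suff /minn : h <= gp (u k) x by rewrite leqNgt kn.
  by apply: le_trans H; rewrite le_min hk hn.
have J2 : \bigcup_n J n `<=` `]0, hgt x]%classic.
  move=> h [n _]; rewrite /J/= !in_itv/= => /andP[h1 h2].
  by rewrite (le_lt_trans (tip_ge0 n) h1) (le_trans h2 (gp_ler _ _)).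
apply/eqP; rewrite eq_le; apply/andP; split.
  rewrite -[hgt x]subr0 -(lebesgue_oc (hgt_ge0 x)).
  by apply: le_measure => //; rewrite inE; [exact: bigcupT_measurable|exact: measurable_itv].
have -> : (hgt x)%:E = mu `]0, hgt x[%classic.
  rewrite /mu/= lebesgue_measure_itv/= lte_fin; case: ltP => [_|h0]; first by rewrite -EFinB subr0.
  by congr EFin; apply/eqP; rewrite eq_le h0 hgt_ge0.
by apply: le_measure => //; rewrite inE; [exact: measurable_itv|exact: bigcupT_measurable].
Qed.

Let branch_length_segment x y : branch_length (segment x y) = (mdist x y)%:E.
Proof.
have lr := @ray_measure R T branch_length branch_length_ray.
have g0 := gp_ge0 x y; have gx := gp_lel x y; have gy := gp_ler x y.
rewrite segment_rays measureU; last 3 first.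
- apply: measurableI; [exact: measurable_ray|exact: measurable_hgt_gt].
- apply: measurableI; [exact: measurable_ray|exact: measurable_hgt_ge].
- rewrite -subset0 => z /= -[[zx gz] [zy _]].
  by have := ray_gp zx zy; rewrite leNgt gz.
rewrite (setIC (segment _ x)) (setIC (segment _ y)).
pose A1 : set (borel T) := [set z | gp x y < hgt z].
pose A2 : set (borel T) := [set z | gp x y <= hgt z].
transitivity (lebesgue_measure (anc x @^-1` A1 `&` `[0%R, hgt x]%classic) +
    lebesgue_measure (anc y @^-1` A2 `&` `[0%R, hgt y]%classic))%E.
  congr (_ + _)%E; first exact: (lr x _ (measurable_hgt_gt (gp x y))).
  exact: (lr y _ (measurable_hgt_ge (gp x y))).
rewrite [X in (lebesgue_measure X + _)%E](_ : _ = `]gp x y, hgt x]%classic); last first.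
  rewrite /A1 /A2; apply/seteqP; split=> h /=; rewrite !in_itv/= ?hgt_anc.
    by move=> [+ hx]; rewrite clamp_id// => ->; case/andP: hx.
  by move=> /andP[h1 h2]; rewrite clamp_id h2 ?andbT ?h1 ?(ltW (le_lt_trans g0 h1)).
rewrite [X in (_ + lebesgue_measure X)%E](_ : _ = `[gp x y, hgt y]%classic); last first.
  rewrite /A1 /A2; apply/seteqP; split=> h /=; rewrite !in_itv/= ?hgt_anc.
    by move=> [+ hx]; rewrite clamp_id// => ->; case/andP: hx.
  by move=> /andP[h1 h2]; rewrite clamp_id h2 ?andbT ?h1 ?(le_trans g0 h1).
rewrite lebesgue_oc// lebesgue_measure_itv/= lte_fin; case: ltP => [_|h0].
  by rewrite -EFinB -EFinD; congr EFin; rewrite (mdist_gp x); lra.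
by rewrite adde0; congr EFin; rewrite (mdist_gp x); lra.
Qed.

Let branch_length_leaves : branch_length (@leaves R T) = 0%E.
Proof.
apply: branch_length0 => n h /andP[h1 h2].
have h0 : 0 < h by exact: le_lt_trans (tip_ge0 n) h1.
have hi : 0 <= h <= hgt (u n) by rewrite !ltW.
set x := anc (u n) h; have hx : hgt x = h by rewrite hgt_anc_id.
have xu : above x (u n) by exact: segment_anc.
have ux : u n != x by apply/eqP => E; move: h2; rewrite E hx ltxx.
move=> [[_ cx]|rT]; last first.
  have : [set: T] x by [].
  by rewrite rT /= => xr; move: h0; rewrite -hx xr hgt_root ltxx.
have xr : x != root T by apply/eqP => xr; move: h0; rewrite -hx xr hgt_root ltxx.
(* An interior point [x] of a branch separates [u n] from the root: the part strictly above it is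
   nonempty, and both open and closed in the complement of [x]. If that complement were connected,
   this part would be all of it and contain the root. *)
suff E : [set z | above x z /\ z != x] = ~` [set x].
  have : (~` [set x]) (root T) by move=> /= /eqP; rewrite eq_sym (negPf xr).
  rewrite -E /= => -[/above_gp xg _].
  by have := le_trans xg (gp_ler _ _); rewrite hx hgt_root leNgt h0.
apply: cx.
- by exists (u n).
- exists [set z | above x z /\ z != x].
    rewrite openE => z [xz zx]; apply/nbhs_mdistP; exists (mdist z x).
      by rewrite mdist_gt0.
    by move=> w; exact: above_neq_open.
  by apply/seteqP; split=> z /=; [move=> [? zx]; split=> //; exact/eqP|case].
- exists (above x); first exact: above_closed.
  by apply/seteqP; split=> z /=; [move=> [? /eqP]|move=> [/eqP]].
Qed.

Let branch_length_sigma_finite : sigma_finite [set: borel T] branch_length.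
Proof.
pose F n : set T := segment (root T) (u n) `\` [set u n].
have mF n : measurable (F n : set (borel T)).
  by apply: measurableD; [exact: measurable_ray|exact: measurable_point].
(* Index 0 holds what the truncated rays miss, a null set; the other indices hold rays, of finite
   length. *)
exists (fun n => if n is k.+1 then segment (root T) (u k) else ~` \bigcup_k F k).
  apply/seteqP; split=> // x _.
  have [[k _ [xk _]]|nx] := pselect ((\bigcup_k F k) x); first by exists k.+1.
  by exists 0%N.
move=> [|k]; last first.
  by rewrite branch_length_ray ltry; split=> //; exact: measurable_ray.
split; first by apply: measurableC; exact: bigcupT_measurable.
rewrite branch_length0// => n h /andP[h1 h2]; apply; exists n => //; split.
  exact: segment_anc.
have h0 : 0 < h by exact: le_lt_trans (tip_ge0 n) h1.
have hi : 0 <= h <= hgt (u n) by rewrite !ltW.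
by move=> /= E; move: h2; rewrite -E hgt_anc_id// ltxx.
Qed.

Lemma length_measure_exists : exists l, @is_length_measure R T l.
Proof. by exists branch_length; split. Qed.

End length_measure_existence.

Section length_measure.
Context {R : realType}.
Variable T : weighted_tree R.

Lemma length_measureP : is_length_measure (length_measure T).
Proof.
rewrite /length_measure; case: pselect => [h|]; first by case: cid.
by have := length_measure_exists T.
Qed.

Lemma length_ray (x : T) : length_measure T (segment (root T) x) = (hgt x)%:E.
Proof. by have [_ _ ->] := length_measureP. Qed.

End length_measure.

(** * Correspondences and couplings *)

Section finite_measures.
Context d (S : measurableType d) (R : realType).
Variable m : {measure set S -> \bar R}.

(** Taking the bound as an argument lets the instance of finite measure be attached to this name. *)
Definition finite_measure_fun of (m setT < +oo)%E : set S -> \bar R := m.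

Variable mfin : (m setT < +oo)%E.
Local Notation fm := (finite_measure_fun mfin).

Let fm0 : fm set0 = 0%E. Proof. exact: measure0. Qed.
Let fm_ge0 A : (0 <= fm A)%E. Proof. exact: measure_ge0. Qed.
Let fm_sigma : semi_sigma_additive fm.
Proof. exact: measure_semi_sigma_additive. Qed.

HB.instance Definition _ := isMeasure.Build _ _ _ fm fm0 fm_ge0 fm_sigma.

Let fin : fin_num_fun fm.
Proof.
move=> A mA; rewrite ge0_fin_numE// (le_lt_trans _ mfin)//.
by apply: le_measure; rewrite ?inE.
Qed.

HB.instance Definition _ := @Measure_isFinite.Build _ _ _ fm fin.

Definition finite_measure_of : {finite_measure set S -> \bar R} := fm.

End finite_measures.

Lemma finite_lty d (S : measurableType d) (R : realType)
  (m : {finite_measure set S -> \bar R}) (A : set S) : measurable A -> (m A < +oo)%E.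
Proof. by move=> mA; rewrite -ge0_fin_numE// fin_num_measure. Qed.

Section near_measures.
Context d (S : measurableType d) (R : realType).
Implicit Types (mu nu : {measure set S -> \bar R}) (e : R).

(** Two additive inequalities in place of the absolute value of a difference: they make sense for
    infinite integrals and can be chained without subtraction. *)
Definition near_measure (mu nu : set S -> \bar R) e := forall f : S -> \bar R,
  measurable_fun [set: S] f -> (forall x, 0 <= f x <= 1)%E ->
  (\int[mu]_x f x <= \int[nu]_x f x + e%:E /\ \int[nu]_x f x <= \int[mu]_x f x + e%:E)%E.

Lemma dTV_ge0 (mu nu : set S -> \bar R) : (0 <= dTV mu nu)%E.
Proof.
rewrite mule_ge0// (le_trans (abse_ge0 (\int[mu]_x (0%R)%:E - \int[nu]_x (0%R)%:E)%E))//.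
apply: ereal_sup_ubound; exists (cst 0) => //; split=> // x.
by rewrite normr0 ler01.
Qed.

Lemma near_measureW (mu nu : set S -> \bar R) e e' : e <= e' ->
  near_measure mu nu e -> near_measure mu nu e'.
Proof.
move=> ee' H f mf f01; have [H1 H2] := H f mf f01.
by split; [apply: (le_trans H1)|apply: (le_trans H2)]; rewrite leeD2l// lee_fin.
Qed.

Lemma near_measure_set mu nu e (A : set S) : near_measure mu nu e -> measurable A ->
  (mu A <= nu A + e%:E /\ nu A <= mu A + e%:E)%E.
Proof.
move=> H mA; have := H (fun x => (\1_A x)%:E).
rewrite !integral_indic// !setIT; apply.
  by apply/measurable_EFinP; exact: measurable_indic.
by move=> x; rewrite indicE; case: (x \in A); rewrite ?lexx ?lee_fin ler01.
Qed.

Lemma lee_abs_sub (a b : \bar R) e : (`|a - b| <= e%:E)%E ->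
  (a <= b + e%:E /\ b <= a + e%:E)%E.
Proof.
case: a b => [a| |] [b| |] //=; rewrite ?leNye ?leey//.
rewrite -!EFinD !lee_fin ler_norml => /andP[? ?]; split; lra.
Qed.

Lemma dTV_near (mu nu : set S -> \bar R) e : (dTV mu nu <= e%:E)%E ->
  near_measure mu nu (2 * e).
Proof.
rewrite /dTV lee_pdivrMl// -EFinM => H f mf f01.
have ff x : f x \is a fin_num.
  have /andP[f0 f1] := f01 x; rewrite fin_numElt (lt_le_trans _ f0) ?ltNyr//.
  by rewrite (le_lt_trans f1)// ltry.
have fE : f = EFin \o (fine \o f) by apply/funext => x /=; rewrite fineK.
have {H} : (`|\int[mu]_x f x - \int[nu]_x f x| <= (2 * e)%:E)%E.
  apply: le_trans H; apply: ereal_sup_ubound; exists (fine \o f).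
    split; first exact: measurableT_comp.
    move=> x /=; have /andP[f0 f1] := f01 x.
    by rewrite ger0_norm ?fine_ge0// -lee_fin fineK.
  by rewrite [in RHS]fE.
exact: lee_abs_sub.
Qed.

Lemma integral_unit_fin mu (f : S -> \bar R) : (mu setT < +oo)%E ->
  measurable_fun [set: S] f -> (forall x, 0 <= f x <= 1)%E ->
  (\int[mu]_x f x)%E \is a fin_num.
Proof.
move=> mfin mf f01; rewrite ge0_fin_numE; last first.
  by apply: integral_ge0 => x _; case/andP: (f01 x).
apply: (@le_lt_trans _ _ (\int[mu]_x 1)%E); last by rewrite integral_cst// mul1e.
by apply: ge0_le_integral => // x _; case/andP: (f01 x).
Qed.

(** The positive and negative parts of a test function each contribute [e], and the factor one half
    in [dTV] compensates for having two of them. *)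
Lemma near_dTV mu nu e : (mu setT < +oo)%E -> (nu setT < +oo)%E ->
  near_measure mu nu e -> (dTV mu nu <= e%:E)%E.
Proof.
move=> mufin nufin H; rewrite /dTV lee_pdivrMl// -EFinM.
apply: ge_ereal_sup => _ [f [mf f1] <-].
have mF : measurable_fun [set: S] (EFin \o f) by exact/measurable_EFinP.
rewrite (integralE mu) (integralE nu).
have f1' x : (`|(EFin \o f) x| <= 1)%E by rewrite /= lee_fin.
have mp := measurable_funepos mF; have mn := measurable_funeneg mF.
have p01 x : (0 <= ((EFin \o f)^\+ x) <= 1)%E.
  rewrite funepos_ge0/= funeposE/= ge_max lee_fin lee_fin ler01 andbT.
  exact: le_trans (ler_norm _) (f1 x).
have n01 x : (0 <= ((EFin \o f)^\- x) <= 1)%E.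
  rewrite funeneg_ge0/= funenegE/= ge_max lee_fin lee_fin ler01 andbT.
  by rewrite (le_trans (ler_norm _))// normrN.
have [Hp1 Hp2] := H _ mp p01; have [Hn1 Hn2] := H _ mn n01.
have up := integral_unit_fin mufin mp p01; have un := integral_unit_fin mufin mn n01.
have vp := integral_unit_fin nufin mp p01; have vn := integral_unit_fin nufin mn n01.
move: Hp1 Hp2 Hn1 Hn2; rewrite -(fineK up) -(fineK un) -(fineK vp) -(fineK vn).
rewrite -!EFinD /= !lee_fin ler_norml.
by move=> ? ? ? ?; apply/andP; split; lra.
Qed.

End near_measures.

Section closeness.
Context {R : realType}.
Implicit Types T : weighted_tree R.

(* A quantitative form of [dGHP T T' < e] with the total variation distances
   replaced by their action on functions with values in [0, 1]. *)
Definition close T T' (C : set (T * T'))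
    (m : {measure set (borel (T * T')%type) -> \bar R}) (e : R) : Prop :=
  [/\ correspondence C,
      forall p q, C p -> C q -> `|mdist p.1 q.1 - mdist p.2 q.2| <= 2 * e,
      near_measure (pushforward m (fst : borel (T * T')%type -> borel T)) (mass T) (2 * e),
      near_measure (pushforward m (snd : borel (T * T')%type -> borel T')) (mass T') (2 * e) &
      (m (~` C) <= e%:E)%E].

Lemma measurable_fst_borel T T' :
  measurable_fun setT (fst : borel (T * T')%type -> borel T).
Proof.
apply: measurable_fun_gen => U oU; apply: sub_sigma_algebra => /=.
have /continuousP : continuous (fst : T * T' -> T) by move=> p; exact: cvg_fst.
exact.
Qed.

Lemma measurable_snd_borel T T' :
  measurable_fun setT (snd : borel (T * T')%type -> borel T').
Proof.
apply: measurable_fun_gen => U oU; apply: sub_sigma_algebra => /=.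
have /continuousP : continuous (snd : T * T' -> T') by move=> p; exact: cvg_snd.
exact.
Qed.

Lemma dGHP_lt_close T T' (e : R) : (dGHP T T' < e%:E)%E ->
  exists C (m : {finite_measure set (borel (T * T')%type) -> \bar R}), @close T T' C m e.
Proof.
move=> /ereal_inf_lt[_ [C [m [Cc ->]]]]; rewrite !gt_max => /andP[/andP[/ltW dis /ltW disc] /ltW mC].
exists C, m; split=> //.
- move=> p q Cp Cq; rewrite -lee_fin EFinM -lee_pdivrMl//; apply: le_trans dis.
  rewrite lee_pmul2l//; apply: ereal_sup_ubound; exists p => //; exists q => //.
- by apply: dTV_near; apply: le_trans disc; rewrite leeDl// dTV_ge0.
- by apply: dTV_near; apply: le_trans disc; rewrite leeDr// dTV_ge0.
Qed.

(** The constant 4 comes from [discrepancy], a sum of two total variation distances of at most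
    [2 * e] each. *)
Lemma close_dGHP T T' C (m : {finite_measure set (borel (T * T')%type) -> \bar R}) (e : R) :
  0 <= e -> @close T T' C m e -> (dGHP T T' <= (4 * e)%:E)%E.
Proof.
move=> e0 [Cc dis m1 m2 mC]; apply: ge_ereal_inf.
exists (Order.max (Order.max (2^-1%:E * distortion C)%E (discrepancy m)) (m (~` C))).
  by exists C, m.
rewrite !ge_max; apply/andP; split; last by rewrite (le_trans mC)// lee_fin; lra.
apply/andP; split.
  rewrite lee_pdivrMl//; apply: ge_ereal_sup => _ [p Cp [q Cq <-]].
  by rewrite -EFinM lee_fin (le_trans (dis _ _ Cp Cq))//; lra.
have -> : 4 * e = 2 * e + 2 * e by lra.
rewrite EFinD; apply: leeD.
  apply: (near_dTV (mu := image_measure m (@measurable_fst_borel T T'))) => //.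
    exact: (finite_lty m measurableT).
  exact: finite_lty.
apply: (near_dTV (mu := image_measure m (@measurable_snd_borel T T'))) => //.
    exact: (finite_lty m measurableT).
  exact: finite_lty.
Qed.

Section close_consequences.
Variables (T T' : weighted_tree R) (C : set (T * T')).
Variables (m : {measure set (borel (T * T')%type) -> \bar R}) (e : R).
Hypothesis Cm : close C m e.

Lemma close_ge0 : 0 <= e.
Proof.
have [_ dis _ _ _] := Cm; case: (Cm) => -[_ _ _ Cr] _ _ _ _.
have := dis _ _ Cr Cr; rewrite /= !mdistxx subrr normr0; lra.
Qed.

Lemma close_left x : exists x', C (x, x').
Proof.
have [[_ Cl _ _] _ _ _ _] := Cm; have : [set: T] x by [].
by rewrite -Cl => -[[a b] Cab /= <-]; exists b.
Qed.

Lemma close_right x' : exists x, C (x, x').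
Proof.
have [[_ _ Cl _] _ _ _ _] := Cm; have : [set: T'] x' by [].
by rewrite -Cl => -[[a b] Cab /= <-]; exists a.
Qed.

Lemma close_hgt x x' : C (x, x') -> `|hgt x - hgt x'| <= 2 * e.
Proof.
move=> Cx; have [[_ _ _ Cr] dis _ _ _] := Cm; exact: (dis _ _ Cr Cx).
Qed.

(** Three distances enter [gp]; each moves by at most [2 * e], and their combination is halved. *)
Lemma close_gp x x' w w' : C (x, x') -> C (w, w') -> `|gp x w - gp x' w'| <= 3 * e.
Proof.
move=> Cx Cw; have := close_hgt Cx; have := close_hgt Cw.
have [_ dis _ _ _] := Cm; have /= := dis _ _ Cx Cw.
rewrite /gp !ler_norml => /andP[? ?] /andP[? ?] /andP[? ?]; apply/andP; split; lra.
Qed.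

Lemma close_int1 (f : borel T -> \bar R) : measurable_fun setT f ->
  (forall x, 0 <= f x <= 1)%E ->
  (\int[m]_p f p.1 <= \int[mass T]_x f x + (2 * e)%:E /\
   \int[mass T]_x f x <= \int[m]_p f p.1 + (2 * e)%:E)%E.
Proof.
move=> mf f01; have [_ _ + _ _] := Cm => /(_ f mf f01).
have E := integral_image_measure m (@measurable_fst_borel T T') mf (fun x => proj1 (andP (f01 x))).
by rewrite -E.
Qed.

Lemma close_int2 (f : borel T' -> \bar R) : measurable_fun setT f ->
  (forall x, 0 <= f x <= 1)%E ->
  (\int[m]_p f p.2 <= \int[mass T']_x f x + (2 * e)%:E /\
   \int[mass T']_x f x <= \int[m]_p f p.2 + (2 * e)%:E)%E.
Proof.
move=> mf f01; have [_ _ _ + _] := Cm => /(_ f mf f01).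
have E := integral_image_measure m (@measurable_snd_borel T T') mf (fun x => proj1 (andP (f01 x))).
by rewrite -E.
Qed.

Lemma close_set1 (A : set (borel T)) : measurable A ->
  (m [set p | A p.1] <= mass T A + (2 * e)%:E)%E.
Proof.
move=> mA; have [_ _ H _ _] := Cm.
have [+ _] := near_measure_set (mu := image_measure m (@measurable_fst_borel T T')) H mA.
by rewrite image_measureE.
Qed.

End close_consequences.

(* [close] for a coupling given as the law of a pair of measurable maps *)
Lemma close_image d (Z : measurableType d) (n : {measure set Z -> \bar R}) T T'
    (a : Z -> borel T) (b : Z -> borel T') (ma : measurable_fun setT a)
    (mb : measurable_fun setT b) (C : set (T * T')) (e : R) :
  correspondence C ->
  (forall p q, C p -> C q -> `|mdist p.1 q.1 - mdist p.2 q.2| <= 2 * e) ->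
  near_measure (pushforward n a) (mass T) (2 * e) ->
  near_measure (pushforward n b) (mass T') (2 * e) ->
  (n [set z | ~ C (a z, b z)] <= e%:E)%E ->
  close C (image_measure n (measurable_fun_pair_borel ma mb)) e.
Proof. by move=> *; split. Qed.

Lemma dGHP_image d (Z : measurableType d) (n : {measure set Z -> \bar R}) T T'
    (a : Z -> borel T) (b : Z -> borel T') (ma : measurable_fun setT a)
    (mb : measurable_fun setT b) (C : set (T * T')) (e : R) :
  (n setT < +oo)%E -> 0 <= e ->
  close C (image_measure n (measurable_fun_pair_borel ma mb)) e ->
  (dGHP T T' <= (4 * e)%:E)%E.
Proof.
move=> nfin e0 H.
have fin : (image_measure n (measurable_fun_pair_borel ma mb) setT < +oo)%E by [].
exact: (@close_dGHP T T' C (finite_measure_of fin)).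
Qed.

End closeness.

(** * Perturbation of subtrees *)

Section subtree_retraction.
Context {R : realType}.
Variable T : weighted_tree R.
Implicit Types (x y z w : T).

Let tT : real_tree T := @space_tree R T.

(** The default value of [sub_in] is the root of the subtree, so points outside are sent to [y]:
    this is the nearest-point projection. *)
Definition retract y : T -> subtree y := sub_in (above_self y).

Definition incl y : subtree y -> T := @sub_val R T (above y) y (above_self y).

Lemma inclK y z : above y z -> incl (retract y z) = z.
Proof. exact: sub_inK. Qed.

Lemma retractK y (z : subtree y) : retract y (incl z) = z.
Proof. by apply: sub_val_inj; rewrite -[LHS]/(incl _) inclK//; exact: sub_valP. Qed.

Lemma incl_above y (z : subtree y) : above y (incl z).
Proof. exact: sub_valP. Qed.

Lemma retract_out y z : ~ above y z -> retract y z = root (subtree y).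
Proof. by rewrite /retract /sub_in; case: pselect. Qed.

Lemma incl_root y : incl (root (subtree y)) = y.
Proof. by []. Qed.

Lemma mdist_incl y (a b : subtree y) : mdist a b = mdist (incl a) (incl b).
Proof. by []. Qed.

Lemma above_out y z w : above y z -> ~ above y w -> mdist z w = mdist z y + mdist y w.
Proof.
move=> yz yw; have [//|/(segmentP tT) H] := tripod tT w yz.
by rewrite (metric_sym z w) -H addrC (metric_sym z y) (metric_sym y w).
Qed.

Lemma retract_lip y z w : mdist (retract y z) (retract y w) <= mdist z w.
Proof.
rewrite mdist_incl.
have [yz|yz] := pselect (above y z); have [yw|yw] := pselect (above y w).
- by rewrite !inclK.
- by rewrite inclK// (retract_out yw) incl_root (above_out yz yw) lerDl mdist_ge0.
- rewrite (inclK yw) (retract_out yz) incl_root metric_sym (metric_sym z).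
  by rewrite (above_out yw yz) lerDl mdist_ge0.
- by rewrite !retract_out// mdistxx mdist_ge0.
Qed.

Lemma measurable_retract y :
  measurable_fun [set: borel T] (retract y : borel T -> borel (subtree y)).
Proof.
apply: (@continuous_borel T (subtree y)); apply: (continuous_lip ltr01) => z w.
by rewrite mul1r; exact: retract_lip.
Qed.

Lemma subtree_mass y A : measurable A ->
  mass (subtree y) A = mass T (above y `&` retract y @^-1` A).
Proof.
move=> mA; congr (mass T _); apply/seteqP; split=> [_ [z Az <-]|z [yz Az]].
  by split; [exact: sub_valP|rewrite /= retractK].
by exists (retract y z) => //; exact: inclK.
Qed.

Lemma integral_subtree y (f : borel (subtree y) -> \bar R) : measurable_fun setT f ->
  (forall c, 0 <= f c)%E ->
  (\int[mass (subtree y)]_c f c = \int[mass T]_(c in (above y : set (borel T))) f (retract y c))%E.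
Proof.
move=> mf f0; pose n := image_measure (mrestr (mass T) (measurable_above y)) (@measurable_retract y).
transitivity (\int[n]_c f c)%E.
  apply: eq_measure_integral => A mA _.
  rewrite [n A]image_measureE /= /mrestr.
  by rewrite subtree_mass// setIC.
rewrite integral_image_measure// (integral_mrestr (mass T) _ (g := f \o retract y))//.
  exact: measurableT_comp mf (@measurable_retract y).
by move=> z; exact: f0.
Qed.

End subtree_retraction.

Lemma open_window (R : realType) (T : weighted_tree R) (x : T) (h k : R) :
  open [set w : T | `|gp x w - h| < k].
Proof.
apply: (open_comp _ (@open_lt R k)) => w _.
apply: (@continuous_lipR _ _ (fun w => `|gp x w - h|) 1) => // {}w v.
rewrite mul1r (le_trans (ler_dist_dist _ _))//.
by rewrite opprB addrA subrK !(gpC x) gp_lip.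
Qed.

Section close_subtrees.
Context {R : realType}.
Variables (T T' : weighted_tree R) (C : set (T * T')).
Variables (m : {measure set (borel (T * T')%type) -> \bar R}) (e : R).
Hypothesis mfin : (m setT < +oo)%E.
Hypothesis e0 : 0 < e.
Hypothesis Cm : close C m e.
Variables (x : T) (x' : T') (h h' k r : R).
Hypothesis Cx : C (x, x').
Hypotheses (hx : 0 <= h <= hgt x) (hx' : 0 <= h' <= hgt x').
Hypotheses (hh' : `|h - h'| <= e) (ek : 4 * e < k) (r0 : 0 < r).

Let W := [set w : T | `|gp x w - h| < k].
Hypothesis Wr : forall w, W w -> mdist w (anc x h) < r.
Hypothesis mW : (mass T W <= r%:E)%E.

Let y := anc x h.
Let y' := anc x' h'.
(** The term [r] is the size of the window [W] around [y]. The rest exceeds [9 * e], the bound on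
    the distance from a partner of [y] to [y']: [5 * e] down to the ray to [x'] and [4 * e] along
    it. *)
Let rho := r + 10 * e.
Let rho0 : 0 < rho. Proof. by move: e0 r0; rewrite /rho; lra. Qed.
Let rrho : r < rho. Proof. by move: e0 r0; rewrite /rho; lra. Qed.

Let above_y z : above y z <-> h <= gp x z. Proof. exact: above_ancP. Qed.
Let above_y' z : above y' z <-> h' <= gp x' z. Proof. exact: above_ancP. Qed.

(** Passing to the other tree moves [gp] by at most [3 * e] and the cut by at most [e], while off
    the window [gp x w] is at least [k > 4 * e] away from [h]; both sides of the cut are thus
    preserved. *)
Let above_iff w w' : C (w, w') -> ~ W w -> above y w <-> above y' w'.
Proof.
move=> Cw /negP; rewrite -leNgt above_y above_y' => nW.
have := close_gp Cm Cx Cw; move: ek nW hh'; rewrite !ler_norml ler_normr => ?.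
by move=> /orP[?|?] /andP[? ?] /andP[? ?]; split=> ?; lra.
Qed.

Let near_root w' : C (y, w') -> mdist w' y' < rho.
Proof.
move=> Cw; apply: (le_lt_trans (mdist_anc_le w' hx')).
have := close_hgt Cm Cw; have := close_gp Cm Cx Cw; have := r0.
rewrite gp_anc hgt_anc clamp_id// /rho; move: hh'.
rewrite !ler_norml => /andP[? ?] ? /andP[? ?] /andP[? ?].
by have [_|_] := ger0P (gp x' w' - h'); lra.
Qed.

(** The pairs of subtree points within [rho] of a pair of [C]. The thickening makes the set open,
    hence Borel, and lets a point of the window, whose partner may lie outside the other subtree, be
    paired with the root. *)
Let D : set (subtree y * subtree y') := [set p | exists w w',
  [/\ C (w, w'), mdist w (incl p.1) < rho & mdist w' (incl p.2) < rho]].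

Let open_D : open D.
Proof.
rewrite openE => -[a b] [w [w' [Cw wa wb]]].
exists ([set c | mdist w (incl c) < rho], [set c | mdist w' (incl c) < rho]).
  split=> /=.
    apply/nbhs_mdistP; exists (rho - mdist w (incl a)); first by rewrite subr_gt0.
    move=> c; rewrite mdist_incl ltrBrDl => ac.
    exact: le_lt_trans (metric_triangle _ _ _) ac.
  apply/nbhs_mdistP; exists (rho - mdist w' (incl b)); first by rewrite subr_gt0.
  move=> c; rewrite mdist_incl ltrBrDl => bc.
  exact: le_lt_trans (metric_triangle _ _ _) bc.
by move=> [c c'] /= [wc wc']; exists w, w'.
Qed.

Let D_root c : mdist y (incl c) < rho -> D (c, root (subtree y')).
Proof.
move=> yc; have [w' Cw] := close_left Cm y; exists y, w'; split=> //=.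
exact: near_root.
Qed.

Let D_corr : correspondence D.
Proof.
split.
- exact: sub_sigma_algebra.
- apply/seteqP; split=> // z _.
  have [Wz|nW] := pselect (W (incl z)).
    exists (z, root (subtree y')) => //; apply: D_root.
    by rewrite metric_sym (lt_trans (Wr Wz) rrho).
  have [w' Cw] := close_left Cm (incl z).
  have yw : above y' w' by apply/(above_iff Cw nW); exact: incl_above.
  by exists (z, retract y' w') => //; exists (incl z), w'; rewrite /= inclK// !mdistxx.
- apply/seteqP; split=> // z' _.
  have [w Cw] := close_right Cm (incl z').
  have [Ww|nW] := pselect (W w).
    exists (root (subtree y), z') => //; exists w, (incl z'); split=> //=.
      exact: lt_trans (Wr Ww) rrho.
    by rewrite mdistxx.
  have yw : above y w by apply/(above_iff Cw nW); exact: incl_above.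
  by exists (retract y w, z') => //; exists w, (incl z'); rewrite /= inclK// !mdistxx.
- by apply: D_root; rewrite incl_root mdistxx.
Qed.

(** The thickening adds at most [4 * rho] to the distortion [2 * e] of [C]. *)
Let D_dis p q : D p -> D q -> `|mdist p.1 q.1 - mdist p.2 q.2| <= 2 * (30 * e + 3 * r).
Proof.
move=> [w [w' [Cw w1 w2]]] [v [v' [Cv v1 v2]]].
have [_ dis _ _ _] := Cm; have /= := dis _ _ Cw Cv.
rewrite !mdist_incl; move: w1 w2 v1 v2.
set a := incl p.1; set b := incl q.1; set a' := incl p.2; set b' := incl q.2.
move=> w1 w2 v1 v2.
have := mdist_lip w b v; have := mdist_lip w' b' v'.
have := mdist_lip b a w; have := mdist_lip b' a' w'.
rewrite (metric_sym b a) (metric_sym b w) (metric_sym b' a') (metric_sym b' w').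
rewrite (metric_sym a w) (metric_sym a' w') (metric_sym b v) (metric_sym b' v').
move: e0 r0 w1 w2 v1 v2; rewrite /rho.
rewrite !ler_norml => ? ? ? ? ? ? /andP[? ?] /andP[? ?] /andP[? ?] /andP[? ?] /andP[? ?].
by apply/andP; split; lra.
Qed.

Let Z : set (borel (T * T')%type) := [set p | above y p.1 /\ above y' p.2].

Let mfst := @measurable_fst_borel R T T'.
Let msnd := @measurable_snd_borel R T T'.

Let mZ : measurable Z.
Proof.
have m1 := mfst measurableT (measurable_above y).
have m2 := msnd measurableT (measurable_above y').
by rewrite !setTI in m1 m2; exact: measurableI m1 m2.
Qed.

Let mC : measurable (C : set (borel (T * T')%type)).
Proof. by case: Cm => -[]. Qed.

Let mW1 : measurable (W : set (borel T)).
Proof.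
by apply: open_borel; exact: open_window.
Qed.

Let n : {measure set (borel (T * T')%type) -> \bar R} := mrestr m mZ.
Let a : borel (T * T')%type -> borel (subtree y) :=
  (retract y : borel T -> borel (subtree y)) \o (fst : borel (T * T')%type -> borel T).
Let b : borel (T * T')%type -> borel (subtree y') :=
  (retract y' : borel T' -> borel (subtree y')) \o (snd : borel (T * T')%type -> borel T').
Let ma : measurable_fun setT a. Proof. exact: measurableT_comp (@measurable_retract R T y) mfst. Qed.
Let mb : measurable_fun setT b. Proof. exact: measurableT_comp (@measurable_retract R T' y') msnd. Qed.

(** Off this set a pair lies above both cuts or above neither, so restricting the coupling to [Z]
    loses no other mass. *)
Let bad : set (borel (T * T')%type) := ~` C `|` [set p | W p.1].

Let mbad : measurable bad.
Proof.
apply: measurableU; first exact: measurableC.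
by have := mfst measurableT mW1; rewrite setTI.
Qed.

Let bad_le : (m bad <= (r + 3 * e)%:E)%E.
Proof.
apply: (le_trans (measureU2 _ _ _)).
- exact: measurableC.
- by have := mfst measurableT mW1; rewrite setTI.
have [_ _ _ _ H] := Cm.
have -> : r + 3 * e = e + (r + 2 * e) by lra.
rewrite EFinD; apply: leeD => //.
by rewrite EFinD; apply: (le_trans (close_set1 Cm mW1)); rewrite leeD2r.
Qed.

Let Zcase p : ~ bad p -> above y p.1 <-> above y' p.2.
Proof.
case: p => w w' nb; apply: above_iff; first by apply: contrapT => nC; apply: nb; left.
by move=> Ww; apply: nb; right.
Qed.

(* both marginal estimates have this shape *)
Let near_marginal (F : borel (T * T')%type -> \bar R) (A : set (borel (T * T')%type)) :
  measurable A -> (forall p, ~ bad p -> A p -> Z p) -> Z `<=` A ->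
  measurable_fun setT F -> (forall p, 0 <= F p <= 1)%E ->
  (\int[m]_(p in Z) F p <= \int[m]_(p in A) F p /\
   \int[m]_(p in A) F p <= \int[m]_(p in Z) F p + (r + 3 * e)%:E)%E.
Proof.
move=> mA AZ ZA mF F01; split.
  apply: ge0_subset_integral => //; first exact: measurable_funTS.
  by move=> p _; case/andP: (F01 p).
rewrite -{1}(setDUK ZA) ge0_integral_setU//; last 4 first.
- exact: measurableD.
- exact: measurable_funTS.
- by move=> p _; case/andP: (F01 p).
- by apply/disj_setPS => p [? []].
rewrite leeD2l//; apply: le_trans bad_le.
apply: (@le_trans _ _ (m (A `\` Z))).
  have := @integral_cst _ _ _ m (A `\` Z) (measurableD mA mZ) 1; rewrite mul1e => <-.
  apply: ge0_le_integral => //.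
  - exact: measurableD.
  - by move=> p _; case/andP: (F01 p).
  - exact: measurable_funTS.
  - by move=> p _; case/andP: (F01 p).
apply: le_measure; rewrite ?inE//; first exact: measurableD.
by move=> p [Ap nZ]; apply: contrapT => nb; apply: nZ; exact: AZ.
Qed.

(** Used with [pr] the first and then the second projection. The error [2 * e] of the marginal and
    the mass [r + 3 * e] of [bad] add up. *)
Let near_subtree (X : weighted_tree R) (pr : borel (T * T')%type -> borel X) (v : X) :
  measurable_fun setT pr ->
  (forall F : borel X -> \bar R, measurable_fun setT F -> (forall z, 0 <= F z <= 1)%E ->
    (\int[m]_p F (pr p) <= \int[mass X]_z F z + (2 * e)%:E /\
     \int[mass X]_z F z <= \int[m]_p F (pr p) + (2 * e)%:E)%E) ->
  (forall p, ~ bad p -> above v (pr p) -> Z p) -> (forall p, Z p -> above v (pr p)) ->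
  near_measure (pushforward n ((retract v : borel X -> borel (subtree v)) \o pr))
    (mass (subtree v)) (2 * (30 * e + 3 * r)).
Proof.
move=> mpr H AZ ZA f mf f01.
have f0 z : (0 <= f z)%E by case/andP: (f01 z).
have mv := measurable_above v.
have mg := measurableT_comp (@measurable_retract R X v) mpr.
have mfr : measurable_fun setT (fun z : borel X => f (retract v z)).
  exact: measurableT_comp mf (@measurable_retract R X v).
have mfg : measurable_fun setT (fun p : borel (T * T')%type => f (retract v (pr p))).
  exact: measurableT_comp mf mg.
pose A : set (borel (T * T')%type) := [set p | above v (pr p)].
have mA : measurable A by have := mpr measurableT _ mv; rewrite setTI.
have [N1 N2] := @near_marginal (fun p => f (retract v (pr p))) A mA AZ ZA mfg (fun p => f01 _).
pose F : borel X -> \bar R := (fun z => f (retract v z)) \_ (above v : set (borel X)).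
have mF : measurable_fun setT F by apply/(measurable_restrictT _ mv); exact: measurable_funTS.
have F01 z : (0 <= F z <= 1)%E.
  by rewrite /F patchE; case: ifP => // _; rewrite lexx lee_fin ler01.
have [I1 I2] := H F mF F01.
have E1 : (\int[pushforward n ((retract v : borel X -> borel (subtree v)) \o pr)]_c f c =
    \int[m]_(p in Z) f (retract v (pr p)))%E.
  transitivity (\int[image_measure n mg]_c f c)%E => //.
  by rewrite integral_image_measure// (integral_mrestr m mZ (g := fun p => f (retract v (pr p)))).
have E2 : (\int[mass (subtree v)]_c f c = \int[mass X]_z F z)%E.
  by rewrite integral_subtree// integral_mkcond.
have E3 : (\int[m]_(p in A) f (retract v (pr p)) = \int[m]_p F (pr p))%E.
  rewrite integral_mkcond; apply: eq_integral => p _; rewrite /F !patchE.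
  by congr (if _ then _ else _); apply/idP/idP; rewrite !inE.
have ec : 2 * e + (r + 3 * e) <= 2 * (30 * e + 3 * r) by move: e0 r0; lra.
have ec' : 2 * e <= 2 * (30 * e + 3 * r) by move: e0 r0; lra.
rewrite E1 E2; rewrite E3 in N1 N2; split.
  by apply: (le_trans N1); apply: (le_trans I1); rewrite leeD2l// lee_fin.
apply: (le_trans I2); apply: (@le_trans _ _ (\int[m]_(p in Z) f (retract v (pr p)) + (r + 3 * e)%:E + (2 * e)%:E)%E).
  by rewrite leeD2r.
by rewrite -addeA -EFinD leeD2l// lee_fin addrC.
Qed.

Lemma close_subtrees :
  close D (image_measure n (measurable_fun_pair_borel ma mb)) (30 * e + 3 * r).
Proof.
apply: close_image => //.
- apply: near_subtree => //.
  + by move=> F mF F01; exact: (close_int1 Cm mF F01).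
  + by move=> p nb yp; split=> //; exact: (iffLR (Zcase nb)).
  + by move=> p [].
- apply: near_subtree => //.
  + by move=> F mF F01; exact: (close_int2 Cm mF F01).
  + by move=> p nb yp; split=> //; exact: (iffRL (Zcase nb)).
  + by move=> p [].
rewrite /n/= /mrestr.
have [_ _ _ _ H] := Cm.
apply: (@le_trans _ _ (m (~` C))); last by apply: le_trans H _; move: e0 r0; rewrite lee_fin; lra.
apply: le_measure; rewrite ?inE.
- apply: measurableI => //.
  have mD : measurable (~` D : set (borel (subtree y * subtree y')%type)).
    by apply: measurableC; exact: sub_sigma_algebra.
  by have := (measurable_fun_pair_borel ma mb) measurableT _ mD; rewrite setTI.
- exact: measurableC.
(* On [Z] both retractions fix the points, so a pair of [C] there already belongs to [D]. *)
move=> [w w'] [/= nD [yw yw']] Cw; apply: nD; exists w, w'.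
by rewrite /a /b /= !inclK// !mdistxx.
Qed.

Lemma dGHP_subtrees : (dGHP (subtree y) (subtree y') <= (120 * e + 12 * r)%:E)%E.
Proof.
have -> : 120 * e + 12 * r = 4 * (30 * e + 3 * r) by lra.
apply: (dGHP_image _ _ close_subtrees); last by move: e0 r0; lra.
apply: le_lt_trans mfin; rewrite /n/= /mrestr setTI.
by apply: le_measure; rewrite ?inE.
Qed.

End close_subtrees.

Lemma countable_setU (X : Type) (A B : set X) :
  countable A -> countable B -> countable (A `|` B).
Proof.
move=> cA cB; have -> : A `|` B = \bigcup_(b in [set: bool]) (if b then A else B).
  apply/seteqP; split=> x; first by case=> ?; [exists true|exists false].
  by case=> -[] _ ?; [left|right].
by apply: bigcup_countable => [|[] _ //]; exact: countableP.
Qed.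

Section atoms.
Context d (S : measurableType d) (R : realType).
Variable m : {finite_measure set S -> \bar R}.
Hypothesis mS : forall x : S, measurable [set x].

Lemma countable_atoms : countable [set x | (0 < m [set x])%E].
Proof.
pose A k := [set x | (k.+1%:R^-1%:E <= m [set x])%E].
have -> : [set x | (0 < m [set x])%E] = \bigcup_k A k.
  apply/seteqP; split=> x; last first.
    by move=> [k _]; apply: lt_le_trans; rewrite lte_fin.
  move=> /= mx; have xf : m [set x] \is a fin_num by rewrite fin_num_measure.
  move: mx; rewrite -(fineK xf) lte_fin => mx; have [k kx] := invS_lt mx.
  by exists k => //; rewrite /A /= -(fineK xf) lee_fin ltW.
apply: bigcup_countable => // k _; apply: finite_set_countable.
apply: contrapT => /infiniteP/ppcard_leP[f].
pose F n : set S := [set f n].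
have tF : trivIset setT F.
  apply/trivIsetP => i j _ _ ij; rewrite -subset0 => z [-> /= fij].
  by move/eqP : ij; apply; apply: (@inj _ _ _ f) => //; rewrite inE.
have mF n : measurable (F n) by exact: mS.
have Af n : A k (f n) by exact: funS.
have MT : m setT \is a fin_num by rewrite fin_num_measure.
have bound n : n%:R * k.+1%:R^-1 <= fine (m setT).
  rewrite -lee_fin fineK//; apply: (@le_trans _ _ (m (\bigcup_i F i))); last first.
    by apply: le_measure; rewrite ?inE//; exact: bigcupT_measurable.
  rewrite measure_semi_bigcup//; last exact: bigcupT_measurable.
  apply: le_trans (nneseries_lim_ge n _); last by move=> *; exact: measure_ge0.
  rewrite (_ : (_ * _)%:E = \sum_(0 <= i < n) k.+1%:R^-1%:E)%E.
    by apply: lee_sum => i _; exact: Af.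
  by rewrite sumEFin; congr EFin; rewrite big_const_nat subn0 iter_addr_0 mulr_natl.
(* That many atoms of mass at least [k.+1%:R^-1] weigh more than the whole space. *)
have := bound (k.+1 * (Num.truncn (fine (m setT))).+1)%N.
rewrite natrM mulrAC divff ?mul1r// leNgt => /negP; apply.
exact: Num.Theory.truncnS_gt.
Qed.

End atoms.

(** * Heights at which subtrees are stable *)

Section good_heights.
Context {R : realType}.
Variable T : weighted_tree R.
Implicit Types x y z w : T.

(* the heights at which the subtree along the ray to [x] is stable under a small
   perturbation: no branching there, and no atom *)
Definition good x (h : R) := [/\ 0 < h, h < hgt x,
  forall n, gp x (dense_seq T n) <> h & mass T [set anc x h] = 0%E].

Lemma countable_bad x : countable [set h | 0 <= h <= hgt x /\ ~ good x h].
Proof.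
pose B : set R := [set 0] `|` [set hgt x] `|` range (fun n => gp x (dense_seq T n)) `|`
  [set hgt y | y in [set y | (0 < mass T [set y])%E]].
apply: (sub_countable (B := B)).
  apply: subset_card_le => h /= [/andP[h0 hx] ng]; rewrite /B.
  apply: contrapT => nB; apply: ng; split.
  - by rewrite lt_neqAle h0 andbT; apply/eqP => h0'; apply: nB; do 3 left; rewrite -h0'.
  - by rewrite lt_neqAle hx andbT; apply/eqP => hx'; apply: nB; left; left; right.
  - by move=> n ng; apply: nB; left; right; exists n.
  - apply/eqP; rewrite eq_le measure_ge0 andbT leNgt; apply/negP => m0.
    by apply: nB; right; exists (anc x h) => //; rewrite hgt_anc_id// h0.
apply: countable_setU; last first.
  apply: (sub_countable (card_image_le _ _)); apply: countable_atoms; exact: measurable_point.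
apply: countable_setU; last by apply: (sub_countable (card_image_le _ _)); exact: countableP.
by apply: countable_setU; exact: countable1.
Qed.

(** Only the branching heights of the dense sequence are excluded in [good], and this suffices. By
    compactness, the distance of [gp x w] to [h] has a minimum over the points [w] at distance at
    least [r] from the cut. Were it zero, the minimiser would branch off exactly at height [h], and
    by [gp_ultra] so would a dense point close to it. *)
Lemma good_window x h : good x h -> forall r : R, 0 < r ->
  exists2 k : R, 0 < k & forall w, `|gp x w - h| < k -> mdist w (anc x h) < r.
Proof.
move=> [h0 hx nu _] r r0; set y := anc x h.
have hi : 0 <= h <= hgt x by rewrite !ltW.
pose K := [set w | r <= mdist y w].
have cK : compact K.
  apply: (subclosed_compact _ (@space_compact R T)) => //.
  apply: (preimage_closed _ (@closed_ge R r)) => w _; exact: continuous_mdist.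
have [K0|/set0P K0] := eqVneq K set0.
  exists 1 => // w _; rewrite metric_sym ltNge; apply/negP => rw.
  by have : K w by []; rewrite K0.
have [|w0 /[!inE] Kw0 wmin] := @compact_EVT_min _ _ (fun w => `|gp x w - h|) K K0 cK.
  apply: continuous_subspaceT => w.
  apply: (@continuous_lipR _ _ (fun w => `|gp x w - h|) 1) => // {}w v.
  rewrite mul1r (le_trans (ler_dist_dist _ _))//.
  by rewrite opprB addrA subrK !(gpC x) gp_lip.
exists `|gp x w0 - h|; last first.
  move=> w; rewrite metric_sym => wh; rewrite ltNge; apply/negP => rw.
  by move: wh; rewrite ltNge wmin// inE.
rewrite normr_gt0 subr_eq0; apply/eqP => gw.
have yw : above y w0 by apply/(above_ancP _ hi); rewrite gw.
have := ray_mdist yw; rewrite hgt_anc_id// => dw.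
have hw : 0 < hgt w0 - h by rewrite -dw (lt_le_trans r0).
have [n nw] := dense_seqP w0 hw; apply: (nu n).
have := gp_near w0 (dense_seq T n); rewrite metric_sym => g1.
have g2 : h < gp w0 (dense_seq T n) by lra.
have := gp_ultra x w0 (dense_seq T n); rewrite gw (min_l (ltW g2)) => g3.
have := gp_ultra x (dense_seq T n) w0; rewrite gw ge_min (gpC _ w0) => /orP[g4|g4].
  by apply/eqP; rewrite eq_le g3 g4.
by move: g4; rewrite leNgt g2.
Qed.

Lemma small_ball y (e : R) : mass T [set y] = 0%E -> 0 < e ->
  exists2 r : R, 0 < r & (mass T [set w | (mdist y w < r)%R] <= e%:E)%E.
Proof.
move=> y0 e0; pose F n : set (borel T) := [set w | mdist y w < n.+1%:R^-1].
have mF n : measurable (F n) by exact: measurable_mball.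
have FE : \bigcap_n F n = ([set y] : set (borel T)).
  apply/seteqP; split=> [w Fw|_ -> n _]; last by rewrite /F /= mdistxx.
  apply/esym/mdist_positivity/eqP; rewrite eq_le mdist_ge0 andbT leNgt; apply/negP => yw.
  by have [n] := invS_lt yw; rewrite ltNge ltW//; exact: Fw.
have := @nonincreasing_cvg_mu _ _ _ (mass T) F (finite_lty _ (mF 0%N)) mF.
rewrite FE => /(_ (measurable_point y)) H.
have {H} : (mass T \o F) n @[n --> \oo] --> mass T [set y].
  apply: H => i j ij; apply/subsetPset => w; rewrite /F /= => /lt_le_trans; apply.
  by rewrite lef_pV2 ?posrE// ler_nat.
rewrite y0.
move=> /fine_cvgP[_ /cvgrPdist_le/(_ e e0)[N _ /(_ N (leqnn N))]] /=.
rewrite sub0r normrN ger0_norm ?fine_ge0// => H.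
exists N.+1%:R^-1 => //; rewrite -lee_fin fineK// in H.
by rewrite fin_num_measure//; exact: mF.
Qed.

Lemma subtree_near x h (e : R) : good x h -> 0 < e -> exists2 k : R, 0 < k &
  forall (T' : weighted_tree R) C (m : {finite_measure set (borel (T * T')%type) -> \bar R}),
    close C m k -> forall (x' : T') (h' : R), C (x, x') -> `|h - h'| <= k ->
    0 <= h' <= hgt x' -> (dGHP (subtree (anc x h)) (subtree (anc x' h')) < e%:E)%E.
Proof.
move=> gh e0; have [h0 hx _ m0] := gh.
(* With [q <= e / 480], both terms of the bound [120 * q + 12 * r] are at most [e / 4]; [q <= k / 8]
   provides [4 * q < k]. *)
pose r := e / 48; have r0 : 0 < r by rewrite /r; lra.
have [r1 r10 mr1] := small_ball m0 r0.
have r20 : 0 < Order.min r r1 by rewrite lt_min r0.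
have [k k0 kP] := good_window gh r20.
have e1 : 0 < Order.min (k / 8) (e / 480) by rewrite lt_min; apply/andP; split; lra.
exists (Order.min (k / 8) (e / 480)) => // T' C m Cm x' h' Cx hh' hx'.
have m1 : Order.min (k / 8) (e / 480) <= k / 8 by rewrite ge_min lexx.
have m2 : Order.min (k / 8) (e / 480) <= e / 480 by rewrite ge_min lexx orbT.
move: e1 Cm hh' m1 m2; set q := Order.min _ _ => e1 Cm hh' m1 m2.
apply: (@le_lt_trans _ _ (120 * q + 12 * r)%:E); last by rewrite lte_fin /r; lra.
apply: (@dGHP_subtrees R T T' C m q _ e1 Cm x x' h h' k r Cx) => //.
- exact: finite_lty.
- by rewrite !ltW.
- lra.
- by move=> w /kP; rewrite lt_min => /andP[].
- apply: le_trans mr1; apply: le_measure; rewrite ?inE.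
  + by apply: open_borel; exact: open_window.
  + exact: measurable_mball.
  + by move=> w /kP /=; rewrite lt_min metric_sym => /andP[].
Qed.

End good_heights.

(** * Diagonal coupling and transport along isometries *)

Section self_close.
Context {R : realType}.
Implicit Types T : weighted_tree R.

(** The image of the mass on the diagonal is the coupling; the diagonal is thickened to an open set
    so that the correspondence is Borel. *)
Lemma close_self T (e : R) : 0 < e ->
  exists m : {finite_measure set (borel (T * T)%type) -> \bar R},
    close [set p : T * T | mdist p.1 p.2 < e] m e.
Proof.
move=> e0; pose i : borel T -> borel T := id.
have mi : measurable_fun setT i by exact: measurable_id.
have fin : (image_measure (mass T) (measurable_fun_pair_borel mi mi) setT < +oo)%E.
  exact: (finite_lty (mass T) measurableT).
exists (finite_measure_of fin); apply: (@close_image R _ _ (mass T) T T i i mi mi).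
- split.
  + apply: sub_sigma_algebra; rewrite /= openE => -[a b] /= ab.
    pose r := (e - mdist a b) / 2; have r0 : 0 < r by rewrite divr_gt0// subr_gt0.
    exists ([set c | mdist a c < r], [set c | mdist b c < r]).
      by split; apply/nbhs_mdistP; exists r.
    move=> [c c'] /= [ac bc]; have := metric_triangle c a c'.
    have := metric_triangle a b c'; rewrite (metric_sym c a).
    move: ac bc; rewrite /r; lra.
  + by apply/seteqP; split=> // a _; exists (a, a); rewrite //= mdistxx.
  + by apply/seteqP; split=> // a _; exists (a, a); rewrite //= mdistxx.
  + by rewrite /= mdistxx.
- move=> [a b] [c k] /= ab ck.
  have := mdist_lip c a b; have := mdist_lip b c k; move: ab ck.
  rewrite (metric_sym c a) (metric_sym c b) !ler_norml.
  move=> ? ? /andP[? ?] /andP[? ?]; apply/andP; split; lra.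
- move=> f mf f01; rewrite /i; split.
  + by rewrite leeDl// lee_fin; lra.
  + by rewrite leeDl// lee_fin; lra.
- move=> f mf f01; rewrite /i; split.
  + by rewrite leeDl// lee_fin; lra.
  + by rewrite leeDl// lee_fin; lra.
- have -> : [set z | ~ [set p : T * T | mdist p.1 p.2 < e] (i z, i z)] = set0.
    by rewrite -subset0 => z /=; rewrite mdistxx.
  by rewrite measure0 lee_fin ltW.
Qed.

Lemma dGHP_self T (e : R) : 0 < e -> (dGHP T T < e%:E)%E.
Proof.
move=> e0; have e1 : 0 < e / 8 by lra.
have [m Hm] := @close_self T _ e1.
by apply: (le_lt_trans (close_dGHP (ltW e1) Hm)); rewrite lte_fin; lra.
Qed.

Lemma tree_iso_repr T : tree_iso T (repr (tree_class T)).
Proof. by apply/asboolP; have /eqmodP := esym (reprK (tree_class T)). Qed.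

Lemma tree_class_eq T T' : tree_iso T T' -> tree_class T = tree_class T'.
Proof. by move=> i; apply/eqmodP/asboolP. Qed.

Lemma tree_iso_inv T T' : tree_iso T T' -> exists (f : T -> T') (g : T' -> T),
  [/\ cancel f g, cancel g f, forall x y, mdist (f x) (f y) = mdist x y,
      forall x y, mdist (g x) (g y) = mdist x y &
      f (root T) = root T' /\
      forall A : set (borel T'), measurable A -> mass T' A = mass T (f @^-1` A)].
Proof.
move=> [f [fd fs fr fm]].
have /choice[g fg] : forall y, exists x, f x = y.
  by move=> y; have : range f y by [rewrite fs|]; move=> [x _ <-]; exists x.
have gf x : g (f x) = x by apply/mdist_positivity; rewrite -fd fg mdistxx.
have gd x y : mdist (g x) (g y) = mdist x y by rewrite -fd !fg.
by exists f, g.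
Qed.

Lemma measurable_isometry T T' (f : T -> T') : (forall x y, mdist (f x) (f y) = mdist x y) ->
  measurable_fun setT (f : borel T -> borel T').
Proof.
move=> fd; apply: (@continuous_borel T T'); apply: (continuous_lip ltr01) => x y.
by rewrite fd mul1r.
Qed.

Lemma integral_iso T T' (f : T -> T') (mf : measurable_fun setT (f : borel T -> borel T'))
    (phi : borel T' -> \bar R) :
  (forall A : set (borel T'), measurable A -> mass T' A = mass T (f @^-1` A)) ->
  measurable_fun setT phi -> (forall x, 0 <= phi x)%E ->
  (\int[mass T']_x phi x = \int[mass T]_x phi (f x))%E.
Proof.
move=> fm mphi phi0; rewrite -(integral_image_measure (mass T) mf mphi phi0).
by apply: eq_measure_integral => A mA _; rewrite image_measureE; exact: fm.
Qed.

(** Needed because open sets of [tree_space] are defined through representatives. The factor 4 is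
    the loss in going to [close] and back. *)
Lemma dGHP_iso A B A' B' (e : R) : tree_iso A A' -> tree_iso B B' ->
  (dGHP A B < e%:E)%E -> (dGHP A' B' <= (4 * e)%:E)%E.
Proof.
move=> /tree_iso_inv[f [f' [fK f'K fd f'd [fr fm]]]].
move=> /tree_iso_inv[g [g' [gK g'K gd g'd [gr gm]]]].
move=> /dGHP_lt_close[C [m Cm]].
have [[mC _ _ Croot] dis _ _ mCe] := Cm.
have mf := measurable_isometry fd; have mg := measurable_isometry gd.
have mf' := measurable_isometry f'd; have mg' := measurable_isometry g'd.
pose a : borel (A * B)%type -> borel A' := (f : borel A -> borel A') \o (fst : borel (A * B)%type -> borel A).
pose b : borel (A * B)%type -> borel B' := (g : borel B -> borel B') \o (snd : borel (A * B)%type -> borel B).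
have ma : measurable_fun setT a by exact: measurableT_comp mf (@measurable_fst_borel R A B).
have mb : measurable_fun setT b by exact: measurableT_comp mg (@measurable_snd_borel R A B).
pose C' : set (A' * B') := [set p | C (f' p.1, g' p.2)].
have := @dGHP_image R _ _ m A' B' a b ma mb C' e; apply.
- exact: (finite_lty m measurableT).
- exact: close_ge0 Cm.
apply: close_image.
- split.
  + have ma' : measurable_fun setT ((f' : borel A' -> borel A) \o (fst : borel (A' * B')%type -> borel A')).
      exact: measurableT_comp mf' (@measurable_fst_borel R A' B').
    have mb' : measurable_fun setT ((g' : borel B' -> borel B) \o (snd : borel (A' * B')%type -> borel B')).
      exact: measurableT_comp mg' (@measurable_snd_borel R A' B').
    by have := measurable_fun_pair_borel ma' mb' measurableT mC; rewrite setTI.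
  + apply/seteqP; split=> // x _; have [y Cy] := close_left Cm (f' x).
    by exists (x, g y) => //; rewrite /C' /= gK.
  + apply/seteqP; split=> // y _; have [x Cx] := close_right Cm (g' y).
    by exists (f x, y) => //; rewrite /C' /= fK.
  + by rewrite /C' /= -fr -gr fK gK.
- move=> [x y] [z w] /= Cx Cz; have [_ dis' _ _ _] := Cm.
  by have := dis' _ _ Cx Cz; rewrite /= f'd g'd.
- move=> phi mphi phi01.
  have phi0 x : (0 <= phi x)%E by case/andP: (phi01 x).
  have E := integral_image_measure m ma mphi phi0.
  rewrite (integral_iso mf fm mphi phi0) E; apply: (close_int1 Cm).
    exact: measurableT_comp mphi mf.
  by move=> x; exact: phi01.
- move=> phi mphi phi01.
  have phi0 x : (0 <= phi x)%E by case/andP: (phi01 x).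
  have E := integral_image_measure m mb mphi phi0.
  rewrite (integral_iso mg gm mphi phi0) E; apply: (close_int2 Cm).
    exact: measurableT_comp mphi mg.
  by move=> x; exact: phi01.
- have -> : [set z | ~ C' (a z, b z)] = ~` C => //.
  by apply/seteqP; split=> -[x y]; rewrite /C' /a /b /= fK gK.
Qed.

End self_close.

(** * The measure Psi *)

Section tree_height_topology.
Context {R : realType}.
Implicit Types T : weighted_tree R.

Definition nnval (c : nneg_real) : R := \val (c : set_type [set x : R | 0 <= x]).

Lemma nnval_height T (y : T) : nnval (height y) = hgt y. Proof. by []. Qed.

Lemma open_tree_height (O : set (tree_height R)) T (c : nneg_real) :
  open O -> O (tree_class T, c) -> exists2 e : R, 0 < e &
    forall T' (c' : nneg_real), (dGHP T T' < e%:E)%E -> `|nnval c - nnval c'| < e ->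
      O (tree_class T', c').
Proof.
move=> oO Oc.
have : nbhs (tree_class T, c) O by exact: open_nbhs_nbhs.
move=> [[P Q] /= [nP nQ] PQ].
have [e1 e10 eP] : exists2 e : R, 0 < e & forall T', (dGHP T T' < e%:E)%E -> P (tree_class T').
  move: nP; rewrite nbhsE => -[U [oU Ux] UP].
  (* The passage to representatives multiplies by 4, which leaves [e / 2 < e]. *)
  have [e e0 eU] := oU _ Ux; exists (e / 8); first by rewrite divr_gt0.
  move=> T' TT'; apply: UP; apply: eU.
  apply: (le_lt_trans (dGHP_iso (tree_iso_repr T) (tree_iso_repr T') TT')).
  by rewrite lte_fin; lra.
have [e2 e20 eQ] : exists2 e : R, 0 < e & forall c' : nneg_real, `|nnval c - nnval c'| < e -> Q c'.
  move: nQ; rewrite nbhsE => -[U [[V oV VU] Uc] UQ].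
  have : nbhs (nnval c) V by apply: open_nbhs_nbhs; split=> //; rewrite -VU in Uc.
  move=> /nbhs_ballP[e e0 eV]; exists e => // c' cc'; apply: UQ; rewrite -VU.
  exact: eV.
exists (Order.min e1 e2); first by rewrite lt_min e10.
move=> T' c' TT' cc'; apply: PQ; split=> /=.
  by apply: eP; apply: lt_le_trans TT' _; rewrite lee_fin ge_min lexx.
by apply: eQ; apply: lt_le_trans cc' _; rewrite ge_min lexx orbT.
Qed.

End tree_height_topology.

Section subtree_map.
Context {R : realType}.
Variable T : weighted_tree R.
Implicit Types x y z : T.

Definition subtree_height y : tree_height R := (tree_class (subtree y), height y).

Lemma open_subtree_height (O : set (tree_height R)) x (h : R) : open O -> good x h ->
  O (subtree_height (anc x h)) -> exists2 e : R, 0 < e &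
    forall (T' : weighted_tree R) C (m : {finite_measure set (borel (T * T')%type) -> \bar R}),
    close C m e -> forall (x' : T') (h' : R), C (x, x') -> `|h - h'| < e ->
    0 <= h' <= hgt x' -> O (tree_class (subtree (anc x' h')), height (anc x' h')).
Proof.
move=> oO gh /(open_tree_height oO)[e e0 eO].
have [h0 hx _ _] := gh; have hi : 0 <= h <= hgt x by rewrite !ltW.
have [k k0 kP] := subtree_near gh e0.
exists (Order.min e k); first by rewrite lt_min e0.
move=> T' C m Cm x' h' Cx hh' hx'; apply: eO; last first.
  rewrite !nnval_height !hgt_anc_id//; apply: lt_le_trans hh' _.
  by rewrite ge_min lexx.
have [mek1 mek2] : Order.min e k <= e /\ Order.min e k <= k.
  by rewrite !ge_min !lexx orbT.
apply: (kP T' C m _ x' h' Cx) => //; last by rewrite (le_trans (ltW hh')).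
have [c1 c2 c3 c4 c5] := Cm; have ek : 2 * Order.min e k <= 2 * k by lra.
split=> //; [|exact: near_measureW ek c3|exact: near_measureW ek c4|].
  by move=> p q Cp Cq; apply: le_trans (c2 p q Cp Cq) ek.
by apply: le_trans c5 _; rewrite lee_fin.
Qed.

End subtree_map.

(** * Measurability of the map from a point to its subtree and height *)

Section measurable_subtree_height.
Context {R : realType}.
Variable T : weighted_tree R.
Implicit Types x y z : T.

Notation RR := (measurableTypeR R).
Let u := dense_seq T.
Let G : borel T -> borel (tree_height R) := @subtree_height R T.

(** Along the ray, a good height in the preimage is interior to it, by stability applied to [T] and
    itself. The preimage is thus an open set of heights together with a countable one. *)
Lemma measurable_ray_preimage (O : set (tree_height R)) x : open O ->
  measurable (segment (root T) x `&` G @^-1` O : set (borel T)).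
Proof.
move=> oO.
pose B : set R := [set h | 0 <= h <= hgt x /\ O (G (anc x h))].
have mB : measurable B.
  have -> : B = B^° `|` (B `\` B^°) by rewrite setDUK//; exact: interior_subset.
  apply: measurableU; first by apply: open_measurable; exact: open_interior.
  apply: countable_measurable => //.
  apply: (sub_countable (B := [set h | 0 <= h <= hgt x /\ ~ good x h])); last exact: countable_bad.
  apply: subset_card_le => h [[hi Oh] nI]; split=> // gh; apply: nI.
  have [h0 hx _ _] := gh.
  have [e e0 eO] := open_subtree_height oO gh Oh.
  have [m Cm] := close_self T e0.
  pose r := Order.min e (Order.min h (hgt x - h)).
  have r0 : 0 < r by rewrite !lt_min e0 h0 subr_gt0 hx.
  apply/nbhs_ballP; exists r => // h'; rewrite /ball /= /r !lt_min => /and3P[h1 h2 h3].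
  have hi' : 0 <= h' <= hgt x.
    by move: h2 h3; rewrite !ltr_norml => /andP[? ?] /andP[? ?]; apply/andP; split; lra.
  split=> //; apply: (eO T _ m Cm x h') => //=; by rewrite mdistxx.
have -> : segment (root T) x `&` G @^-1` O = segment (root T) x `&` (@hgt R T : borel T -> R) @^-1` B.
  apply/seteqP; split=> y /= [yx Gy]; split=> //.
    by rewrite /B /= -(segment_ancE yx); split=> //; exact: ray_hgt.
  by move: Gy; rewrite /B /= -(segment_ancE yx) => -[].
apply: measurableI; first exact: measurable_ray.
by have := @measurable_hgt R T measurableT B mB; rewrite setTI.
Qed.

Definition skeleton : set (borel T) := \bigcup_n (segment (root T) (u n) `\` [set u n]).

Let mF n : measurable (segment (root T) (u n) `\` [set u n] : set (borel T)).
Proof. by apply: measurableD; [exact: measurable_ray|exact: measurable_point]. Qed.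

Lemma measurable_skeleton : measurable skeleton.
Proof. exact: bigcupT_measurable. Qed.

(** The set strictly above [y] is open; if it were nonempty it would contain a point of the dense
    sequence, and [y] would lie on the ray to that point. *)
Lemma off_skeleton y : ~ skeleton y -> above y = [set y].
Proof.
move=> ny; apply/seteqP; split=> [z yz|_ ->]; last exact: above_self.
apply: contrapT => /eqP zy; apply: ny.
have d0 : 0 < mdist z y by rewrite mdist_gt0.
have [n nz] := dense_seqP z d0; rewrite metric_sym in nz.
have [yn ny] := above_neq_open yz zy nz.
by exists n => //; split=> //=; exact/nesym/eqP.
Qed.

Let atoms : set (borel T) := [set y | (0 < mass T [set y])%E].

Let matoms (A : set (borel T)) : A `<=` atoms -> measurable A.
Proof.
move=> Aa; apply: countable_measurable; first exact: measurable_point.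
apply: (sub_countable (B := atoms)); first exact: subset_card_le.
by apply: countable_atoms; exact: measurable_point.
Qed.

Lemma trivial_subtree y : ~ skeleton y -> ~ atoms y ->
  tree_class (subtree y) = tree_class (@unit_weighted_tree R).
Proof.
move=> ny na; have ay := off_skeleton ny.
have my : mass T [set y] = 0%E by apply/eqP; rewrite eq_le measure_ge0 andbT leNgt; apply/negP.
have E (a : subtree y) : a = root (subtree y).
  have : [set y] (incl a) by rewrite -ay; exact: incl_above.
  by move=> ya; exact: sub_val_inj.
apply: tree_class_eq; exists (fun _ => root (@unit_weighted_tree R)); split=> //.
- by move=> a b; rewrite (E a) (E b) !mdistxx.
- by apply/seteqP; split=> // -[] _; exists (root (subtree y)).
move=> A mA; rewrite -[RHS]/(mass (subtree y) (cst (root (@unit_weighted_tree R)) @^-1` A)).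
rewrite preimage_cst; case: ifP => _; last by rewrite measure0.
by rewrite subtree_mass// preimage_setT setIT ay.
Qed.

(** The skeleton is a countable union of rays without their tops, and the atoms are countable.
    Everywhere else the subtree is a single point without mass, so that [G] depends on the height
    alone, continuously. *)
Lemma measurable_subtree_height : measurable_fun setT G.
Proof.
apply: (@measurable_fun_gen _ (borel T) (tree_height R) (@open (tree_height R))) => O oO.
have -> : G @^-1` O =
    (\bigcup_n ((segment (root T) (u n) `&` G @^-1` O) `\` [set u n])) `|`
    ((G @^-1` O `&` atoms `\` skeleton) `|`
    ([set y : T | O (tree_class (@unit_weighted_tree R), height y)] `\` atoms `\` skeleton)).
  apply/seteqP; split=> y.
    move=> Oy; have [[n _ [yn ny]]|ny] := pselect (skeleton y); first by left; exists n.
    right; have [ay|ay] := pselect (atoms y); [by left|right].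
    by split=> //; split=> //; move: Oy; rewrite /G /= /subtree_height trivial_subtree.
  move=> [[n _ [[_ ?] _]]//|[[[]//]|[[Oy ay] ny]]].
  by rewrite /G /= /subtree_height trivial_subtree.
apply: measurableU.
  apply: bigcupT_measurable => n; apply: measurableD; last exact: measurable_point.
  exact: measurable_ray_preimage.
apply: measurableU; apply: measurableD; [|exact: measurable_skeleton| |exact: measurable_skeleton].
  by apply: matoms => y [].
apply: measurableD; last exact: matoms.
apply: open_borel; rewrite openE => y /= Oy.
have [e e0 eO] := open_tree_height oO Oy.
apply/nbhs_mdistP; exists e => // z yz; apply: eO; first exact: dGHP_self.
by rewrite !nnval_height (le_lt_trans (hgt_lip _ _)).
Qed.

End measurable_subtree_height.

(** * Exchange of the integrals over ancestor pairs *)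

Section fubini_length.
Context {R : realType}.
Variable T : weighted_tree R.
Implicit Types x y z : T.

(** A separate name to which the sigma-finiteness required by Tonelli can be attached as an
    instance. *)
Definition tree_length : set (borel T) -> \bar R := length_measure T.

HB.instance Definition _ := isMeasure.Build _ _ _ tree_length (measure0 (length_measure T))
  (measure_ge0 (length_measure T)) (@measure_semi_sigma_additive _ _ _ (length_measure T)).

Let tree_length_sf : sigma_finite setT tree_length.
Proof. by have [] := length_measureP T. Qed.

HB.instance Definition _ := @Measure_isSigmaFinite.Build _ _ _ tree_length tree_length_sf.

Definition ancestry : set (borel T * borel T) := [set p | segment (root T) p.1 p.2].

Lemma measurable_ancestry : measurable ancestry.
Proof.
(* The identity is measurable from the product of the Borel structures to the Borel sets of the
   product, so that open sets of pairs become measurable in the former. *)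
have mid := measurable_fun_pair_borel
  (@measurable_fst _ _ (borel T) (borel T)) (@measurable_snd _ _ (borel T) (borel T)).
pose U : set (T * T) := [set p | hgt p.1 < mdist p.1 p.2 + hgt p.2].
have oU : open U.
  rewrite openE => -[a b] /= ab.
  pose r := (mdist a b + hgt b - hgt a) / 4.
  have r0 : 0 < r by rewrite divr_gt0// subr_gt0.
  exists ([set c | mdist a c < r], [set c | mdist b c < r]).
    by split; apply/nbhs_mdistP; exists r.
  move=> [c c'] /= [ac bc].
  have := hgt_lip a c; have := hgt_lip b c'.
  have := metric_triangle a c b; have := metric_triangle c c' b.
  rewrite (metric_sym c' b) !ler_norml => ? ? /andP[? ?] /andP[? ?].
  move: ac bc; rewrite /U /= /r; lra.
have mU : measurable (~` (U : set (borel (T * T)%type))).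
  by apply: measurableC; exact: sub_sigma_algebra.
have := mid measurableT _ mU; rewrite setTI; congr measurable.
apply/seteqP; split=> -[a b]; rewrite /ancestry /U /=.
  move/negP; rewrite -leNgt => ab; apply/(segmentP (space_tree T))/eqP.
  by rewrite eq_le metric_triangle andbT -/(hgt _) -/(hgt _) (metric_sym b a) addrC.
move/(segmentP (space_tree T)); rewrite -/(hgt _) -/(hgt _) (metric_sym b a) addrC => ->.
by rewrite ltxx.
Qed.

Let onE (F : borel T -> \bar R) : borel T * borel T -> \bar R := (F \o snd) \_ ancestry.

Let measurable_onE F : measurable_fun setT F -> measurable_fun setT (onE F).
Proof.
move=> mF; apply/(measurable_restrictT _ measurable_ancestry); apply: measurable_funTS.
exact: measurableT_comp mF measurable_snd.
Qed.

Let onE_ge0 (F : borel T -> \bar R) p : (forall y, 0 <= F y)%E -> (0 <= onE F p)%E.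
Proof. by move=> F0; rewrite /onE patchE; case: ifP => // _; exact: F0. Qed.

Let int1 (F : borel T -> \bar R) x : measurable_fun setT F -> (forall c, 0 <= F c)%E ->
  (\int[tree_length]_y onE F (x, y) =
   \int[lebesgue_measure]_(h in `[0%R, hgt x]) F (anc x h))%E.
Proof.
move=> mF F0; rewrite -(integral_ray (length_ray (T := T)) x mF F0).
rewrite [RHS]integral_mkcond; apply: eq_integral => y _.
rewrite /onE !patchE.
by congr (if _ then _ else _); apply/idP/idP; rewrite !inE.
Qed.

Let int2 (F : borel T -> \bar R) y : measurable_fun setT F -> (forall c, 0 <= F c)%E ->
  (\int[mass T]_x onE F (x, y) = mass T (above y) * F y)%E.
Proof.
move=> mF F0; transitivity (\int[mass T]_(x in (above y : set (borel T))) F y)%E.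
  rewrite [RHS]integral_mkcond; apply: eq_integral => x _.
  rewrite /onE !patchE.
  by congr (if _ then _ else _); apply/idP/idP; rewrite !inE.
by rewrite muleC; exact: (integral_cst (mass T) (measurable_above y) (F y)).
Qed.

Lemma measurable_ray_integral (F : borel T -> \bar R) :
  measurable_fun setT F -> (forall y, 0 <= F y)%E ->
  measurable_fun [set: borel T] (fun x : borel T =>
    (\int[lebesgue_measure]_(h in `[0%R, hgt (x : T)]) F (anc (x : T) h))%E).
Proof.
move=> mF F0.
have := @measurable_fun_fubini_tonelli_F _ _ _ _ _ tree_length (onE F) (measurable_onE mF) (fun p => onE_ge0 p F0).
by congr measurable_fun; apply/funext => x; rewrite /fubini_F int1.
Qed.

Lemma measurable_mass_above (F : borel T -> \bar R) :
  measurable_fun setT F -> (forall y, 0 <= F y)%E ->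
  measurable_fun [set: borel T] (fun y : borel T => (mass T (above (y : T)) * F y)%E).
Proof.
move=> mF F0.
have := @measurable_fun_fubini_tonelli_G _ _ _ _ _ (mass T) (onE F) (measurable_onE mF) (fun p => onE_ge0 p F0).
by congr measurable_fun; apply/funext => x; rewrite /fubini_G int2.
Qed.

Lemma fubini_length (F : borel T -> \bar R) :
  measurable_fun setT F -> (forall y, 0 <= F y)%E ->
  (\int[mass T \x tree_length]_(p in ancestry) F p.2 =
    \int[length_measure T]_y (mass T (above y) * F y) /\
   \int[mass T \x tree_length]_(p in ancestry) F p.2 =
    \int[mass T]_x \int[lebesgue_measure]_(h in `[0%R, hgt x]) F (anc x h))%E.
Proof.
move=> mF F0.
have E : (\int[mass T \x tree_length]_(p in ancestry) F p.2 =
    \int[mass T \x tree_length]_p onE F p)%E by rewrite integral_mkcond.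
have F01 p : (0 <= onE F p)%E by exact: onE_ge0.
split; rewrite E.
  rewrite fubini_tonelli2//; last exact: measurable_onE.
  by apply: eq_integral => y _; rewrite /fubini_G int2.
rewrite fubini_tonelli1//; last exact: measurable_onE.
by apply: eq_integral => x _; rewrite /fubini_F int1.
Qed.

End fubini_length.

Section psi_measure.
Context {R : realType}.
Variable T : weighted_tree R.

Let G : borel T -> borel (tree_height R) := @subtree_height R T.

Let mG : measurable_fun [set: borel T * borel T] (G \o (@snd (borel T) (borel T))).
Proof. exact: measurableT_comp (@measurable_subtree_height R T) measurable_snd. Qed.

Let pm : {measure set (borel T * borel T) -> \bar R} := (mass T \x @tree_length R T)%E.

(** The product of mass and length, restricted to the pairs whose second point is an ancestor of the
    first, and pushed forward by the subtree and height of the ancestor. *)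
Let psi0 : {measure set (borel (tree_height R)) -> \bar R} :=
  image_measure (mrestr pm (@measurable_ancestry R T)) mG.

Let int_psi0 (f : borel (tree_height R) -> \bar R) : measurable_fun setT f ->
  (forall z, 0 <= f z)%E ->
  (\int[psi0]_z f z = \int[pm]_(p in @ancestry R T) f (G p.2))%E.
Proof.
move=> mf f0; have mfG := measurableT_comp mf mG.
transitivity (\int[mrestr pm (@measurable_ancestry R T)]_p (f \o (G \o snd)) p)%E.
  exact: (integral_image_measure (mrestr pm (@measurable_ancestry R T)) mG mf f0).
exact: (integral_mrestr pm (@measurable_ancestry R T) mfG (fun p => f0 _)).
Qed.

Let psi0_fin : (psi0 setT < +oo)%E.
Proof.
rewrite -[psi0 setT]mul1e -integral_cst// int_psi0//.
have [_ ->] := @fubini_length R T (cst 1%E) (measurable_cst _) (fun _ => lee01).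
have [K K0 HK] := hgt_bounded T.
apply: (@le_lt_trans _ _ (\int[mass T]_x K%:E)%E).
  apply: ge0_le_integral => //.
  - by move=> x _; exact: integral_ge0.
  - exact: measurable_ray_integral.
  - move=> x _; rewrite integral_cst//= mul1e.
    by rewrite lebesgue_cc ?hgt_ge0// lee_fin.
rewrite integral_cst// lte_mul_pinfty ?lee_fin ?ltW//; exact: finite_lty.
Qed.

Definition psi_measure : finite_measures R := finite_measure_of psi0_fin.

Lemma integral_psi_length (f : borel (tree_height R) -> \bar R) : measurable_fun setT f ->
  (forall z, 0 <= f z)%E ->
  (\int[psi_measure]_z f z =
   \int[length_measure T]_y (mass T (above y) * f (subtree_height y)))%E.
Proof.
move=> mf f0; rewrite -[LHS]/(\int[psi0]_z f z)%E int_psi0//.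
have mfG := measurableT_comp mf (@measurable_subtree_height R T).
exact: (proj1 (@fubini_length R T (f \o G) mfG (fun y => f0 _))).
Qed.

Lemma integral_psi_ray (f : borel (tree_height R) -> \bar R) : measurable_fun setT f ->
  (forall z, 0 <= f z)%E ->
  (\int[psi_measure]_z f z =
   \int[mass T]_x \int[lebesgue_measure]_(h in `[0%R, hgt x]) f (subtree_height (anc x h)))%E.
Proof.
move=> mf f0; rewrite -[LHS]/(\int[psi0]_z f z)%E int_psi0//.
have mfG := measurableT_comp mf (@measurable_subtree_height R T).
exact: (proj2 (@fubini_length R T (f \o G) mfG (fun y => f0 _))).
Qed.

Lemma is_Psi_psi : is_Psi T psi_measure.
Proof.
move=> f mf f0; split; last exact: integral_psi_length.
apply: (measurable_mass_above (F := f \o G)); last by move=> y; exact: f0.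
exact: measurableT_comp mf (@measurable_subtree_height R T).
Qed.

End psi_measure.

Section psi_iso.
Context {R : realType}.
Implicit Types T : weighted_tree R.

Section iso.
Variables (T T' : weighted_tree R) (phi : T -> T') (phi' : T' -> T).
Hypotheses (phiK : cancel phi phi') (phi'K : cancel phi' phi).
Hypothesis phid : forall x y, mdist (phi x) (phi y) = mdist x y.
Hypothesis phir : phi (root T) = root T'.
Hypothesis phim : forall A : set (borel T'), measurable A -> mass T' A = mass T (phi @^-1` A).

Let hgt_phi x : hgt (phi x) = hgt x.
Proof. by rewrite /hgt -phir phid. Qed.

Let above_phi y z : above (phi y) (phi z) <-> above y z.
Proof. by rewrite !above_gp /gp !hgt_phi phid. Qed.

Let anc_phi x h : 0 <= h <= hgt x -> anc (phi x) h = phi (anc x h).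
Proof.
move=> hx; have : segment (root T') (phi x) (phi (anc x h)).
  apply/(above_phi (anc x h) x); exact: segment_anc.
by move/segment_ancE ->; rewrite hgt_phi hgt_anc_id.
Qed.

Let subtree_phi y : tree_class (subtree (phi y)) = tree_class (subtree y).
Proof.
apply/esym/tree_class_eq.
pose g (a : subtree y) : subtree (phi y) := retract (phi y) (phi (incl a)).
have ig a : incl (g a) = phi (incl a).
  by rewrite /g inclK//; apply/above_phi; exact: incl_above.
exists g; split.
- by move=> a b; rewrite mdist_incl !ig phid.
- apply/seteqP; split=> // c _.
  have yc : above y (phi' (incl c)) by apply/above_phi; rewrite phi'K; exact: incl_above.
  exists (retract y (phi' (incl c))) => //; apply: sub_val_inj.
  by rewrite -[LHS]/(incl _) ig inclK// phi'K.
- by apply: sub_val_inj; rewrite -[LHS]/(incl _) ig.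
move=> A mA.
have mg : measurable (g @^-1` A : set (borel (subtree y))).
  apply: isometry_measurable mA => a b.
  by rewrite mdist_incl !ig phid.
rewrite !subtree_mass//.
rewrite phim; last first.
  apply: measurableI; first exact: measurable_above.
  by have := @measurable_retract R T' (phi y) measurableT A mA; rewrite setTI.
congr (mass T _); apply/seteqP; split=> z /=.
  move=> [/above_phi yz Az]; split=> //; suff -> : g (retract y z) = retract (phi y) (phi z) by [].
  by rewrite /g inclK.
move=> [yz Az]; split; first exact/above_phi.
by move: Az; rewrite /g inclK.
Qed.

Let subtree_height_phi y : subtree_height (phi y) = subtree_height y.
Proof.
rewrite /subtree_height subtree_phi; congr pair.
by apply: val_inj; rewrite /= -phir phid.
Qed.

(** Uses the form with rays, where the length measures chosen on the two trees do not appear. *)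
Lemma integral_psi_iso0 (f : borel (tree_height R) -> \bar R) : measurable_fun setT f ->
  (forall z, 0 <= f z)%E ->
  (\int[psi_measure T']_z f z = \int[psi_measure T]_z f z)%E.
Proof.
move=> mf f0; rewrite !integral_psi_ray//.
have mfG : measurable_fun setT (fun y : borel T' => f (subtree_height (y : T'))).
  exact: measurableT_comp mf (@measurable_subtree_height R T').
rewrite (integral_iso (measurable_isometry phid) phim); last 2 first.
- exact: (measurable_ray_integral mfG).
- by move=> x; exact: integral_ge0.
apply: eq_integral => x _; rewrite hgt_phi; apply: eq_integral => h.
by rewrite inE /= in_itv /= => hx; rewrite anc_phi// subtree_height_phi.
Qed.

End iso.

Lemma integral_psi_iso T T' (f : borel (tree_height R) -> \bar R) : tree_iso T T' ->
  measurable_fun setT f -> (forall z, 0 <= f z)%E ->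
  (\int[psi_measure T']_z f z = \int[psi_measure T]_z f z)%E.
Proof.
move=> /tree_iso_inv[phi [phi' [phiK phi'K phid _ [phir phim]]]].
by apply: (@integral_psi_iso0 T T' phi phi').
Qed.

Definition Psi (tau : tree_space R) : finite_measures R := psi_measure (repr tau).

Lemma is_Psi_Psi T : is_Psi T (Psi (tree_class T)).
Proof.
move=> f mf f0; have [H1 H2] := @is_Psi_psi R T f mf f0; split=> //.
by rewrite -H2 /Psi; apply: integral_psi_iso => //; exact: tree_iso_repr.
Qed.

Lemma is_Psi_unique T (nu nu' : finite_measures R) : is_Psi T nu -> is_Psi T nu' ->
  forall A : set (borel (tree_height R)), measurable A -> nu A = nu' A.
Proof.
move=> H H' A mA.
have mf : measurable_fun setT (fun z : borel (tree_height R) => (\1_A z : R)%:E).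
  by apply/measurable_EFinP; exact: measurable_indic.
have f0 (z : tree_height R) : (0 <= (\1_A z : R)%:E)%E by rewrite lee_fin.
have [_ E] := H _ mf f0; have [_ E'] := H' _ mf f0.
by move: E; rewrite -E' !integral_indic// !setIT.
Qed.

End psi_iso.

(** * Continuity *)

Section close_monotone.
Context {R : realType}.
Implicit Types T : weighted_tree R.

Lemma close_le T T' C (m : {measure set (borel (T * T')%type) -> \bar R}) (e e' : R) :
  e <= e' -> close C m e -> @close R T T' C m e'.
Proof.
move=> ee' [c1 c2 c3 c4 c5]; have ek : 2 * e <= 2 * e' by lra.
split=> //; [|exact: near_measureW ek c3|exact: near_measureW ek c4|].
  by move=> p q Cp Cq; apply: le_trans (c2 p q Cp Cq) ek.
by apply: le_trans c5 _; rewrite lee_fin.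
Qed.

End close_monotone.

Section ray_integrals.
Context {R : realType}.
Variables (f : tree_height R -> R) (M : R).
Hypotheses (cf : continuous f) (M0 : 0 < M) (f0 : forall z, 0 <= f z) (fM : forall z, f z <= M).
Implicit Types T : weighted_tree R.

Notation RR := (measurableTypeR R).
Notation lam := (@lebesgue_measure R).

Lemma integral_cst_cc (c b : R) : 0 <= b ->
  (\int[lam]_(h in `[0%R, b]) c%:E = (c * b)%:E)%E.
Proof.
move=> b0; have mI : measurable (`[0, b]%classic : set RR) by exact: measurable_itv.
transitivity (c%:E * lebesgue_measure (`[0%R, b]%classic : set R))%E.
  exact: (integral_cst lam mI c%:E).
by rewrite lebesgue_cc.
Qed.

Lemma integral_cst_oc (c a b : R) : a <= b ->
  (\int[lam]_(h in `]a, b]) c%:E = (c * (b - a))%:E)%E.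
Proof.
move=> ab; have mI : measurable (`]a, b]%classic : set RR) by exact: measurable_itv.
transitivity (c%:E * lebesgue_measure (`]a, b]%classic : set R))%E.
  exact: (integral_cst lam mI c%:E).
by rewrite lebesgue_oc.
Qed.

Lemma measurable_height_fun : measurable_fun [set: borel (tree_height R)] (f : borel (tree_height R) -> R).
Proof. exact: (@continuous_borelR R (tree_height R)). Qed.

Definition along T (x : T) (h : R) : R := f (subtree_height (anc x h)).

Lemma along_ge0 T (x : T) h : 0 <= along x h. Proof. exact: f0. Qed.

Lemma along_le T (x : T) h : along x h <= M. Proof. exact: fM. Qed.

Lemma measurable_along T (x : T) : measurable_fun [set: RR] (along x : RR -> R).
Proof.
have m1 := measurableT_comp measurable_height_fun (@measurable_subtree_height R T).
exact: measurableT_comp m1 (@measurable_anc R T x).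
Qed.

Definition ray_int T (x : T) : \bar R := (\int[lam]_(h in `[0%R, hgt x]) (along x h)%:E)%E.

Let mEalong T (x : T) (D : set RR) : measurable_fun D (fun h : RR => (along x h)%:E).
Proof. by apply: measurable_funTS; apply/measurable_EFinP; exact: measurable_along. Qed.

Lemma ray_int_ge0 T (x : T) : (0 <= ray_int x)%E.
Proof. by apply: integral_ge0 => h _; rewrite lee_fin along_ge0. Qed.

Lemma ray_int_le T (x : T) : (ray_int x <= (M * hgt x)%:E)%E.
Proof.
have mI : measurable (`[0, hgt x]%classic : set RR) by exact: measurable_itv.
apply: (@le_trans _ _ (\int[lam]_(h in `[0%R, hgt x]) M%:E)%E).
  apply: ge0_le_integral => //.
  - by move=> h _; rewrite lee_fin along_ge0.
  - by move=> h _; rewrite lee_fin along_le.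
by rewrite integral_cst_cc ?hgt_ge0.
Qed.

Lemma measurable_ray_int T : measurable_fun [set: borel T] (@ray_int T : borel T -> \bar R).
Proof.
apply: (@measurable_ray_integral R T (fun y => (f (subtree_height y))%:E)).
  apply/measurable_EFinP.
  exact: measurableT_comp measurable_height_fun (@measurable_subtree_height R T).
by move=> y; rewrite lee_fin f0.
Qed.

Lemma integral_psi_ray_int T : (\int[psi_measure T]_z (f z)%:E = \int[mass T]_x ray_int x)%E.
Proof.
rewrite (@integral_psi_ray R T (fun z => (f z)%:E))//.
by apply/measurable_EFinP; exact: measurable_height_fun.
Qed.

Lemma ray_int_cut T (x : T) (a : R) : 0 <= a <= hgt x ->
  (\int[lam]_(h in `[0%R, a]) (along x h)%:E <= ray_int x /\
   ray_int x <= \int[lam]_(h in `[0%R, a]) (along x h)%:E + (M * (hgt x - a))%:E)%E.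
Proof.
move=> /andP[a0 ax].
have m1 : measurable (`[0, a]%classic : set RR) by exact: measurable_itv.
have m2 : measurable (`]a, hgt x]%classic : set RR) by exact: measurable_itv.
have E : `[0, hgt x]%classic = `[0, a]%classic `|` `]a, hgt x]%classic.
  apply/seteqP; split=> h /=; rewrite !in_itv/=.
    by move=> /andP[h0 hx]; have [ha|ha] := leP h a; [left|right]; rewrite ?h0.
  by move=> [|] /andP[h1 h2]; apply/andP; split; lra.
rewrite /ray_int E ge0_integral_setU//=; last 2 first.
- by move=> h _; rewrite lee_fin along_ge0.
- apply/disj_setPS => h /= []; rewrite !in_itv/= => /andP[_ h1] /andP[h2 _]; lra.
split.
  by rewrite leeDl//; apply: integral_ge0 => h _; rewrite lee_fin along_ge0.
rewrite leeD2l//.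
apply: (@le_trans _ _ (\int[lam]_(h in `]a, hgt x]) M%:E)%E).
  apply: ge0_le_integral => //.
  - by move=> h _; rewrite lee_fin along_ge0.
  - by move=> h _; rewrite lee_fin along_le.
by rewrite integral_cst_oc.
Qed.

Lemma ae_good T (x : T) : {ae lam, forall h, `[0%R, hgt x]%classic h -> good x h}.
Proof.
exists [set h | 0 <= h <= hgt x /\ ~ good x h]; split.
- by apply: countable_measurable; [move=> ?|exact: countable_bad].
- by apply: countable_lebesgue_measure0; exact: countable_bad.
- by move=> h /= /not_implyP[]; rewrite in_itv.
Qed.

(** Otherwise each radius [n.+1%:R^-1] admits a counterexample. Along such a sequence the functions
    on the rays converge at every good height, hence almost everywhere, and dominated convergence
    contradicts the lower bound [e]. *)
Lemma near_ray T (x : T) (e : R) : 0 < e -> exists2 k : R, 0 < k &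
  forall T' C (m : {finite_measure set (borel (T * T')%type) -> \bar R}), close C m k ->
  forall x' : T', C (x, x') ->
  (\int[lam]_(h in `[0%R, hgt x]) `|along x h - along x' h|%:E <= e%:E)%E.
Proof.
move=> e0; apply: contrapT => H.
have mI : measurable (`[0, hgt x]%classic : set RR) by exact: measurable_itv.
(* Only the functions on the rays are extracted as a sequence; the trees, correspondences and
   couplings stay under the existential. *)
have {H} /choice[g gP] : forall n : nat, exists g : RR -> R, [/\ measurable_fun setT g,
    exists T' C (m : {finite_measure set (borel (T * T')%type) -> \bar R}) (x' : T'),
      [/\ close C m n.+1%:R^-1, C (x, x') & g = along x'],
    forall h, 0 <= g h <= M &
    ~ (\int[lam]_(h in `[0%R, hgt x]) `|along x h - g h|%:E <= e%:E)%E].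
  move=> n; apply: contrapT => Hn; apply: H; exists n.+1%:R^-1 => // T' C m Cm x' Cx.
  apply: contrapT => nle; apply: Hn; exists (along x'); split=> //.
  - exact: measurable_along.
  - by exists T', C, m, x'.
  - by move=> h; rewrite along_ge0 along_le.
pose F n (h : RR) : \bar R := `|along x h - g n h|%:E.
have mF n : measurable_fun `[0, hgt x]%classic (F n).
  apply: measurable_funTS; apply/measurable_EFinP; apply: measurableT_comp => //.
  by apply: measurable_funB; [exact: measurable_along|case: (gP n)].
have Fcvg : {ae lam, forall h, `[0%R, hgt x]%classic h -> F ^~ h @ \oo --> (cst 0%E : RR -> \bar R) h}.
  have [B [mB B0 subB]] := ae_good x; exists B; split=> // h nh; apply: subB => Hg; apply: nh => hi.
  have {Hg hi} gh := Hg hi.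
  apply: cvg_EFin; first by apply: nearW.
  apply/cvgrPdist_le => eta eta0.
  pose O : set (tree_height R) := [set z | `|along x h - f z| < eta].
  have oO : open O.
    apply: (open_comp _ (@open_lt R eta)) => z _ /=.
    by apply: cvg_norm; apply: cvgB; [exact: cvg_cst|exact: cf].
  have Oh : O (subtree_height (anc x h)) by rewrite /O /= subrr normr0.
  have [k k0 kO] := open_subtree_height oO gh Oh.
  have [h0 hx _ _] := gh.
  (* The second bound keeps [h] below [hgt x'], since the heights of [x] and [x'] differ by at most
     twice the radius. *)
  have k1 : 0 < Order.min k ((hgt x - h) / 4) by rewrite lt_min k0 divr_gt0// subr_gt0.
  have [N Nk] := invS_lt k1.
  exists N => // n /= Nn.
  rewrite sub0r normrN normr_id.
  have [_ [T' [C [m [x' [Cm Cx ->]]]]] _ _] := gP n.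
  have nN : n.+1%:R^-1 <= N.+1%:R^-1 :> R by rewrite lef_pV2 ?posrE// ler_nat.
  have ne1 : n.+1%:R^-1 <= k.
    by rewrite (le_trans nN)// (le_trans (ltW Nk))// ge_min lexx.
  have ne2 : n.+1%:R^-1 <= (hgt x - h) / 4.
    by rewrite (le_trans nN)// (le_trans (ltW Nk))// ge_min lexx orbT.
  apply: ltW; apply: (kO T' C m (close_le ne1 Cm) x' h Cx); rewrite ?subrr ?normr0//.
  have := close_hgt Cm Cx; rewrite ler_norml (ltW h0)/= => /andP[_].
  move: ne2; set q := n.+1%:R^-1; lra.
have iM : lam.-integrable `[0, hgt x]%classic (cst M%:E).
  apply/integrableP; split; first exact: measurable_cst.
  by rewrite /= integral_cst_cc ?hgt_ge0// ltry.
have FM : {ae lam, forall h n, `[0%R, hgt x]%classic h -> (`|F n h| <= (cst M%:E) h)%E}.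
  apply: aeW => h n _; rewrite /F /= lee_fin normr_id ler_norml.
  have [_ _ /(_ h)/andP[g1 g2] _] := gP n.
  by have := along_ge0 x h; have := along_le x h => ? ?; apply/andP; split; lra.
have [_ + _] := dominated_convergence mI mF (measurable_cst _) Fcvg iM FM.
move=> /fine_cvgP[fin /cvgrPdist_le/(_ e e0)] H.
have [n [/= Hn1 Hn2]] := filter_ex (filterI fin H).
have [_ _ _] := gP n; apply.
move: Hn2; rewrite sub0r normrN => /(le_trans (ler_norm _)).
rewrite -lee_fin fineK//; apply: le_trans; rewrite le_eqVlt; apply/orP; left; apply/eqP.
by apply: eq_integral => h _; rewrite /F /= subr0 normr_id.
Qed.

End ray_integrals.

Section integral_comparison.
Context d (Z : measurableType d) (R : realType).
Variable m : {measure set Z -> \bar R}.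

Lemma integral_le_dist (D : set Z) (u v : Z -> R) : measurable D ->
  measurable_fun setT u -> measurable_fun setT v -> (forall z, 0 <= u z) -> (forall z, 0 <= v z) ->
  (\int[m]_(z in D) (u z)%:E <= \int[m]_(z in D) (v z)%:E + \int[m]_(z in D) `|u z - v z|%:E)%E.
Proof.
move=> mD mu mv u0 v0.
have mE (w : Z -> R) : measurable_fun setT w -> measurable_fun D (fun z => (w z)%:E).
  by move=> mw; apply: measurable_funTS; exact/measurable_EFinP.
have mdist : measurable_fun setT (fun z => `|u z - v z|).
  by apply: measurableT_comp => //; exact: measurable_funB.
rewrite -ge0_integralD//; [|by move=> z _; rewrite lee_fin|exact: mE|exact: mE].
apply: ge0_le_integral => //.
- by move=> z _; rewrite lee_fin.
- exact: mE.
- by apply: emeasurable_funD; exact: mE.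
by move=> z _; rewrite -EFinD lee_fin -lerBlDl ler_norm.
Qed.

Lemma integral_le_off (u v : Z -> \bar R) (N : set Z) (L e dl A : R) :
  measurable_fun setT u -> measurable_fun setT v -> measurable N ->
  (forall z, 0 <= u z <= L%:E)%E -> (forall z, 0 <= v z)%E -> 0 <= L -> 0 <= e ->
  (m N <= dl%:E)%E -> (m setT <= A%:E)%E ->
  (forall z, ~ N z -> u z <= v z + e%:E)%E ->
  (\int[m]_z u z <= \int[m]_z v z + (e * A + L * dl)%:E)%E.
Proof.
move=> mu mv mN uL v0 L0 e0 Nd TA uv.
pose w : Z -> \bar R := (cst L%:E) \_ N.
have mw : measurable_fun setT w.
  by apply/(measurable_restrictT _ mN); exact: measurable_cst.
have w0 z : (0 <= w z)%E by rewrite /w patchE; case: ifP => // _; rewrite lee_fin.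
have ew0 z : (0 <= e%:E + w z)%E by rewrite adde_ge0// lee_fin.
have mew : measurable_fun setT (fun z => e%:E + w z)%E.
  by apply: emeasurable_funD => //; exact: measurable_cst.
apply: (@le_trans _ _ (\int[m]_z (v z + (e%:E + w z)))%E).
  apply: ge0_le_integral => //; first by move=> z _; case/andP: (uL z).
    exact: emeasurable_funD.
  move=> z _; have [Nz|nN] := pselect (N z); last first.
    by apply: (le_trans (uv z nN)); rewrite leeD2l// leeDl.
  have /andP[_ uz] := uL z; apply: (le_trans uz).
  rewrite /w patchE mem_set//= addeA leeDr// adde_ge0// lee_fin//.
rewrite ge0_integralD// leeD2l// ge0_integralD//.
rewrite EFinD !EFinM; apply: leeD.
  have -> : (\int[m]_x e%:E = e%:E * m setT)%E by exact: (integral_cst m measurableT e%:E).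
  by rewrite lee_wpmul2l// lee_fin.
rewrite /w -integral_mkcond.
have -> : (\int[m]_(x in N) cst L%:E x = L%:E * m N)%E by exact: (integral_cst m mN L%:E).
by rewrite lee_wpmul2l// lee_fin.
Qed.

Lemma near_measure_scale (nu : {measure set Z -> \bar R}) (e L : R) (F : Z -> \bar R) :
  (m setT < +oo)%E -> (nu setT < +oo)%E -> near_measure m nu e -> 0 < L ->
  measurable_fun setT F -> (forall z, 0 <= F z <= L%:E)%E ->
  (\int[m]_z F z <= \int[nu]_z F z + (L * e)%:E /\
   \int[nu]_z F z <= \int[m]_z F z + (L * e)%:E)%E.
Proof.
move=> mfin nufin H L0 mF FL.
pose f z := ((L^-1)%:E * F z)%E.
have f01 z : (0 <= f z <= 1)%E.
  have /andP[F0 F1] := FL z; rewrite /f mule_ge0 ?lee_fin ?invr_ge0 ?(ltW L0)//=.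
  by rewrite lee_pdivrMl// mule1.
have mf : measurable_fun setT f by exact: measurable_funeM.
have FE z : F z = (L%:E * f z)%E by rewrite /f muleA -EFinM divff ?gt_eqF// mul1e.
have f0 z : (0 <= f z)%E by case/andP: (f01 z).
have I (k : {measure set Z -> \bar R}) : (\int[k]_z F z = L%:E * \int[k]_z f z)%E.
  rewrite -ge0_integralZl// ?lee_fin ?ltW//; first by apply: eq_integral => z _; exact: FE.
have [H1 H2] := H f mf f01.
have fin1 := integral_unit_fin mfin mf f01; have fin2 := integral_unit_fin nufin mf f01.
rewrite !I; move: H1 H2; rewrite -(fineK fin1) -(fineK fin2) -!EFinM -!EFinD !lee_fin.
by move=> H1 H2; rewrite -!mulrDr !ler_wpM2l// ltW.
Qed.

End integral_comparison.

Lemma lee_chain (R : realType) (x y z w : \bar R) (r1 r2 r3 e : R) :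
  (x <= y + r1%:E -> y <= z + r2%:E -> z <= w + r3%:E -> (r1 + (r2 + r3) <= e)%R ->
   x <= w + e%:E)%E.
Proof.
move=> xy yz zw rr; apply: (le_trans xy).
apply: (@le_trans _ _ (z + r2%:E + r1%:E)%E); first by rewrite leeD2r.
apply: (@le_trans _ _ (w + r3%:E + r2%:E + r1%:E)%E); first by rewrite !leeD2r.
by rewrite -!addeA -!EFinD leeD2l// lee_fin; lra.
Qed.

(** Half of [e] pays for the comparison of corresponding points; the remaining terms amount to five
    times [L * k], whence the 10. *)
Lemma error_budget (R : realType) (L A k e : R) : 0 < L -> 0 < A -> k <= e / (10 * L) ->
  L * (2 * k) + ((e / (2 * A) * A + L * k) + L * (2 * k)) <= e.
Proof.
move=> L0 A0 kL.
have E1 : e / (2 * A) * A = e / 2 by field; rewrite gt_eqF.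
have E2 : e / 10 = L * (e / (10 * L)) by field; rewrite gt_eqF.
have : L * k <= e / 10 by rewrite E2; apply: ler_wpM2l kL; exact: ltW.
rewrite E1; lra.
Qed.

Section psi_continuity.
Context {R : realType}.
Variables (f : tree_height R -> R) (M : R).
Hypotheses (cf : continuous f) (M0 : 0 < M) (f0 : forall z, 0 <= f z) (fM : forall z, f z <= M).
Implicit Types T : weighted_tree R.

Notation RR := (measurableTypeR R).
Notation lam := (@lebesgue_measure R).
Let rint T (x : T) := @ray_int R f T x.

Lemma common_radius (X : eqType) (s : seq X) (P : X -> R -> Prop) :
  (forall x e e', e' <= e -> P x e -> P x e') ->
  (forall x, exists2 e, 0 < e & P x e) -> exists2 e, 0 < e & forall x, x \in s -> P x e.
Proof.
move=> Pd Pe; elim: s => [|x s [e e0 IH]]; first by exists 1.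
have [e' e'0 Px] := Pe x; exists (Order.min e e'); first by rewrite lt_min e0.
move=> y; rewrite inE => /orP[/eqP ->|ys].
  by apply: Pd Px; rewrite ge_min lexx orbT.
by apply: Pd (IH _ ys); rewrite ge_min lexx.
Qed.

(** Up to height [a] the rays to [x] and [xi] coincide, and so do those to [x'] and [xi']; a bound
    known at the pair [(xi, xi')] therefore passes to [(x, x')], up to the parts above [a]. *)
Let cut_compare T T' (x : T) (x' : T') (xi : T) (xi' : T') (a e h : R) :
  0 <= a -> a <= gp x xi -> a <= gp x' xi' ->
  (\int[lam]_(h in `[0%R, hgt xi]) `|along f xi h - along f xi' h|%:E <= e%:E)%E ->
  hgt x - a <= h -> (rint x <= rint x' + (e + M * h)%:E)%E /\
  (\int[lam]_(h in `[0%R, a]) (along f x' h)%:E <= rint x + e%:E)%E.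
Proof.
move=> a0 ax ax' He xh.
have mI : measurable (`[0, a]%classic : set RR) by exact: measurable_itv.
have mJ : measurable (`[0, hgt xi]%classic : set RR) by exact: measurable_itv.
have mal S (y : weighted_tree R) (z : y) : measurable_fun S (along f z : RR -> R).
  by apply: measurable_funTS; exact: measurable_along.
have aix : a <= hgt x by rewrite (le_trans ax) ?gp_lel.
have aix' : a <= hgt x' by rewrite (le_trans ax') ?gp_lel.
have aixi : a <= hgt xi by rewrite (le_trans ax) ?gp_ler.
have [x1 x2] := @ray_int_cut R f M cf f0 fM T x a (introT andP (conj a0 aix)).
have [x1' _] := @ray_int_cut R f M cf f0 fM T' x' a (introT andP (conj a0 aix')).
have D : (\int[lam]_(h in `[0%R, a]) `|along f x h - along f x' h|%:E <= e%:E)%E.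
  apply: le_trans He.
  rewrite (_ : (\int[lam]_(h in `[0%R, a]) _ =
      \int[lam]_(h in `[0%R, a]) `|along f xi h - along f xi' h|%:E)%E); last first.
    apply: eq_integral => k; rewrite inE /= in_itv/= => /andP[k0 ka].
    by rewrite /along (anc_eq (le_trans ka ax)) (anc_eq (le_trans ka ax')).
  apply: ge0_subset_integral => //.
    apply/measurable_EFinP; apply: measurableT_comp => //.
    by apply: measurable_funB; exact: mal.
  by move=> k /=; rewrite !in_itv/= => /andP[-> ka]; rewrite (le_trans ka).
have A0 (y : weighted_tree R) (z : y) k : 0 <= along f z k by exact: along_ge0.
split.
  apply: (le_trans x2).
  have := @integral_le_dist _ RR R lam _ _ _ mI (mal _ _ x) (mal _ _ x') (A0 _ x) (A0 _ x').
  move=> /(leeD2r (M * (hgt x - a))%:E)/le_trans; apply.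
  apply: (@le_trans _ _ (rint x' + e%:E + (M * h)%:E)%E); last by rewrite -addeA -EFinD.
  apply: leeD; first exact: leeD x1' D.
  by rewrite lee_fin; exact: (ler_wpM2l (ltW M0) xh).
have := @integral_le_dist _ RR R lam _ _ _ mI (mal _ _ x') (mal _ _ x) (A0 _ x') (A0 _ x).
move/le_trans; apply; apply: leeD => //.
apply: le_trans D; rewrite le_eqVlt; apply/orP; left; apply/eqP.
by apply: eq_integral => k _; rewrite distrC.
Qed.

Lemma close_ray_int T (e : R) : 0 < e -> exists2 k : R, 0 < k &
  forall T' C (m : {finite_measure set (borel (T * T')%type) -> \bar R}), close C m k ->
  forall x x', C (x, x') -> (rint x <= rint x' + e%:E /\ rint x' <= rint x + e%:E)%E.
Proof.
(* The parts of the rays to [x] and [x'] above the common height will have length at most [6 * eta],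
   and [M * (6 * eta)] is half of [e]. *)
move=> e0; pose eta := e / (12 * M).
have eta0 : 0 < eta by rewrite divr_gt0// mulr_gt0.
have [s sP] := @tree_net R T eta eta0.
have e20 : 0 < e / 2 by rewrite divr_gt0.
(* Finiteness of the net turns the pointwise radii of [near_ray] into a single one. *)
have [k1 k10 k1P] := @common_radius T s _
  (fun x r r' rr'
    (H : forall T' C (m : {finite_measure set (borel (T * T')%type) -> \bar R}), close C m r -> _)
    T' C m Cm => H T' C m (close_le rr' Cm))
  (fun x => near_ray cf f0 fM x e20).
exists (Order.min k1 eta); first by rewrite lt_min k10.
set k := Order.min k1 eta => T' C m Cm x x' Cx.
have k0 : 0 <= k := close_ge0 Cm.
have kk1 : k <= k1 by rewrite ge_min lexx.
have keta : k <= eta by rewrite ge_min lexx orbT.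
have [xi xis xix] := sP x.
have [xi' Cxi] := close_left Cm xi.
have He := k1P xi xis T' C m (close_le kk1 Cm) xi' Cxi.
(* Lowering [gp x xi] by [3 * k] gives a height below which the rays agree in both trees. The part
   left above it is at most [eta + 3 * k] on the side of [x], and [2 * k] more on the side of
   [x']. *)
pose a := Order.max 0 (gp x xi - 3 * k).
have a0 : 0 <= a by rewrite le_max lexx.
have ax : a <= gp x xi by rewrite ge_max gp_ge0/=; lra.
have gg := close_gp Cm Cx Cxi; have hh := close_hgt Cm Cx.
have ax' : a <= gp x' xi'.
  by rewrite ge_max gp_ge0/=; move: gg; rewrite ler_norml => /andP[? ?]; lra.
have am : gp x xi - 3 * k <= a by rewrite le_max lexx orbT.
have gn := gp_near x xi; rewrite metric_sym in gn.
have xa : hgt x - a <= 6 * eta by lra.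
have xa' : hgt x' - a <= 6 * eta.
  by move: hh; rewrite ler_norml => /andP[? ?]; lra.
have Meta : M * (6 * eta) = e / 2.
  rewrite /eta; by field; rewrite gt_eqF.
have [H1 H2] := cut_compare a0 ax ax' He xa.
have aix' : a <= hgt x' by rewrite (le_trans ax') ?gp_lel.
have [_ H3] := @ray_int_cut R f M cf f0 fM T' x' a (introT andP (conj a0 aix')).
have e2 : e = e / 2 + e / 2 by lra.
split; first by apply: (le_trans H1); rewrite Meta -e2.
apply: (le_trans H3); rewrite [in leRHS]e2 EFinD addeA; apply: leeD => //.
by rewrite lee_fin -Meta ler_wpM2l// ltW.
Qed.

Lemma psi_close T (e : R) : 0 < e -> exists2 k : R, 0 < k &
  forall T', (dGHP T T' < k%:E)%E ->
    (\int[psi_measure T]_z (f z)%:E <= \int[psi_measure T']_z (f z)%:E + e%:E /\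
     \int[psi_measure T']_z (f z)%:E <= \int[psi_measure T]_z (f z)%:E + e%:E)%E.
Proof.
move=> e0; have [K K0 HK] := hgt_bounded T.
(* As [k <= 1], heights in [T'] are at most [K + 2], so [L] bounds the ray integrals of both trees.
   Likewise the 2 in [A] covers the excess [2 * k] of the mass of the coupling. *)
pose L := M * (K + 2); have L0 : 0 < L by rewrite mulr_gt0//; lra.
have AT : mass T setT \is a fin_num by rewrite fin_num_measure.
pose A := fine (mass T setT) + 2.
have A0 : 0 < A by have : 0 <= fine (mass T setT) by [rewrite fine_ge0|]; rewrite /A; lra.
have eA : 0 < e / (2 * A) by rewrite divr_gt0// mulr_gt0.
have [k1 k10 k1P] := @close_ray_int T _ eA.
have eL : 0 < e / (10 * L) by rewrite divr_gt0// mulr_gt0.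
pose k := Order.min k1 (Order.min 1 (e / (10 * L))).
have k0 : 0 < k by rewrite !lt_min k10 ltr01.
have [kk1 [k_1 kL]] : k <= k1 /\ k <= 1 /\ k <= e / (10 * L).
  by rewrite /k !ge_min !lexx ?orbT.
exists k => // T' /dGHP_lt_close[C [m Cm]].
have mfin := finite_lty m measurableT.
have mTA : (m setT <= A%:E)%E.
  have := close_set1 Cm measurableT; rewrite -(fineK AT) -EFinD.
  move=> /le_trans; apply; rewrite lee_fin /A; lra.
rewrite !(integral_psi_ray_int cf f0).
have mu := @measurable_ray_int R f cf f0 T; have mv := @measurable_ray_int R f cf f0 T'.
have uL (x : T) : (0 <= ray_int f x <= L%:E)%E.
  rewrite ray_int_ge0//= (le_trans (ray_int_le cf f0 fM x))// lee_fin ler_wpM2l ?(ltW M0)//.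
  by have := HK x; lra.
have vL (x' : T') : (0 <= ray_int f x' <= L%:E)%E.
  rewrite ray_int_ge0//= (le_trans (ray_int_le cf f0 fM x'))// lee_fin ler_wpM2l ?(ltW M0)//.
  have [x Cx] := close_right Cm x'; have := close_hgt Cm Cx.
  by rewrite ler_norml => /andP[? ?]; have := HK x; lra.
have mu1 := measurableT_comp mu (@measurable_fst_borel R T T').
have mv1 := measurableT_comp mv (@measurable_snd_borel R T T').
have [[mC _ _ _] _ c3 c4 c5] := Cm.
have T'fin := finite_lty (mass T') measurableT.
have [a1 a2] := near_measure_scale (m := image_measure m (@measurable_fst_borel R T T'))
  mfin (finite_lty (mass T) measurableT) c3 L0 mu uL.
have [b1 b2] := near_measure_scale (m := image_measure m (@measurable_snd_borel R T T'))
  mfin T'fin c4 L0 mv vL.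
have e1 := integral_image_measure m (@measurable_fst_borel R T T') mu (fun x => ray_int_ge0 f0 x).
have e2 := integral_image_measure m (@measurable_snd_borel R T T') mv (fun x => ray_int_ge0 f0 x).
rewrite e1 in a1 a2; rewrite e2 in b1 b2.
have mN : measurable (~` (C : set (borel (T * T')%type))) by exact: measurableC.
have d1 := @integral_le_off _ _ R m (fun p => ray_int f p.1) (fun p => ray_int f p.2) (~` C)
  L (e / (2 * A)) k A mu1 mv1 mN (fun p => uL p.1) (fun p => ray_int_ge0 f0 p.2)
  (ltW L0) (ltW eA) c5 mTA _.
have d2 := @integral_le_off _ _ R m (fun p => ray_int f p.2) (fun p => ray_int f p.1) (~` C)
  L (e / (2 * A)) k A mv1 mu1 mN (fun p => vL p.2) (fun p => ray_int_ge0 f0 p.1)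
  (ltW L0) (ltW eA) c5 mTA _.
have Cp (p : T * T') : ~ (~` C) p -> C (p.1, p.2) by case: p => x x' /contrapT.
have {}d1 := d1 (fun p nCp => proj1 (k1P T' C m (close_le kk1 Cm) p.1 p.2 (Cp p nCp))).
have {}d2 := d2 (fun p nCp => proj2 (k1P T' C m (close_le kk1 Cm) p.1 p.2 (Cp p nCp))).
have tot := error_budget L0 A0 kL.
split; [exact: lee_chain a2 d1 b1 tot|exact: lee_chain b2 d2 a1 tot].
Qed.

End psi_continuity.

Section weak_continuity.
Context {R : realType}.
Variables (g : tree_height R -> R) (M : R).
Hypotheses (cg : continuous g) (M0 : 0 < M) (gM : forall z, `|g z| <= M).

Let mg : measurable_fun [set: borel (tree_height R)] (g : borel (tree_height R) -> R).
Proof. exact: (@continuous_borelR R (tree_height R)). Qed.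

Let integrable_bounded (nu : finite_measures R) (u : borel (tree_height R) -> R) :
  measurable_fun setT u -> (forall z, `|u z| <= M) -> nu.-integrable setT (EFin \o u).
Proof.
move=> mu uM; apply/integrableP; split; first exact/measurable_EFinP.
apply: (@le_lt_trans _ _ (\int[nu]_z M%:E)%E).
  apply: ge0_le_integral => //.
  - by apply: measurableT_comp => //; exact/measurable_EFinP.
  - by move=> z _; rewrite /= lee_fin.
rewrite (integral_cst nu measurableT M%:E) lte_mul_pinfty ?lee_fin ?(ltW M0)//.
exact: finite_lty.
Qed.

(** Reduces a signed [g] to two nonnegative functions bounded by [2 * M]. The constant one is kept
    since the total mass also varies with the tree. *)
Let Rintegral_shift (nu : finite_measures R) :
  (\int[nu]_z g z = fine (\int[nu]_z (g z + M)%:E)%E - fine (\int[nu]_z M%:E)%E)%R.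
Proof.
have i1 := integrable_bounded nu mg gM.
have i2 : nu.-integrable setT (EFin \o cst M).
  by apply: integrable_bounded => // z; rewrite /= gtr0_norm.
have -> : (\int[nu]_z (g z + M)%:E = \int[nu]_z (g z)%:E + \int[nu]_z M%:E)%E.
  by rewrite -(integralD measurableT i1 i2).
have f1 : (\int[nu]_z (g z)%:E)%E \is a fin_num by exact: integrable_fin_num i1.
have f2 : (\int[nu]_z M%:E)%E \is a fin_num by exact: integrable_fin_num i2.
by rewrite fineD// addrK.
Qed.

Let psi_fin (u : tree_height R -> R) T : continuous u -> (forall z, 0 <= u z <= 2 * M) ->
  (\int[psi_measure T]_z (u z)%:E)%E \is a fin_num.
Proof.
move=> cu uM; rewrite ge0_fin_numE; last first.
  by apply: integral_ge0 => z _; rewrite lee_fin; case/andP: (uM z).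
apply: (@le_lt_trans _ _ (\int[psi_measure T]_z (2 * M)%:E)%E).
  apply: ge0_le_integral => //.
  - by move=> z _; rewrite lee_fin; case/andP: (uM z).
  - by apply/measurable_EFinP; exact: (@continuous_borelR R (tree_height R)).
  - by move=> z _; rewrite lee_fin; case/andP: (uM z).
rewrite (integral_cst _ measurableT (2 * M)%:E) lte_mul_pinfty ?lee_fin ?mulr_ge0 ?(ltW M0)//.
exact: finite_lty.
Qed.

Let psi_near (u : tree_height R -> R) T (e : R) : continuous u ->
  (forall z, 0 <= u z <= 2 * M) -> 0 < e -> exists2 k : R, 0 < k &
  forall T', (dGHP T T' < k%:E)%E ->
  `|fine (\int[psi_measure T]_z (u z)%:E)%E - fine (\int[psi_measure T']_z (u z)%:E)%E| <= e.
Proof.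
move=> cu uM e0; have M20 : 0 < 2 * M by rewrite mulr_gt0.
have [k k0 kP] := psi_close cu M20 (fun z => proj1 (andP (uM z))) (fun z => proj2 (andP (uM z))) T e0.
exists k => // T' /kP.
rewrite -(fineK (psi_fin T cu uM)) -(fineK (psi_fin T' cu uM)) -!EFinD !lee_fin ler_norml.
by move=> [? ?]; apply/andP; split; lra.
Qed.

Lemma psi_weak T (e : R) : 0 < e -> exists2 k : R, 0 < k &
  forall T', (dGHP T T' < k%:E)%E ->
  `|\int[psi_measure T]_z g z - \int[psi_measure T']_z g z| <= e.
Proof.
move=> e0; have e20 : 0 < e / 2 by rewrite divr_gt0.
have c1 : continuous (fun z => g z + M).
  by move=> z; apply: cvgD; [exact: cg|exact: cvg_cst].
have b1 z : 0 <= g z + M <= 2 * M.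
  by have := gM z; rewrite ler_norml => /andP[? ?]; apply/andP; split; lra.
have c2 : continuous (fun z : tree_height R => M) by move=> z; exact: cvg_cst.
have b2 (z : tree_height R) : 0 <= M <= 2 * M by move: M0 => ?; apply/andP; split; lra.
have [k1 k10 H1] := psi_near T c1 b1 e20.
have [k2 k20 H2] := psi_near T c2 b2 e20.
exists (Order.min k1 k2); first by rewrite lt_min k10.
move=> T' TT'; rewrite !Rintegral_shift.
have h1 := H1 T' (lt_le_trans TT' _); have h2 := H2 T' (lt_le_trans TT' _).
have {}h1 := h1 ltac:(by rewrite lee_fin ge_min lexx).
have {}h2 := h2 ltac:(by rewrite lee_fin ge_min lexx orbT).
have sub4 (a b c d : R) : a - c - (b - d) = (a - b) - (c - d) by ring.
by rewrite sub4 [e]splitr; apply: (le_trans (ler_normB _ _)); exact: lerD.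
Qed.

End weak_continuity.

Lemma continuous_Psi (R : realType) : continuous (@Psi R).
Proof.
move=> tau A; rewrite nbhsE => -[U [[D' sD UE] Utau] UA].
rewrite -UE in Utau; have [B D'B Btau] := Utau.
have [E sE EB] := sD _ D'B.
suff : nbhs tau (@Psi R @^-1` B).
  apply: filterS => sigma Bsigma; apply: UA; rewrite -UE; by exists B.
(* A basic open set is a finite intersection of subbasic ones, so a single test function can be
   treated at a time. *)
rewrite -EB; rewrite -EB in Btau.
rewrite preimage_bigcap; apply: filter_bigI => i iE.
have := sE _ iE; rewrite inE => -[ci [M iM] oi].
have Bi := Btau i iE.
apply: open_nbhs_nbhs; split; last exact: Bi.
(* A neighbourhood must contain a [GHP_open] set, so the ball condition is checked at every [sigma]
   of the preimage and not only at [tau]. *)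
move=> sigma Wsigma /=.
have [e e0 eV] : exists2 e : R, 0 < e & forall c, `|(\int[Psi sigma]_z i.1 z) - c| < e -> i.2 c.
  have : nbhs (\int[Psi sigma]_z i.1 z) i.2 by apply: open_nbhs_nbhs; split.
  by move=> /(nbhs_ballP (\int[Psi sigma]_z i.1 z))[e e0 eV]; exists e.
have M0 : 0 < `|M| + 1 by have := normr_ge0 M; lra.
have iM' z : `|i.1 z| <= `|M| + 1.
  by have := iM z; have := ler_norm M; lra.
have e20 : 0 < e / 2 by rewrite divr_gt0.
have [k k0 kP] := psi_weak ci M0 iM' (repr sigma) e20.
exists k => // rho /kP H; apply: eV; apply: (le_lt_trans H); lra.
Qed.

Theorem theorem1p3 (R : realType) :
  exists Psi : tree_space R -> finite_measures R,
    [/\ forall T : weighted_tree R, is_Psi T (Psi (tree_class T)),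
        forall (T : weighted_tree R) (nu : finite_measures R),
          is_Psi T nu -> forall A : set (borel (tree_height R)),
          measurable A -> nu A = Psi (tree_class T) A &
        continuous Psi].
Proof.
exists (@Psi R); split; [exact: is_Psi_Psi| |exact: continuous_Psi].
by move=> T nu H; exact: is_Psi_unique H (is_Psi_Psi T).
Qed.
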